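(* Let $r\in(1,\infty)$. The space $(\mathrm{Diff}_{-\infty}(\mathbb R),F)$ is geodesically incomplete. More precisely, given any initial conditions $\varphi(0)=\mathrm{id}\in\mathrm{Diff}_{-\infty}(\mathbb R)$, $\varphi_t(0)=u_0\in T_{\mathrm{id}}\mathrm{Diff}_{-\infty}(\mathbb R)=\mathfrak g_{-\infty}$, the geodesic $$\varphi(t,x)=x+\int_{-\infty}^x\left(\left(\frac{t\,u_0'(y)}{r}+1\right)^r-1\right)dy$$ exists for all time $t>0$ if and only if $u_0'(x)\ge 0$ for all $x\in\mathbb R$. If there exists a point $x_0$ with $u_0'(x_0)<0$, then the geodesic only exists for finite time $T^*(u_0)$, with $$T^*(u_0)=-\frac{r}{\inf_{x\in\mathbb R}u_0'(x)} .$$ At time $T^*(u_0)$ we have $\min_{x\in\mathbb R}\varphi_x(T^*(u_0),x)=0$, and thus the corresponding solution $u=\varphi_t\circ\varphi^{-1}$ to the $r$-Hunter--Saxton equation $$\left(u_x|u_x|^{r-2}\right)_{xt}+\left(u_x|u_x|^{r-2}\right)_xu_x+\left((u_x|u_x|^{r-2})_xu\right)_x=0$$ (equivalently, to the generalized Proudman--Johnson equation $u_{txx}+(1+2\lambda)u_xu_{xx}+uu_{xxx}=0$ with $\lambda=r^{-1}$) blows up at the same time.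
   Context: $W^{\infty,1}(\mathbb R)=\bigcap_{k\ge 0}W^{k,1}(\mathbb R)$. The group $\mathrm{Diff}_{-\infty}(\mathbb R)=\{\varphi=\mathrm{id}+f: f'\in W^{\infty,1}(\mathbb R),\ f'>-1,\ \lim_{x\to-\infty}f(x)=0\}$ is a Fréchet Lie group with Lie algebra $\mathfrak g_{-\infty}=\{u: u'\in W^{\infty,1}(\mathbb R),\ \lim_{x\to-\infty}u(x)=0\}$. Tangent vectors at $\varphi$ are of the form $h=X\circ\varphi$ with $X\in\mathfrak g_{-\infty}$, and the right-invariant Finsler metric $F$ is $$F_\varphi(h)=\left(\int_{\mathbb R}|(h\circ\varphi^{-1})'|^r\,dx\right)^{1/r}=\left(\int_{\mathbb R}|X'|^r\,dx\right)^{1/r}.$$ Geodesics are paths in $\mathrm{Diff}_{-\infty}(\mathbb R)$ locally minimizing the length $\int F_\varphi(\varphi_t)\,dt$, with constant speed; the geodesic starting at $\mathrm{id}$ with velocity $u_0$ is given by the displayed formula for $\varphi(t,x)$. The geodesic exists up to a given time if it remains in $\mathrm{Diff}_{-\infty}(\mathbb R)$ up to that time. Geodesic incompleteness means that not all geodesics exist for all time. Subscripts $t,x$ denote partial derivatives. *)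

(* Defs.v *)
From HB Require Import structures.
From mathcomp Require Import all_boot all_order all_algebra.
From mathcomp Require Import all_classical all_reals all_analysis.

Set Implicit Arguments.
Unset Strict Implicit.
Unset Printing Implicit Defensive.

Import Order.TTheory GRing.Theory Num.Theory.
Import numFieldNormedType.Exports.

Local Open Scope ring_scope.
Local Open Scope classical_set_scope.

Section DiffGroup.
Context {R : realType}.
Implicit Types (f g u phi h : R -> R) (k : nat).

Local Notation mu := (@lebesgue_measure R).

(* An element of the intersection of all W^{k,1}(R) has exactly one continuous
   representative; it is C^oo and its classical derivatives are its weak ones.
   Functions are identified with that representative, which is what gives
   pointwise conditions such as f' > -1 a meaning. *)
Definition Winf1 f : Prop :=
  forall k, (forall x, derivable f^`(k) x 1) /\
            mu.-integrable setT (EFin \o f^`(k)).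

Definition lie_algebra u : Prop :=
  [/\ forall x, derivable u x 1, Winf1 u^`() & u x @[x --> -oo] --> 0].

Definition Diff phi : Prop :=
  let f := fun x => phi x - x in
  lie_algebra f /\ forall x, -1 < f^`() x.

Definition tangent phi h : Prop :=
  exists2 X, lie_algebra X & h = X \o phi.

Definition inverse phi : R -> R := 'pinv_(fun=> 0) setT phi.

Definition finsler (r : R) phi h : \bar R :=
  'N[mu]_(r%:E) [EFin \o (h \o inverse phi)^`()]%E.

(* The seminorms || (f')^(k) ||_{L^1} defining the Frechet topology of the
   model space; the constant is fixed by the limit 0 at -oo. *)
Definition seminorm k f : \bar R := (\int[mu]_x (`|derive1n k.+1 f x|)%:E)%E.

(* A C^1 curve, on an interval I, in the open subset of an affine Frechet space
   that Diff is; [v] is its velocity, one-sided at end points of I. *)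
Definition C1_path (I : set R) (gamma v : R -> R -> R) : Prop :=
  forall t, I t ->
    [/\ Diff (gamma t), tangent (gamma t) (v t),
        forall k, seminorm k
            (fun x => (gamma s x - gamma t x) / (s - t) - v t x)
          @[s --> within I t^'] --> 0%E
      & forall k, seminorm k (fun x => v s x - v t x)
          @[s --> within I (nbhs t)] --> 0%E].

Definition path_length (r a b : R) (gamma v : R -> R -> R) : \bar R :=
  (\int[mu]_(t in `[a, b]) finsler r (gamma t) (v t))%E.

Definition geodesic (r : R) (I : set R) (gamma v : R -> R -> R) : Prop :=
  [/\ C1_path I gamma v,
      (forall s t, I s -> I t ->
         finsler r (gamma s) (v s) = finsler r (gamma t) (v t))
    & forall t0, I t0 -> exists2 delta : R, 0 < delta &
        forall a b, I a -> I b -> `|a - t0| < delta -> `|b - t0| < delta ->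
        a < b ->
        forall eta w, C1_path `[a, b] eta w ->
          eta a = gamma a -> eta b = gamma b ->
          (path_length r a b gamma v <= path_length r a b eta w)%E].

Definition time_interval (T : \bar R) : set R :=
  [set t | 0 <= t /\ (t%:E < T)%E].

Definition geodesic_from (r : R) phi0 h0 (T : \bar R) gamma v : Prop :=
  [/\ geodesic r (time_interval T) gamma v, gamma 0 = phi0 & v 0 = h0].

Definition geodesic_exists (r : R) phi0 h0 (T : \bar R) : Prop :=
  exists gamma v, geodesic_from r phi0 h0 T gamma v.

Definition geodesically_complete (r : R) : Prop :=
  forall phi0 h0, Diff phi0 -> tangent phi0 h0 ->
    geodesic_exists r phi0 h0 +oo%E.

(* Only meaningful while the base of the power is nonnegative: `^ has a
   conventional value at negative bases. *)
Definition flow (r : R) u0 (t x : R) : R :=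
  x + \int[mu]_(y in `]-oo, x]) ((t * derive1 u0 y / r + 1) `^ r - 1).

End DiffGroup.

Section Equations.
Context {R : realType}.
Implicit Types (u psi : R -> R -> R) (T : R).

Definition Dt u : R -> R -> R := fun t x => (u ^~ x)^`() t.
Definition Dx u : R -> R -> R := fun t x => (u t)^`() x.

Definition eulerian (phi : R -> R -> R) : R -> R -> R :=
  fun t => Dt phi t \o inverse (phi t).

(* u_txx + (1 + 2 lambda) u_x u_xx + u u_xxx = 0 on ]0, T[ x R *)
Definition Proudman_Johnson_solution (lambda : R) T u : Prop :=
  forall t x, 0 < t < T ->
    [/\ derivable (u ^~ x) t 1, derivable (Dt u t) x 1,
        derivable (Dx (Dt u) t) x 1,
        [/\ derivable (u t) x 1, derivable (Dx u t) x 1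
          & derivable (Dx (Dx u) t) x 1]
      & Dx (Dx (Dt u)) t x
        + (1 + 2 * lambda) * Dx u t x * Dx (Dx u) t x
        + u t x * Dx (Dx (Dx u)) t x = 0].

Fixpoint Cn2 (n : nat) psi : Prop :=
  continuous (fun z : R * R => psi z.1 z.2) /\
  if n is n'.+1 then
    [/\ forall t x, derivable (psi ^~ x) t 1,
        forall t x, derivable (psi t) x 1, Cn2 n' (Dt psi) & Cn2 n' (Dx psi)]
  else True.

Definition test_function T psi : Prop :=
  (forall n, Cn2 n psi) /\
  exists a b M : R, [/\ 0 < a, b < T &
    forall t x, psi t x != 0 -> a <= t <= b /\ `|x| <= M].

(* For r <> 2, m = u_x |u_x|^(r-2) is in general not classically twice
   differentiable where u_x vanishes, so that
     m_xt + m_x u_x + (m_x u)_x = 0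
   is read in the sense of distributions on ]0, T[ x R, with
   <m_xt, psi> = <m, psi_tx>,  <m_x u_x, psi> = - <m, (u_x psi)_x>  and
   <(m_x u)_x, psi> = <m, (u psi_x)_x>.  Where u_x = 0, m evaluates to 0. *)
Definition Hunter_Saxton_solution (r T : R) u : Prop :=
  let m t x := Dx u t x * `|Dx u t x| `^ (r - 2) in
  forall psi, test_function T psi ->
    let F (z : R * R) :=
      m z.1 z.2 * (Dx (Dt psi) z.1 z.2
                   - Dx (fun t x => Dx u t x * psi t x) z.1 z.2
                   + Dx (fun t x => u t x * Dx psi t x) z.1 z.2) in
    let mu2 := (@lebesgue_measure R \x @lebesgue_measure R)%E in
    mu2.-integrable setT (EFin \o F) /\ (\int[mu2]_z (F z)%:E = 0)%E.

(* Blow-up of the C^1 norm: || u_x(t, .) ||_oo --> +oo as t increases to T. *)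
Definition blows_up_at T u : Prop :=
  ereal_sup (range (fun x => (`|Dx u t x|)%:E)) @[t --> T^'-] --> +oo%E.

End Equations.

(* Main.v *)
(* Put g = r phi_x^(1/r).  If h = X o phi, then g moves with velocity
   X'(phi) phi_x^(1/r), whose L^r norm is F_phi(h): in the coordinate g the
   metric is the flat L^r norm on an open convex set of functions.  For 1 < r
   that norm is strictly convex, so constant-speed minimisers are exactly the
   segments; hence the geodesic from id has phi_x = (1 + t u_0'/r)^r, and it
   stays in the group as long as this base stays bounded below by a positive
   constant, that is up to T* = - r / inf u_0'.

   With a = u_0' and h = 1 + t a / r, one has u_x o phi = a / h.  The
   Proudman-Johnson equation follows by differentiating such formulas, and
   u_x at the image of a minimum point of a tends to -oo at T*.  For the weak
   Hunter-Saxton equation, the change of variables x = phi(t, y) turns the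
   integrand into d_t A + d_y B with
     A = a |a|^(r-2) h psi_x(t, phi),   B = - |a|^r h^(-r) psi(t, phi) / r. *)

Require Import Defs.
From HB Require Import structures.
From mathcomp Require Import all_boot all_order all_algebra.
From mathcomp Require Import all_classical all_reals all_analysis.
From mathcomp Require Import measurable_realfun ring lra.

Set Implicit Arguments.
Unset Strict Implicit.
Unset Printing Implicit Defensive.

Import Order.TTheory GRing.Theory Num.Theory.
Import numFieldNormedType.Exports.

Local Open Scope ring_scope.
Local Open Scope classical_set_scope.

(** * Differentiation rules in one real variable *)

Section Calculus.
Context {R : realType}.
Implicit Types (f g : R -> R) (x a b p : R).

(** Minimality is tested against every [C1_path] of the group, so lengths must be bounded below
    without calculus in $L^r$: each curve is reduced to one scalar function of time, to which the
    real fundamental theorem applies. Minimality is also only local in time. Rigidity thus makes the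
    velocity in the coordinate locally constant, and a zero derivative together with one-sided
    continuity at time 0 extends the initial velocity to the whole interval. Positivity must be
    uniform for a path to move within the group. Elements of $W^{1,1}$ vanish at both ends of the
    line, so a negative infimum is attained: pointwise positivity gives a gap, and at [Tstar] the
    base has an actual zero. [C1_path] involves all seminorms, hence families dominated by one
    integrable function uniformly in time, at each order of differentiation. No differentiability in
    two variables is available for the flow or its inverse. Chain rule, inverse and mixed
    derivatives are obtained from one-variable mean values, whose intermediate points are controlled
    by Lipschitz bounds. *)

Lemma is_derive_fD f g x a b : is_derive x (1 : R) f a -> is_derive x (1 : R) g b ->
  is_derive x (1 : R) (fun y => f y + g y) (a + b).
Proof. by move=> df dg; exact: is_deriveD. Qed.

Lemma is_derive_fN f x a : is_derive x (1 : R) f a ->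
  is_derive x (1 : R) (fun y => - f y) (- a).
Proof. by move=> df; exact: is_deriveN. Qed.

Lemma is_derive_fB f g x a b : is_derive x (1 : R) f a -> is_derive x (1 : R) g b ->
  is_derive x (1 : R) (fun y => f y - g y) (a - b).
Proof. by move=> df dg; exact: is_deriveB. Qed.

Lemma is_derive_fM f g x a b : is_derive x (1 : R) f a -> is_derive x (1 : R) g b ->
  is_derive x (1 : R) (fun y => f y * g y) (a * g x + f x * b).
Proof.
move=> df dg; apply: (@is_derive_eq _ _ _ (f * g)).
by rewrite addrC /GRing.scale /= [g x * a]mulrC.
Qed.

Lemma is_derive_comp f g x a b : is_derive (g x) (1 : R) f a -> is_derive x (1 : R) g b ->
  is_derive x (1 : R) (fun y => f (g y)) (a * b).
Proof. by move=> df dg; exact: is_derive1_comp. Qed.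

Lemma is_derive_pow f x a p : 0 < f x -> is_derive x (1 : R) f a ->
  is_derive x (1 : R) (fun y => f y `^ p) (p * f x `^ (p - 1) * a).
Proof.
move=> f0 df; apply: (@is_derive_comp (fun y => y `^ p)) => //.
exact: is_derive1_powR.
Qed.

Lemma is_derive_fV f x a : f x != 0 -> is_derive x (1 : R) f a ->
  is_derive x (1 : R) (fun y => (f y)^-1) (- (f x) ^- 2 * a).
Proof. by move=> f0 df; exact: is_deriveV. Qed.

Lemma is_derive_cont f x a : is_derive x (1 : R) f a -> {for x, continuous f}.
Proof. by case=> df _; exact/differentiable_continuous/derivable1_diffP. Qed.

Lemma is_derive_uniq f x a b :
  is_derive x (1 : R) f a -> is_derive x (1 : R) f b -> a = b.
Proof. by case=> _ <- [_ <-]. Qed.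

Lemma is_derive1E f x a : is_derive x (1 : R) f a -> f^`() x = a.
Proof. by rewrite derive1E; case. Qed.

Lemma is_derive_fun f g : (forall x, is_derive x (1 : R) f (g x)) -> f^`() = g.
Proof. by move=> fg; apply/funext => x; exact: is_derive1E. Qed.

Lemma derivable_is_derive f x : derivable f x 1 -> is_derive x (1 : R) f (f^`() x).
Proof. by move=> df; rewrite derive1E; exact: derivableP. Qed.

Lemma powR_cont p x : 0 < x -> {for x, continuous (fun y : R => y `^ p)}.
Proof. by move=> x0; apply: is_derive_cont; exact: is_derive1_powR. Qed.

Lemma continuous_pow f p : (forall x, 0 < f x) -> continuous f ->
  continuous (fun x => f x `^ p).
Proof.
move=> f0 cf x; apply: (@continuous_comp _ _ _ f (fun y => y `^ p) x (cf x)).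
exact: powR_cont.
Qed.

(** The end points come in either order, so that it applies to increments of any sign. *)
Lemma MVT_mean f (df : R -> R) a b :
  (forall x, a <= x <= b \/ b <= x <= a -> is_derive x (1 : R) f (df x)) ->
  exists2 c, (a <= c <= b \/ b <= c <= a) & f b - f a = df c * (b - a).
Proof.
wlog ab : a b / a <= b.
  move=> H; have [ab|/ltW ba] := leP a b; first exact: H.
  move=> d; have [|c ? e] := H b a ba; first by move=> x [?|?]; apply: d; [right|left].
  by exists c; [tauto|rewrite -opprB e -mulrN opprB].
move=> d; have [| |c] := @MVT_segment _ f df a b ab.
- by move=> x; rewrite in_itv /= => /andP[/ltW ax /ltW xb]; apply: d; left; rewrite ax.
- apply: derivable_within_continuous => x; rewrite in_itv /= => xab.
  by apply: ex_derive; apply: d; left.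
- by rewrite in_itv /= => ? e; exists c => //; left.
Qed.

End Calculus.

(** * Integrals over the line, tails, and primitives from [-oo] *)

Section Integration.
Context {R : realType}.
Implicit Types (f g : R -> R) (x y a b c e M : R).
Local Notation mu := (@lebesgue_measure R).
Local Notation Int f := (mu.-integrable setT (EFin \o f)).

Lemma measurable_half x : measurable (`]-oo, x] : set R).
Proof. exact: measurable_itv. Qed.

Lemma Int_le f g : continuous f -> (forall x, `|f x| <= g x) -> Int g -> Int f.
Proof.
move=> cf fg ig; apply: (le_integrable _ _ _ ig) => //.
  by apply/measurable_EFinP; exact: continuous_measurable_fun.
by move=> x _ /=; rewrite lee_fin (le_trans (fg x))// ler_norm.
Qed.

Lemma IntD f g : Int f -> Int g -> Int (fun x => f x + g x).
Proof. by move=> i1 i2; apply: eq_integrable (integrableD _ i1 i2). Qed.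

Lemma IntB f g : Int f -> Int g -> Int (fun x => f x - g x).
Proof.
by move=> i1 i2; apply: eq_integrable (integrableB _ i1 i2).
Qed.

Lemma IntZ c f : Int f -> Int (fun x => c * f x).
Proof.
by move=> i1; apply: eq_integrable (integrableZl _ c i1).
Qed.

Lemma Int_norm f : Int f -> Int (fun x => `|f x|).
Proof. exact: integrable_norm. Qed.

Lemma Int_sub f (A : set R) : measurable A -> Int f -> mu.-integrable A (EFin \o f).
Proof. by move=> mA; apply: integrableS. Qed.

Lemma Int_mul_bounded f g M : continuous f -> continuous g -> Int f ->
  (forall x, `|g x| <= M) -> Int (fun x => f x * g x).
Proof.
move=> cf cg i1 gM; apply: (@Int_le _ (fun x => M * `|f x|)).
- by move=> x; exact: (continuousM (cf x) (cg x)).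
- by move=> x; rewrite normrM mulrC ler_wpM2r.
- exact/IntZ/Int_norm.
Qed.

Lemma Rint_le f g : Int f -> Int g -> (forall x, f x <= g x) ->
  \int[mu]_x f x <= \int[mu]_x g x.
Proof. by move=> i1 i2 fg; apply: le_Rintegral. Qed.

(** A positive value [f x] persists as at least [f x / 2] on an interval of length [d] and makes the
    integral positive. This is how equality of integrals becomes pointwise equality in
    [curve_rigidity]. *)
Lemma Rint_eq0 f : continuous f -> Int f -> (forall x, 0 <= f x) ->
  \int[mu]_x f x <= 0 -> forall x, f x = 0.
Proof.
move=> cf fi f0 If x; apply/eqP; rewrite eq_le f0 andbT leNgt; apply/negP => fx.
have : {for x, continuous f} by exact: cf.
move=> /cvgrPdist_lt /(_ (f x / 2) ltac:(by rewrite divr_gt0)).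
move=> [d /= d0 Hd].
have H y : x - d/2 <= y <= x + d/2 -> f x / 2 <= f y.
  move=> /andP[y1 y2].
  have : `|f x - f y| < f x / 2.
    by apply: Hd; rewrite /= ltr_norml; apply/andP; split; lra.
  by rewrite ltr_norml => /andP[? ?]; lra.
have : f x / 2 * d <= \int[mu]_x f x.
  rewrite -lee_fin /Rintegral fineK; last exact: integrable_fin_num.
  have <- : (\int[mu]_(y in `[(x - d/2)%R, (x + d/2)%R]) (cst (f x / 2)%:E) y = (f x / 2 * d)%:E)%E.
    rewrite integral_cst//= lebesgue_measure_itv /= lte_fin ifT; last by lra.
    by rewrite -EFinD -EFinM; congr (_%:E); lra.
  apply: (@le_trans _ _ (\int[mu]_(y in `[(x - d/2)%R, (x + d/2)%R]) (f y)%:E)%E).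
    apply: ge0_le_integral => //=.
    - by move=> y _; rewrite lee_fin; apply: divr_ge0 => //; exact: ltW.
    - apply/measurable_EFinP; apply: (@measurable_funS _ _ _ _ setT) => //.
      exact: continuous_measurable_fun.
  apply: ge0_subset_integral => //=.
    by apply/measurable_EFinP; exact: continuous_measurable_fun.
  by move=> y _; rewrite lee_fin.
by apply/negP; rewrite -ltNge (le_lt_trans If)// mulr_gt0// divr_gt0.
Qed.

Lemma FTC f f' a b : a <= b -> (forall x, is_derive x (1 : R) f (f' x)) -> continuous f' ->
  \int[mu]_(x in `[a, b]) f' x = f b - f a.
Proof.
rewrite le_eqVlt => /predU1P[<- _ _|ab df cf'].
  by rewrite set_itv1 Rintegral_set1 subrr.
rewrite /Rintegral (@continuous_FTC2 _ f' f) //.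
- exact: continuous_subspaceT.
- split => [x _||]; first exact: ex_derive.
  + by apply: cvg_at_right_filter; exact: (is_derive_cont (df a)).
  + by apply: cvg_at_left_filter; exact: (is_derive_cont (df b)).
- by move=> x _; exact: is_derive1E.
Qed.

Lemma mu_half_l x : mu `]-oo, x] = +oo%E.
Proof. by rewrite lebesgue_measure_itv /= ltNyr. Qed.

Lemma mu_half_r x : mu `[x, +oo[ = +oo%E.
Proof. by rewrite lebesgue_measure_itv /= ltry. Qed.

(** Otherwise [|f|] is at least [e] on a set of infinite measure and its integral diverges. The
    point found replaces a limit at infinity in the tail bounds. *)
Lemma Int_small f (A : set R) e : measurable A -> mu A = +oo%E -> Int f -> 0 < e ->
  exists2 y, A y & `|f y| < e.
Proof.
move=> mA muA fi e0; apply: contrapT => H.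
have {}H y : A y -> e <= `|f y|.
  by move=> Ay; rewrite leNgt; apply/negP => fy; apply: H; exists y.
have /integrableP[mf] := fi.
apply/negP; rewrite -leNgt.
have <- : (\int[mu]_(y in A) (cst e%:E) y = +oo)%E.
  by rewrite integral_cst// [X in (_ * X)%E]muA gt0_muley ?lte_fin.
apply: (@le_trans _ _ (\int[mu]_(y in A) `|f y|%:E)%E).
  apply: ge0_le_integral => //=.
  - by move=> y _; rewrite lee_fin ltW.
  - apply/measurable_EFinP; apply: (@measurable_funS _ _ _ _ setT) => //.
    by apply: measurableT_comp => //; exact/measurable_EFinP.
apply: ge0_subset_integral => //=.
by apply/measurable_EFinP; apply: measurableT_comp => //; exact/measurable_EFinP.
Qed.

Lemma Rint_sub_norm f (A B : set R) : measurable A -> measurable B -> A `<=` B ->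
  Int f -> `|\int[mu]_(x in A) f x| <= \int[mu]_(x in B) `|f x|.
Proof.
move=> mA mB AB fi.
have fiA : mu.-integrable A (EFin \o f) by exact: Int_sub.
apply: le_trans; first exact: le_normr_Rintegral.
apply: fine_le.
- by apply: integrable_fin_num => //; exact: (Int_sub mA (Int_norm fi)).
- by apply: integrable_fin_num => //; exact: (Int_sub mB (Int_norm fi)).
apply: ge0_subset_integral => //=.
by have /measurable_int := Int_sub mB (Int_norm fi).
Qed.

(** Apply the fundamental theorem from a point of the half-line where [|f|] is below [e]. No limit
    of [f] is assumed; that it is 0 follows from this bound in [cvg_Ny]. *)
Lemma le_tail_l f f' x : (forall x, is_derive x (1 : R) f (f' x)) -> continuous f' ->
  Int f -> Int f' -> `|f x| <= \int[mu]_(y in `]-oo, x]) `|f' y|.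
Proof.
move=> df cf' fi f'i; apply/ler_addgt0Pr => e e0.
have [|y /=] := @Int_small f `]-oo, x] e _ (mu_half_l x) fi e0; first exact: measurable_itv.
rewrite in_itv /= => yx fy.
rewrite -(subrK (f y) (f x)) (le_trans (ler_normD _ _))// lerD//; last exact: ltW.
rewrite -(FTC yx df cf'); apply: Rint_sub_norm => //.
by move=> z /=; rewrite !in_itv /= => /andP[].
Qed.

Lemma le_tail_r f f' x : (forall x, is_derive x (1 : R) f (f' x)) -> continuous f' ->
  Int f -> Int f' -> `|f x| <= \int[mu]_(y in `[x, +oo[) `|f' y|.
Proof.
move=> df cf' fi f'i; apply/ler_addgt0Pr => e e0.
have [|y /=] := @Int_small f `[x, +oo[ e _ (mu_half_r x) fi e0; first exact: measurable_itv.
rewrite in_itv /= andbT => xy fy.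
rewrite -(subrK (f y) (f x)) (le_trans (ler_normD _ _))// lerD//; last exact: ltW.
rewrite distrC -(FTC xy df cf'); apply: Rint_sub_norm => //.
by move=> z /=; rewrite !in_itv /= => /andP[->].
Qed.

(** The embedding of $W^{1,1}$ into $L^\infty$, with constant 1. *)
Lemma le_sup_int f f' x : (forall x, is_derive x (1 : R) f (f' x)) -> continuous f' ->
  Int f -> Int f' -> `|f x| <= \int[mu]_y `|f' y|.
Proof.
move=> df cf' fi f'i; apply: (le_trans (le_tail_l x df cf' fi f'i)).
rewrite -[leLHS]ger0_norm; last exact: Rintegral_ge0.
apply: (le_trans (@Rint_sub_norm (fun y => `|f' y|) `]-oo, x] setT _ _ _ _)) => //.
  exact: Int_norm.
by under eq_Rintegral do rewrite normr_id.
Qed.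

Lemma tail_cvg f (A : nat -> set R) : Int f -> (forall n, measurable (A n)) ->
  (forall x, \forall n \near \oo, ~ A n x) ->
  \int[mu]_(y in A n) f y @[n --> \oo] --> 0.
Proof.
move=> fi mA An.
have -> : (fun n => \int[mu]_(y in A n) f y) = (fun n => fine (\int[mu]_y ((f \_ (A n)) y)%:E)%E).
  by apply/funext => n; rewrite Rintegral_mkcond.
apply: (@fine_cvg _ _ _ _ _ 0).
rewrite -[0%:E](integral0 mu setT).
apply: (@dominated_cvg _ _ _ mu _ measurableT _ _ (fun x => `|f x|%:E)) => //=.
- move=> n; apply/measurable_EFinP.
  have /measurable_int/measurable_EFinP mf := fi.
  have /(measurable_restrictT f (mA n)).1 := measurable_funS measurableT (@subsetT _ (A n)) mf.
  by [].
- move=> x _; apply: cvg_near_cst.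
  apply: filterS (An x) => n nA; rewrite patchE memNset//.
- exact: Int_norm.
- move=> n x _; rewrite lee_fin patchE; case: ifP => // _; by rewrite normr0.
Qed.

Lemma tail_l f : Int f -> \int[mu]_(y in `]-oo, x]) f y @[x --> -oo] --> 0.
Proof.
move=> fi; apply/cvg_ninftyP => u uy; apply: (tail_cvg fi) => //.
move=> x; move/cvgrNyPlt : uy => /(_ x); apply: filterS => n /=.
by rewrite in_itv /= => un; apply/negP; rewrite -ltNge.
Qed.

Lemma tail_r f : Int f -> \int[mu]_(y in `[x, +oo[) f y @[x --> +oo] --> 0.
Proof.
move=> fi; apply/cvg_pinftyP => u uy; apply: (tail_cvg fi) => //.
move=> x; move/cvgryPgt : uy => /(_ x); apply: filterS => n /=.
by rewrite in_itv /= andbT => un; apply/negP; rewrite -ltNge.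
Qed.

Lemma cvg0_le (F : set_system R) (f g : R -> R) : Filter F ->
  (forall x, `|f x| <= g x) -> g x @[x --> F] --> 0 -> f x @[x --> F] --> 0.
Proof.
move=> FF fg g0; apply: norm_cvg0.
apply: (squeeze_cvgr _ (cvg_cst _) g0).
by apply: nearW => x /=; rewrite normr_ge0 fg.
Qed.

Lemma cvg_Ny f f' : (forall x, is_derive x (1 : R) f (f' x)) -> continuous f' ->
  Int f -> Int f' -> f x @[x --> -oo] --> 0.
Proof.
move=> df cf' fi f'i; apply: (cvg0_le _ (fun x => le_tail_l x df cf' fi f'i)).
exact: (tail_l (Int_norm f'i)).
Qed.

Lemma cvg_y f f' : (forall x, is_derive x (1 : R) f (f' x)) -> continuous f' ->
  Int f -> Int f' -> f x @[x --> +oo] --> 0.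
Proof.
move=> df cf' fi f'i; apply: (cvg0_le _ (fun x => le_tail_r x df cf' fi f'i)).
exact: (tail_r (Int_norm f'i)).
Qed.

(** The primitive that vanishes at [-oo]; it recovers an element of the Lie algebra from its
    slope. *)
Definition prim f x := \int[mu]_(y in `]-oo, x]) f y.

Lemma is_derive_prim f x : continuous f -> Int f -> is_derive x (1 : R) (prim f) (f x).
Proof.
move=> cf fi.
have [||||d e] := @continuous_FTC1 R f -oo%O x (x + 1).
- by rewrite ltrDl.
- exact: Int_sub.
- by rewrite ltNyr.
- exact: cf.
- by rewrite -[f x]e; exact: (derivable_is_derive d).
Qed.

Lemma prim_cvg f : Int f -> prim f x @[x --> -oo] --> 0.
Proof. exact: tail_l. Qed.

Lemma prim_norm f x : Int f -> `|prim f x| <= \int[mu]_y `|f y|.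
Proof. by move=> fi; apply: Rint_sub_norm => //; exact: measurable_half. Qed.

Lemma primB f g : Int f -> Int g -> prim (fun x => f x - g x) = (fun x => prim f x - prim g x).
Proof.
move=> i1 i2; apply/funext => x; rewrite /prim RintegralB//; exact: Int_sub.
Qed.

Lemma primZ c f : Int f -> prim (fun x => c * f x) = (fun x => c * prim f x).
Proof.
by move=> i1; apply/funext => x; rewrite /prim RintegralZl//; exact: Int_sub.
Qed.

Lemma prim_eq f f' : (forall x, is_derive x (1 : R) f (f' x)) -> continuous f' ->
  Int f' -> f x @[x --> -oo] --> 0 -> prim f' = f.
Proof.
move=> df cf' f'i f0; apply/funext => x; apply/subr0_eq.
pose k y := prim f' y - f y.
have dk y : is_derive y (1 : R) k 0.
  by rewrite -(subrr (f' y)); apply: is_derive_fB => //; exact: is_derive_prim.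
have k0 : k y @[y --> -oo] --> (0 : R).
  by rewrite -(subr0 0); apply: cvgB => //; exact: prim_cvg.
have kc : k = cst (k x) by apply/funext => y; exact: is_derive_0_is_cst.
have : k y @[y --> -oo] --> k x by rewrite {1}kc; exact: cvg_cst.
by move=> /(cvg_unique _ k0) ->.
Qed.

End Integration.

(** * Dominated and bounded families of functions, uniformly in a parameter *)

Section Classes.
Context {R : realType} {T : Type}.
Local Notation mu := (@lebesgue_measure R).
Local Notation Int f := (mu.-integrable setT (EFin \o f)).
Implicit Types (F G h : T -> R -> R) (J : set T) (k : nat) (p eps : R).
Implicit Types P Q S : (T -> R -> R) -> Prop.

(* Families indexed by [J], so that the bounds are uniform in a time parameter;
   [W k] below is the one-element case of [Wk], i.e. W^{k,1}. *)
Fixpoint smooth P J k F : Prop :=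
  P F /\ if k is k'.+1 then
    exists F', (forall t x, J t -> is_derive x (1 : R) (F t) (F' t x)) /\ smooth P J k' F'
  else True.

Definition dominated J F : Prop :=
  (forall t, J t -> continuous (F t)) /\
  exists g, Int g /\ forall t x, J t -> `|F t x| <= g x.

Definition bounded_family J F : Prop :=
  (forall t, J t -> continuous (F t)) /\
  exists M, forall t x, J t -> `|F t x| <= M.

Definition Wk J k F := smooth (dominated J) J k F.
Definition Bk J k F := smooth (bounded_family J) J k F.

Lemma smooth0 P J k F : smooth P J k F -> P F.
Proof. by case: k => [|k] []. Qed.

Lemma smoothS P J k F : smooth P J k.+1 F -> smooth P J k F.
Proof.
elim: k F => [|k IH] F; first by case.
by move=> [PF [F' [dF /IH ?]]]; split=> //; exists F'.
Qed.

Lemma WkS J k F : Wk J k.+1 F -> Wk J k F.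
Proof. exact: (@smoothS (dominated J)). Qed.

Lemma smoothD P J k F G :
  (forall F G, P F -> P G -> P (fun t x => F t x + G t x)) ->
  smooth P J k F -> smooth P J k G -> smooth P J k (fun t x => F t x + G t x).
Proof.
move=> PD; elim: k F G => [|k IH] F G.
  by move=> [pf _] [pg _]; split => //; exact: PD.
move=> [pf [F' [dF sF]]] [pg [G' [dG sG]]]; split; first exact: PD.
exists (fun t x => F' t x + G' t x); split; last exact: IH.
by move=> t x Jt; apply: is_derive_fD; [exact: dF|exact: dG].
Qed.

(** Leibniz's rule at each order. Three predicates, because one induction has to cover both
    dominated times bounded and bounded times bounded. *)
Lemma smoothM P Q S J k F G :
  (forall F G, S F -> S G -> S (fun t x => F t x + G t x)) ->
  (forall F G, P F -> Q G -> S (fun t x => F t x * G t x)) ->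
  smooth P J k F -> smooth Q J k G -> smooth S J k (fun t x => F t x * G t x).
Proof.
move=> SD PQ; elim: k F G => [|k IH] F G.
  by move=> [pf _] [pg _]; split => //; exact: PQ.
move=> /[dup] sF0 [pf [F' [dF sF]]] /[dup] sG0 [pg [G' [dG sG]]].
split; first exact: PQ.
exists (fun t x => F' t x * G t x + F t x * G' t x); split.
  by move=> t x Jt; apply: is_derive_fM; [exact: dF|exact: dG].
by apply: smoothD => //; apply: IH => //; exact: smoothS.
Qed.

Lemma dominatedD J F G : dominated J F -> dominated J G ->
  dominated J (fun t x => F t x + G t x).
Proof.
move=> [cF [f [fi fF]]] [cG [g [gi gG]]]; split.
  by move=> t Jt x; apply: cvgD; [exact: cF|exact: cG].
exists (fun x => f x + g x); split; first exact: IntD.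
by move=> t x Jt; rewrite (le_trans (ler_normD _ _))// lerD ?fF ?gG.
Qed.

Lemma boundedD J F G : bounded_family J F -> bounded_family J G ->
  bounded_family J (fun t x => F t x + G t x).
Proof.
move=> [cF [f fF]] [cG [g gG]]; split.
  by move=> t Jt x; apply: cvgD; [exact: cF|exact: cG].
by exists (f + g) => t x Jt; rewrite (le_trans (ler_normD _ _))// lerD ?fF ?gG.
Qed.

Lemma dominatedM J F G : dominated J F -> bounded_family J G ->
  dominated J (fun t x => F t x * G t x).
Proof.
move=> [cF [f [fi fF]]] [cG [M gG]]; split.
  by move=> t Jt x; apply: cvgM; [exact: cF|exact: cG].
exists (fun x => M * f x); split; first exact: IntZ.
by move=> t x Jt; rewrite normrM mulrC ler_pM ?fF ?gG.
Qed.

Lemma boundedM J F G : bounded_family J F -> bounded_family J G ->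
  bounded_family J (fun t x => F t x * G t x).
Proof.
move=> [cF [N fF]] [cG [M gG]]; split.
  by move=> t Jt x; apply: cvgM; [exact: cF|exact: cG].
by exists (N * M) => t x Jt; rewrite normrM ler_pM ?fF ?gG.
Qed.

Lemma WkD J k F G : Wk J k F -> Wk J k G -> Wk J k (fun t x => F t x + G t x).
Proof. by apply: smoothD; exact: dominatedD. Qed.

Lemma BkD J k F G : Bk J k F -> Bk J k G -> Bk J k (fun t x => F t x + G t x).
Proof. by apply: smoothD; exact: boundedD. Qed.

Lemma WkM J k F G : Wk J k F -> Bk J k G -> Wk J k (fun t x => F t x * G t x).
Proof. by apply: smoothM; [exact: dominatedD|exact: dominatedM]. Qed.

Lemma BkM J k F G : Bk J k F -> Bk J k G -> Bk J k (fun t x => F t x * G t x).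
Proof. by apply: smoothM; [exact: boundedD|exact: boundedM]. Qed.

Lemma Bk_cst J k (c : T -> R) M : (forall t, J t -> `|c t| <= M) ->
  Bk J k (fun t _ => c t).
Proof.
move=> cM.
have M0 (c' : T -> R) M' : (forall t, J t -> `|c' t| <= M') -> bounded_family J (fun t _ => c' t).
  by move=> c'M; split => [t Jt x|]; [exact: cvg_cst|exists M' => t x; exact: c'M].
have Z k' : Bk J k' (fun _ _ => 0).
  elim: k' => [|k' IH]; split=> //.
  - by apply: (M0 (fun=> 0) 0) => t _; rewrite normr0.
  - by apply: (M0 (fun=> 0) 0) => t _; rewrite normr0.
  - by exists (fun _ _ => 0); split => // t x _; exact: is_derive_cst.
case: k => [|k]; split => //; [exact: (M0 c M)|exact: (M0 c M)|].
by exists (fun _ _ => 0); split => [t x _|]; [exact: is_derive_cst|exact: Z].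
Qed.

Lemma Bk_const J k c : Bk J k (fun _ _ => c).
Proof. exact: (@Bk_cst _ _ (fun=> c) `|c|). Qed.

Lemma WkZ J k c F : Wk J k F -> Wk J k (fun t x => c * F t x).
Proof.
move=> wF; have -> : (fun t x => c * F t x) = (fun t x => F t x * c).
  by apply/funext => t; apply/funext => x; rewrite mulrC.
by apply: WkM => //; exact: Bk_const.
Qed.

Lemma BkZ J k c F : Bk J k F -> Bk J k (fun t x => c * F t x).
Proof. by move=> bF; apply: BkM => //; exact: Bk_const. Qed.

Lemma WkB J k F G : Wk J k F -> Wk J k G -> Wk J k (fun t x => F t x - G t x).
Proof.
move=> wF wG; have -> : (fun t x => F t x - G t x) = (fun t x => F t x + (-1) * G t x).
  by apply/funext => t; apply/funext => x; rewrite mulN1r.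
by apply: WkD => //; exact: WkZ.
Qed.

(** The Sobolev embedding costs one derivative: [|F t x|] is at most the integral of the function
    that dominates the derivative, a bound independent of [t]. *)
Lemma Wk_Bk J k F : Wk J k.+1 F -> Bk J k F.
Proof.
have H F' : Wk J 1 F' -> bounded_family J F'.
  move=> [[cF [f [fi fF]]] [F1 [dF [[cF1 [g [gi gF]]] _]]]]; split => //.
  exists (\int[mu]_y g y) => t x Jt.
  have iF : Int (F' t) by apply: (Int_le _ _ fi); [exact: cF|move=> y; exact: fF].
  have iF1 : Int (F1 t) by apply: (Int_le _ _ gi); [exact: cF1|move=> y; exact: gF].
  apply: (@le_trans _ _ (\int[mu]_y `|F1 t y|)).
    apply: (@le_sup_int _ (F' t)) => //; last exact: cF1.
    by move=> y; exact: dF.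
  apply: Rint_le => //; first exact: Int_norm.
  by move=> y; exact: gF.
have H1 k' F' : Wk J k'.+1 F' -> Wk J 1 F'.
  by elim: k' => // k' IH /WkS.
elim: k F => [|k IH] F wF; split => //; try exact/H/H1/wF.
by case: wF => _ [F' [dF /IH bF]]; exists F'.
Qed.

Lemma bounded_pow J F p eps : 0 < eps -> bounded_family J F ->
  (forall t x, J t -> eps <= F t x) -> bounded_family J (fun t x => F t x `^ p).
Proof.
move=> e0 [cF [M FM]] eF; split.
  move=> t Jt; apply: continuous_pow; last exact: cF.
  by move=> x; exact: (lt_le_trans e0 (eF t x Jt)).
(* The power is monotone in its base, increasing or decreasing with the sign of [p]; the sum of the
   values at both ends covers both cases. *)
exists (eps `^ p + M `^ p) => t x Jt; rewrite ger0_norm ?powR_ge0//.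
have := eF t x Jt; have := FM t x Jt; rewrite ler_norml => /andP[_ FtM] etF.
have F0 : 0 < F t x by exact: lt_le_trans etF.
have M0 : 0 < M by exact: lt_le_trans FtM.
have [p0|p0] := leP 0 p.
  by rewrite ler_wpDl ?powR_ge0//; apply: ge0_ler_powR => //; rewrite nnegrE ltW.
rewrite ler_wpDr ?powR_ge0// -(opprK p) !(powRN _ (- p)) lef_pV2 ?posrE ?powR_gt0//.
by apply: ge0_ler_powR => //; rewrite ?nnegrE ?oppr_ge0 ltW.
Qed.

Lemma Bk_pow J k F p eps : 0 < eps -> Bk J k F ->
  (forall t x, J t -> eps <= F t x) -> Bk J k (fun t x => F t x `^ p).
Proof.
move=> e0 + eF; elim: k F p eF => [|k IH] F p eF.
  by move=> [bF _]; split => //; exact: (bounded_pow p e0).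
move=> /[dup] bF0 [bF [F' [dF sF]]]; split; first exact: (bounded_pow p e0).
exists (fun t x => p * F t x `^ (p - 1) * F' t x); split.
  move=> t x Jt; apply: is_derive_pow; last exact: dF.
  by rewrite (lt_le_trans e0)// eF.
apply: BkM => //; apply: BkZ; apply: IH => //; exact: smoothS.
Qed.

End Classes.

(** * The classes of single functions, and their link with [Winf1] *)

Section Single.
Context {R : realType}.
Local Notation mu := (@lebesgue_measure R).
Local Notation Int f := (mu.-integrable setT (EFin \o f)).
Implicit Types (f g h : R -> R) (k : nat) (p eps : R).

Definition W k f := Wk [set: unit] k (fun _ => f).
Definition B k f := Bk [set: unit] k (fun _ => f).

Lemma W_Int k f : W k f -> Int f.
Proof.
move=> /smooth0 [cf [g [gi fg]]]; apply: (Int_le _ _ gi); first exact: (cf tt).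
by move=> x; exact: (fg tt).
Qed.

Lemma W_cont k f : W k f -> continuous f.
Proof. by move=> /smooth0 [cf _]; exact: (cf tt). Qed.

Lemma B_bound k f : B k f -> exists2 M, 0 < M & forall x, `|f x| <= M.
Proof.
move=> /smooth0 [_ [M fM]]; exists (`|M| + 1); first by rewrite ltr_wpDl.
by move=> x; rewrite (le_trans (fM tt x _))// (le_trans (ler_norm _))// lerDl.
Qed.

Lemma smooth_const (T : Type) (J : set T) (P : (unit -> R -> R) -> Prop)
    (P' : (T -> R -> R) -> Prop) k f :
  (forall f, P (fun _ => f) -> P' (fun _ => f)) ->
  smooth P [set: unit] k (fun _ => f) -> smooth P' J k (fun _ => f).
Proof.
move=> PP; elim: k f => [|k IH] f; first by move=> [/PP ? _]; split.
move=> [/PP pf [f' [df sf]]]; split => //.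
exists (fun _ => f' tt); split; first by move=> t x _; exact: (df tt x).
by apply: IH; have -> : (fun=> f' tt) = f' by apply/funext => -[].
Qed.

Lemma W_fam (T : Type) (J : set T) k f : W k f -> Wk J k (fun _ => f).
Proof.
apply: smooth_const => {}f [cf [g [gi fg]]]; split.
  by move=> t _; exact: (cf tt).
by exists g; split => // t x _; exact: (fg tt).
Qed.

Lemma B_fam (T : Type) (J : set T) k f : B k f -> Bk J k (fun _ => f).
Proof.
apply: smooth_const => {}f [cf [M fM]]; split.
  by move=> t _; exact: (cf tt).
by exists M => // t x _; exact: (fM tt).
Qed.

Lemma fam_W (T : Type) (J : set T) k (F : T -> R -> R) t : J t -> Wk J k F -> W k (F t).
Proof.
move=> Jt; elim: k F => [|k IH] F.
  move=> [[cF [g [gi Fg]]] _]; split => //; split => [_ _|]; first exact: cF.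
  by exists g; split => // _ x _; exact: Fg.
move=> [[cF [g [gi Fg]]] [F' [dF /IH wF]]]; split.
  split => [_ _|]; first exact: cF.
  by exists g; split => // _ x _; exact: Fg.
by exists (fun _ => F' t); split => // _ x _; exact: dF.
Qed.

Lemma WS k f : W k.+1 f -> exists2 f', (forall x, is_derive x (1 : R) f (f' x)) & W k f'.
Proof.
move=> [_ [f' [df wf]]]; exists (f' tt); first by move=> x; exact: (df tt x).
by rewrite /W; have -> : (fun=> f' tt) = f' by apply/funext => -[].
Qed.

Lemma WSI k f f' : (forall x, is_derive x (1 : R) f (f' x)) -> Int f -> W k f' -> W k.+1 f.
Proof.
move=> df fi wf; split; last by exists (fun _ => f').
split; first by move=> _ _ x; exact: (is_derive_cont (df x)).
exists (fun x => `|f x|); split => //; exact: Int_norm.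
Qed.

(** Trades iterated derivatives for derivatives given as witnesses, the form in which product and
    chain rules deliver them. *)
Lemma Winf1P f : Winf1 f <-> forall k, W k f.
Proof.
split.
  move=> wf k.
  suff H n : W k f^`(n) by exact: (H 0%N).
  elim: k n => [|k IH] n.
    split => //; have [df fi] := wf n; split => [_ _ x|].
      exact/differentiable_continuous/derivable1_diffP.
    by exists (fun x => `|f^`(n) x|); split => //; exact: Int_norm.
  apply: (WSI _ _ (IH n.+1)); last by case: (wf n).
  by move=> x; rewrite derive1nS; apply: derivable_is_derive; case: (wf n).
move=> wf.
suff H n : forall k, W k f^`(n).
  move=> n; split; last exact: (W_Int (H n 0%N)).
  by move=> x; have [f' df _] := WS (H n 1%N); apply: ex_derive; exact: df.
elim: n => [//|n IH] k; rewrite derive1nS.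
by have [f' df wf'] := WS (IH k.+1); rewrite (is_derive_fun df).
Qed.

End Single.

(** * The diffeomorphism group: gaps, inverses, substitution, tangent spaces, Finsler norm *)

Section DiffGroupTheory.
Context {R : realType}.
Local Notation mu := (@lebesgue_measure R).
Local Notation Int f := (mu.-integrable setT (EFin \o f)).
Implicit Types (f g h u v phi a b : R -> R) (k : nat) (x y eps C r : R).

(** The slope is an explicit argument, so that a formula can stand for the derivative. In
    [diff_with] the argument is the deviation of the slope from 1. *)
Definition lie_with u a := [/\ forall x, is_derive x (1 : R) u (a x),
  forall k, W k a & u x @[x --> -oo] --> 0].

Definition diff_with phi a := [/\ forall x, is_derive x (1 : R) phi (1 + a x),
  forall k, W k a, forall x, - 1 < a x & phi x - x @[x --> -oo] --> 0].

Lemma lie_algebraP u : lie_algebra u <-> lie_with u u^`().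
Proof.
split=> [[du wu u0]|[du wu u0]]; split => //.
- by move=> x; exact: derivable_is_derive.
- by apply/Winf1P.
- by apply/Winf1P.
Qed.

Lemma lie_withE u a : lie_with u a -> u^`() = a.
Proof. by case=> du _ _; exact: is_derive_fun. Qed.

Lemma lie_with_algebra u a : lie_with u a -> lie_algebra u.
Proof. by move=> ua; apply/lie_algebraP; rewrite (lie_withE ua). Qed.

Lemma diff_withE phi a : diff_with phi a -> phi^`() = (fun x => 1 + a x).
Proof. by case=> du _ _ _; exact: is_derive_fun. Qed.

Lemma DiffP phi : Diff phi <-> diff_with phi (fun x => derive1 phi x - 1).
Proof.
have idK x : is_derive x (1 : R) (fun y : R => y) 1 by exact: is_derive_id.
split=> [[/lie_algebraP[df wf f0] f1]|].
  have dphi x : is_derive x (1 : R) phi (derive1 (fun x => phi x - x) x + 1).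
    rewrite [X in is_derive _ _ X _](_ : _ = (fun y => (phi y - y) + y)).
      by apply: is_derive_fD; exact: derivable_is_derive.
    by apply/funext => y; rewrite subrK.
  have E x : derive1 phi x - 1 = derive1 (fun x => phi x - x) x.
    by rewrite (is_derive1E (dphi x)) addrK.
  split => //.
  - by move=> x; rewrite E addrC.
  - by have -> : (fun x => derive1 phi x - 1) = derive1 (fun x => phi x - x) by exact/funext.
  - by move=> x; rewrite E.
move=> dw; case: (dw) => dphi wphi phi1 phi0.
have df x : is_derive x (1 : R) (fun x => phi x - x) (derive1 phi x - 1).
  apply: is_derive_fB => //; rewrite -[X in is_derive _ _ _ X](subrK 1) addrC; exact: dphi.
have lw : lie_with (fun x => phi x - x) (fun x => derive1 phi x - 1) by split.
by split; [exact: (lie_with_algebra lw)|move=> x; rewrite (lie_withE lw)].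
Qed.

Lemma diff_with_Diff phi a : diff_with phi a -> Diff phi.
Proof.
move=> d; apply/DiffP; rewrite (diff_withE d).
by under [X in diff_with _ X]eq_fun do rewrite addrAC subrr add0r.
Qed.

Lemma Diff_with phi : Diff phi -> exists a, diff_with phi a.
Proof. by move=> /DiffP; exists (fun x => derive1 phi x - 1). Qed.

(** Outside a compact interval [|f|] is below [- f x0], so the minimum over that interval, chosen to
    contain [x0], is global. *)
Lemma min_attained f x0 : continuous f -> f x @[x --> -oo] --> 0 ->
  f x @[x --> +oo] --> 0 -> f x0 < 0 -> exists xm, forall x, f xm <= f x.
Proof.
move=> cf fl fr f0.
have n0 : 0 < - f x0 by rewrite oppr_gt0.
have [A [_ HA]] := cvgr0_norm_lt _ fl _ n0.
have [B' [_ HB]] := cvgr0_norm_lt _ fr _ n0.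
pose a := Num.min (A - 1) x0; pose b := Num.max (B' + 1) x0.
have aA : a < A by rewrite /a gt_min ltrBlDr ltrDl ltr01.
have bB : B' < b by rewrite /b lt_max ltrDl ltr01.
have ax0 : a <= x0 by rewrite /a ge_min lexx orbT.
have bx0 : x0 <= b by rewrite /b le_max lexx orbT.
have [c _ Hc] := @EVT_min _ f a b (le_trans ax0 bx0) (continuous_subspaceT cf).
exists c => x.
have fc : f c <= f x0 by apply: Hc; rewrite in_itv /= ax0.
have [xa|ax] := ltP x a.
  have := HA x (lt_trans xa aA); rewrite ltr_norml opprK => /andP[fx _].
  exact: (le_trans fc (ltW fx)).
have [xb|bx] := ltP b x.
  have := HB x (lt_trans bB xb); rewrite ltr_norml opprK => /andP[fx _].
  exact: (le_trans fc (ltW fx)).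
by apply: Hc; rewrite in_itv /= ax.
Qed.

Lemma W_lim a : W 1 a -> a x @[x --> -oo] --> 0 /\ a x @[x --> +oo] --> 0.
Proof.
move=> w; have [a' da wa'] := WS w.
by split; [apply: (cvg_Ny da)|apply: (cvg_y da)];
   [exact: (W_cont wa')|exact: (W_Int w)|exact: (W_Int wa')|exact: (W_cont wa')|exact: (W_Int w)|exact: (W_Int wa')].
Qed.

Lemma W_min a x0 : W 1 a -> a x0 < 0 -> exists xm, forall x, a xm <= a x.
Proof.
move=> w; have [? ?] := W_lim w.
by apply: min_attained => //; exact: (W_cont w).
Qed.

(** A negative minimum of [a] is attained and still above -1; without negative values the gap is
    1. *)
Lemma W_gap a : W 1 a -> (forall x, -1 < a x) -> exists2 eps, 0 < eps & forall x, eps <= 1 + a x.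
Proof.
move=> w a1; have [[x0 x00]|H] := pselect (exists x0, a x0 < 0).
  have [xm am] := W_min w x00.
  by exists (1 + a xm); [rewrite -ltrBlDl sub0r|move=> x; rewrite lerD2l].
exists 1 => // x; rewrite lerDl leNgt; apply/negP => ax; apply: H; by exists x.
Qed.

Lemma W_B k a : W k.+1 a -> B k a.
Proof. exact: Wk_Bk. Qed.

Lemma W_int_abs a : W 1 a -> exists2 M, 0 < M & forall x, `|a x| <= M.
Proof. by move=> /W_B/B_bound. Qed.

Lemma lie_prim u a : lie_with u a -> u = prim a.
Proof.
by move=> [du wu u0]; rewrite (prim_eq du _ _ u0)//; [exact: (W_cont (wu 0%N))|exact: (W_Int (wu 0%N))].
Qed.

Lemma prim_lie a : (forall k, W k a) -> lie_with (prim a) a.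
Proof.
move=> wa; split => //.
  by move=> x; apply: is_derive_prim; [exact: (W_cont (wa 0%N))|exact: (W_Int (wa 0%N))].
by apply: prim_cvg; exact: (W_Int (wa 0%N)).
Qed.

Lemma diff_lie phi a : diff_with phi a <-> lie_with (fun x => phi x - x) a /\ forall x, -1 < a x.
Proof.
have idK x : is_derive x (1 : R) (fun y : R => y) 1 by exact: is_derive_id.
split=> [[dphi w a1 p0]|[[df w f0] a1]]; split => //; first split => //.
  move=> x; have -> : a x = (1 + a x) - 1 by rewrite addrAC subrr add0r.
  exact: is_derive_fB.
move=> x; have -> : phi = (fun y => y + (phi y - y)) by apply/funext => y; rewrite addrC subrK.
exact: is_derive_fD.
Qed.

Lemma prim_diff a : (forall k, W k a) -> (forall x, -1 < a x) ->
  diff_with (fun x => x + prim a x) a.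
Proof.
move=> wa a1; apply/diff_lie; split => //.
under [X in lie_with X _]eq_fun do rewrite addrAC subrr add0r.
exact: prim_lie.
Qed.

Lemma diff_primE phi a : diff_with phi a -> phi = (fun x => x + prim a x).
Proof.
move=> /diff_lie[/lie_prim e _]; apply/funext => x.
by rewrite -e addrC subrK.
Qed.

Section OneDiffeo.
Variables (phi a : R -> R).
Hypothesis dphi : diff_with phi a.

Lemma diff_pos x : 0 < 1 + a x.
Proof. by case: dphi => _ _ a1 _; rewrite -ltrBlDl sub0r. Qed.

Lemma diff_W k : W k a. Proof. by case: dphi. Qed.

Lemma diff_gap : exists2 eps, 0 < eps & forall x, eps <= 1 + a x.
Proof. by case: dphi => _ w a1 _; exact: W_gap. Qed.

Lemma diff_cont : continuous phi.
Proof. by move=> x; case: dphi => d _ _ _; exact: (is_derive_cont (d x)). Qed.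

Lemma diff_dist : exists2 C, 0 < C & forall x, `|phi x - x| <= C.
Proof.
exists (1 + \int[mu]_y `|a y|).
  by rewrite ltr_pwDl// Rintegral_ge0.
move=> x; rewrite (diff_primE dphi) addrAC subrr add0r (le_trans (prim_norm _ _))//.
  exact: (W_Int (diff_W 0)).
by rewrite lerDr.
Qed.

Lemma diff_incr : {homo phi : x y / x < y}.
Proof.
move=> x y xy; have [d _ _ _] := dphi.
have [c _ e] := @MVT_mean _ phi (fun x => 1 + a x) x y (fun z _ => d z).
by rewrite -subr_gt0 e mulr_gt0 ?diff_pos ?subr_gt0.
Qed.

Lemma diff_inj : injective phi.
Proof.
move=> x y e; have [xy|xy|//] := ltgtP x y.
  by have := diff_incr xy; rewrite e ltxx.
by have := diff_incr xy; rewrite e ltxx.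
Qed.

Lemma diff_surj y : exists x, phi x = y.
Proof.
have [C C0 HC] := diff_dist.
(* [phi] moves points by at most [C], so its values at [y - C] and [y + C] enclose [y]. *)
have yC : y - C <= y + C by rewrite lerD2l; lra.
have [|x _ e] := @IVT _ phi (y - C) (y + C) y yC (continuous_subspaceT diff_cont).
- rewrite ge_min le_max; apply/andP; split; apply/orP; [left|right].
    by have := HC (y - C); rewrite ler_norml => /andP[_]; lra.
  by have := HC (y + C); rewrite ler_norml => /andP[+ _]; lra.
- by exists x.
Qed.

Lemma inverseK : cancel phi (inverse phi).
Proof. by move=> x; rewrite /inverse pinvKV ?inE// => ? ? _ _; exact: diff_inj. Qed.

Lemma inverseVK : cancel (inverse phi) phi.
Proof.
move=> y; rewrite /inverse pinvK// inE.
by have [x <-] := diff_surj y; exists x.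
Qed.

Lemma inverse_dist : exists2 C, 0 < C & forall y, `|inverse phi y - y| <= C.
Proof.
have [C C0 HC] := diff_dist; exists C => // y.
by rewrite -{2}(inverseVK y) distrC HC.
Qed.

Lemma inverse_derive x : is_derive x (1 : R) (inverse phi) (1 + a (inverse phi x))^-1.
Proof.
rewrite -{1}(inverseVK x); apply: (@is_derive_inverse _ phi).
- by near=> y; exact: inverseK.
- by near=> y; exact: diff_cont.
- by case: dphi.
- by rewrite gt_eqF// diff_pos.
Unshelve. all: by end_near. Qed.

Lemma inverse_cont : continuous (inverse phi).
Proof. by move=> x; exact: (is_derive_cont (inverse_derive x)). Qed.

Lemma dist_cvgNy (f : R -> R) C : (forall x, `|f x - x| <= C) -> f x @[x --> -oo] --> -oo.
Proof.
move=> HC; apply/cvgrNyPle => A; near=> x.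
have := HC x; rewrite ler_norml => /andP[_ ?].
have : x <= A - C by near: x; apply: nbhs_ninfty_le; exact: num_real.
lra.
Unshelve. all: by end_near. Qed.

Lemma dist_cvgy (f : R -> R) C : (forall x, `|f x - x| <= C) -> f x @[x --> +oo] --> +oo.
Proof.
move=> HC; apply/cvgryPge => A; near=> x.
have := HC x; rewrite ler_norml => /andP[? _].
have : A + C <= x by near: x; apply: nbhs_pinfty_ge; exact: num_real.
lra.
Unshelve. all: by end_near. Qed.

Lemma change_var_ge0 g : continuous g -> (forall x, 0 <= g x) ->
  (\int[mu]_x (g x)%:E = \int[mu]_x (g (phi x) * (1 + a x))%:E)%E.
Proof.
move=> cg g0; have [dd w _ _] := dphi; have [C _ HC] := diff_dist.
rewrite (@increasing_ge0_integration_by_substitutionT _ phi) //.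
- by rewrite (diff_withE dphi).
- exact: diff_incr.
- by rewrite (diff_withE dphi) => x; apply: cvgD; [exact: cvg_cst|exact: (W_cont (w 0%N))].
- rewrite (diff_withE dphi); apply/cvg_ex; exists (1 + 0); apply: cvgD; first exact: cvg_cst.
  by case: (W_lim (w 1%N)).
- rewrite (diff_withE dphi); apply/cvg_ex; exists (1 + 0); apply: cvgD; first exact: cvg_cst.
  by case: (W_lim (w 1%N)).
- exact: (dist_cvgNy HC).
- exact: (dist_cvgy HC).
Qed.

Lemma cont1a : continuous (fun x => 1 + a x).
Proof. by move=> x; apply: cvgD; [exact: cvg_cst|exact: (W_cont (diff_W 0))]. Qed.

Lemma Int_change g : continuous g -> Int g <-> Int (fun x => g (phi x) * (1 + a x)).
Proof.
move=> cg.
have cg' : continuous (fun x => g (phi x) * (1 + a x)).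
  move=> x; apply: cvgM; last exact: cont1a.
  by apply: continuous_comp; [exact: diff_cont|exact: cg].
have H : (\int[mu]_x `|(g x)%:E| = \int[mu]_x `|(g (phi x) * (1 + a x))%:E|)%E.
  have := @change_var_ge0 (fun x => `|g x|).
  under eq_integral do rewrite -abse_EFin.
  move=> ->; rewrite ?normr_ge0//.
    apply: eq_integral => x _; congr EFin.
    by rewrite normrM (gtr0_norm (diff_pos x)).
  by move=> x; apply: continuous_comp; [exact: cg|exact: norm_continuous].
split=> /integrableP[_ i]; apply/integrableP; split.
- by apply/measurable_EFinP; exact: continuous_measurable_fun.
- by rewrite -H.
- by apply/measurable_EFinP; exact: continuous_measurable_fun.
- by rewrite H.
Qed.

(** Write [g] as [p - |g|] with [p = |g| + g]: both terms are nonnegative and continuous, which the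
    substitution rule for nonnegative functions requires. A split into parts times indicators would
    lose continuity. *)
Lemma change_var g : continuous g -> Int g ->
  \int[mu]_x g x = \int[mu]_x (g (phi x) * (1 + a x)).
Proof.
move=> cg gi.
pose p (x : R) : R := `|g x| + g x.
have cn : continuous (fun x => `|g x|).
  by move=> x; apply: continuous_comp; [exact: cg|exact: norm_continuous].
have cp : continuous p by move=> x; apply: cvgD; [exact: cn|exact: cg].
have ni := Int_norm gi.
have pi_ : Int p by exact: IntD.
have E (q : R -> R) : continuous q -> (forall x, 0 <= q x) ->
    \int[mu]_x q x = \int[mu]_x (q (phi x) * (1 + a x)).
  by move=> cq q0; rewrite /Rintegral (change_var_ge0 cq q0).
have -> : \int[mu]_x g x = \int[mu]_x p x - \int[mu]_x `|g x|.
  by rewrite -RintegralB//; apply: eq_Rintegral => x _; rewrite /p addrAC subrr add0r.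
rewrite (E p)//; last by move=> x; rewrite /p -lerBlDr sub0r -normrN ler_norm.
rewrite (E (fun x => `|g x|))// -RintegralB//.
- by apply: eq_Rintegral => x _; rewrite /p; ring.
- exact/(Int_change cp).
- exact/(Int_change cn).
Qed.

(** Integrability uses the lower gap of the Jacobian [1 + a]; each derivative then brings one factor
    [1 + a], bounded together with its derivatives. *)
Lemma W_comp k g : W k g -> W k (fun x => g (phi x)).
Proof.
have I0 f : continuous f -> Int f -> Int (fun x => f (phi x)).
  move=> cf fi; have [eps e0 He] := diff_gap.
  have cc : continuous (fun x => f (phi x)).
    by move=> x; apply: continuous_comp; [exact: diff_cont|exact: cf].
  apply: (@Int_le _ _ (fun x => eps^-1 * `|f (phi x) * (1 + a x)|)) => //.
    move=> x; rewrite ler_pdivlMl// normrM mulrC ler_wpM2l//.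
    by rewrite (gtr0_norm (diff_pos x)).
  by apply/IntZ/Int_norm; exact: (Int_change cf).1.
elim: k g => [|k IH] g wg.
  split => //; split=> [_ _ x|].
    by apply: continuous_comp; [exact: diff_cont|exact: (W_cont wg)].
  exists (fun x => `|g (phi x)|); split => //; apply: Int_norm; apply: I0; [exact: (W_cont wg)|exact: (W_Int wg)].
have [g' dg wg'] := WS wg.
apply: (@WSI _ _ _ (fun x => g' (phi x) * (1 + a x))).
- by move=> x; apply: is_derive_comp; case: dphi.
- by apply: I0; [exact: (W_cont wg)|exact: (W_Int wg)].
- apply: WkM; first exact: IH.
  apply: BkD; first exact: Bk_const.
  exact: (Wk_Bk (diff_W k.+1)).
Qed.

Lemma B_1a k p : B k (fun x => (1 + a x) `^ p).
Proof.
have [eps e0 He] := diff_gap.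
apply: (@Bk_pow _ _ _ k (fun _ x => 1 + a x) p eps) => //.
apply: BkD; first exact: Bk_const.
exact: (Wk_Bk (diff_W k.+1)).
Qed.

(** The derivative is [g' / (1 + a)] composed with the inverse, again of the form treated, so the
    induction has to be general in [g]. The quotient is written as a power -1 to use [B_1a]. *)
Lemma W_comp_inv k g : W k g -> W k (fun x => g (inverse phi x)).
Proof.
have I0 f : continuous f -> Int f -> Int (fun x => f (inverse phi x)).
  move=> cf fi.
  have cc : continuous (fun x => f (inverse phi x)).
    by move=> x; apply: continuous_comp; [exact: inverse_cont|exact: cf].
  apply/(Int_change cc).
  under [X in Int X]eq_fun do rewrite inverseK.
  have [M _ HM] := W_int_abs (diff_W 1).
  apply: (@Int_mul_bounded _ _ _ (1 + M)) => //; first exact: cont1a.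
  by move=> x; rewrite (le_trans (ler_normD _ _))// normr1 lerD2l.
elim: k g => [|k IH] g wg.
  split => //; split=> [_ _ x|].
    by apply: continuous_comp; [exact: inverse_cont|exact: (W_cont wg)].
  exists (fun x => `|g (inverse phi x)|); split => //; apply: Int_norm; apply: I0; [exact: (W_cont wg)|exact: (W_Int wg)].
have [g' dg wg'] := WS wg.
apply: (@WSI _ _ _ (fun x => (fun y => g' y * (1 + a y) `^ (-1)) (inverse phi x))).
- move=> x; apply: is_derive_comp.
  by rewrite powR_inv1 ?ltW ?diff_pos//; exact: inverse_derive.
- by apply: I0; [exact: (W_cont wg)|exact: (W_Int wg)].
- by apply: (IH (fun y => g' y * (1 + a y) `^ (-1))); apply: WkM => //; exact: B_1a.
Qed.

(** Composition with [phi] and with its inverse both preserve the Lie algebra; the limit at [-oo]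
    survives because either map stays at bounded distance from the identity. Hence all tangent
    spaces coincide as sets. *)
Lemma tangent_lie h : tangent phi h <-> lie_algebra h.
Proof.
have [C _ HC] := diff_dist; have [C' _ HC'] := inverse_dist.
split.
  move=> [X /lie_algebraP[dX wX X0] ->].
  apply: (@lie_with_algebra _ (fun x => derive1 X (phi x) * (1 + a x))); split.
  - by move=> x; apply: is_derive_comp; case: dphi.
  - move=> k; apply: WkM; first exact: W_comp.
    by apply: BkD; [exact: Bk_const|exact: (Wk_Bk (diff_W k.+1))].
  - exact: (cvg_comp _ _ (dist_cvgNy HC) X0).
move=> /lie_algebraP[dh wh h0].
exists (h \o inverse phi); last by apply/funext => x /=; rewrite inverseK.
apply: (@lie_with_algebra _ (fun x => (fun y => derive1 h y * (1 + a y) `^ (-1)) (inverse phi x))).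
split.
- move=> x; apply: is_derive_comp.
  by rewrite powR_inv1 ?ltW ?diff_pos//; exact: inverse_derive.
- move=> k; apply: (@W_comp_inv _ (fun y => derive1 h y * (1 + a y) `^ (-1))).
  by apply: WkM; [exact: wh|exact: B_1a].
- exact: (cvg_comp _ _ (dist_cvgNy HC') h0).
Qed.

Lemma W_comp_inv_lie h b : lie_with h b ->
  lie_with (h \o inverse phi) (fun x => b (inverse phi x) / (1 + a (inverse phi x))).
Proof.
have [C' _ HC'] := inverse_dist; move=> [dh wh h0]; split.
- by move=> x; apply: is_derive_comp; exact: inverse_derive.
- move=> k; have := W_comp_inv (WkM (wh k) (B_1a k (-1))).
  by under eq_fun do rewrite powR_inv1 ?ltW ?diff_pos//.
- exact: (cvg_comp _ _ (dist_cvgNy HC') h0).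
Qed.

End OneDiffeo.

Lemma continuous_norm_pow f r : 0 < r -> continuous f -> continuous (fun x => `|f x| `^ r).
Proof.
move=> r0 cf x.
have cn : {for x, continuous (fun x => `|f x|)}.
  by apply: continuous_comp; [exact: cf|exact: norm_continuous].
have [fx0|fx0] := eqVneq (f x) 0; last first.
  apply: (@continuous_comp _ _ _ (fun x => `|f x|) (fun y => y `^ r)) => //.
  by apply: powR_cont; rewrite normr_gt0.
apply/cvgrPdist_lt => e e0; rewrite fx0 normr0 powR0 ?gt_eqF//.
(* At a zero of [f], the bound [|f y| < e^(1/r)] is what yields [|f y|^r < e]. *)
have e1 : 0 < e `^ r^-1 by exact: powR_gt0.
move/cvgrPdist_lt : cn => /(_ _ e1); apply: filterS => y.
rewrite fx0 normr0 !sub0r !normrN normr_id (ger0_norm (powR_ge0 _ _)) => fy.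
rewrite -[e](powRr1 (ltW e0)) -(mulVf (lt0r_neq0 r0)) powRrM.
by apply: gt0_ltr_powR => //; rewrite nnegrE ?powR_ge0 ?normr_ge0.
Qed.

(** A bound [M] of [|f|] gives [|f|^r <= M^(r-1) |f|]. *)
Lemma W_pow_Int f r : 1 < r -> W 1 f -> Int (fun x => `|f x| `^ r).
Proof.
move=> r1 wf; have [M M0 HM] := W_int_abs wf.
have r0 : 0 < r by rewrite (lt_trans ltr01).
apply: (@Int_le _ _ (fun x => M `^ (r - 1) * `|f x|)).
- by apply: continuous_norm_pow => //; exact: (W_cont wf).
- move=> x; rewrite ger0_norm ?powR_ge0// -(mulr_powRB1 (normr_ge0 (f x)) r0) mulrC ler_wpM2r//.
  by apply: ge0_ler_powR => //; rewrite ?subr_ge0 ?nnegrE ltW.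
- by apply/IntZ/Int_norm; exact: (W_Int wf).
Qed.

(** The [r]-th power of the $L^r$ norm. *)
Definition normr_pow r f := \int[mu]_x (`|f x| `^ r).

Lemma normr_pow_ge0 r f : 0 <= normr_pow r f.
Proof. by apply: Rintegral_ge0 => x _; exact: powR_ge0. Qed.

(** The substitution [x = phi y] turns [|b / (1 + a)|^r] times the Jacobian [1 + a] into
    [|b (1 + a)^(1/r - 1)|^r]. *)
Lemma finslerE r phi a v b : 1 < r -> diff_with phi a -> lie_with v b ->
  finsler r phi v = (normr_pow r (fun x => b x * (1 + a x) `^ (r^-1 - 1)) `^ r^-1)%:E.
Proof.
move=> r1 d l; have r0 : 0 < r by rewrite (lt_trans ltr01).
have l' := W_comp_inv_lie d l.
rewrite /finsler (lie_withE l') unlock /Lnorm /=.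
have -> : (\int[mu]_x (`|b (inverse phi x) / (1 + a (inverse phi x))| `^ r)%:E =
  \int[mu]_x (`|b x * (1 + a x) `^ (r^-1 - 1)| `^ r)%:E)%E.
  rewrite (change_var_ge0 d).
  - apply: eq_integral => x _; rewrite (inverseK d); congr EFin.
    have p := diff_pos d x.
    rewrite normrM [in RHS]normrM powRM// [in RHS]powRM// -mulrA; congr (_ * _).
    rewrite normfV !gtr0_norm ?powR_gt0// -powRrM mulrBl mul1r mulVf ?gt_eqF//.
    rewrite -(powR_inv1 (ltW p)) -powRrM mulN1r -{2}(powRr1 (ltW p)) -powRD; last by rewrite (gt_eqF p) implybT.
    by congr (_ `^ _); ring.
  - apply: continuous_norm_pow => //; case: l' => _ w _; exact: (W_cont (w 0%N)).
  - by move=> x; exact: powR_ge0.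
have wi : Int (fun x => `|b x * (1 + a x) `^ (r^-1 - 1)| `^ r).
  by case: l => _ w _; exact: (W_pow_Int r1 (WkM (w 1%N) (B_1a d 1 (r^-1 - 1)))).
rewrite -[X in (X `^ _)%E]fineK; last exact: integrable_fin_num.
by rewrite poweR_EFin.
Qed.

End DiffGroupTheory.

(** * Families differentiable in time, with estimates integrable in space *)

Section TimeSmooth.
Context {R : realType}.
Local Notation mu := (@lebesgue_measure R).
Local Notation Int f := (mu.-integrable setT (EFin \o f)).
Implicit Types (F G H : R -> R -> R) (J : set R) (k : nat) (p eps : R) (f g m : R -> R).

(** Commutation of time and space derivatives is built in: [F1x] is the space derivative of [F1]
    and, by the recursive clause, the time derivative of [Fx]. *)
Fixpoint time_smooth J k F F1 : Prop :=
  (forall t x, J t -> is_derive t (1 : R) (F ^~ x) (F1 t x)) /\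
  if k is k'.+1 then exists Fx F1x,
    [/\ forall t x, J t -> is_derive x (1 : R) (F t) (Fx t x),
        forall t x, J t -> is_derive x (1 : R) (F1 t) (F1x t x) &
        time_smooth J k' Fx F1x]
  else True.

Lemma time_smoothS J k F F1 : time_smooth J k.+1 F F1 -> time_smooth J k F F1.
Proof.
elim: k F F1 => [|k IH] F F1; first by case.
by move=> [d [Fx [F1x [dF dF1 /IH ?]]]]; split=> //; exists Fx, F1x.
Qed.

Lemma is_derive_ext_open J (f g : R -> R) t (l : R) : open J -> J t ->
  (forall s, J s -> f s = g s) -> is_derive t (1 : R) f l -> is_derive t (1 : R) g l.
Proof.
move=> oJ Jt fg; apply: near_eq_is_derive.
by near=> s; apply: fg; near: s; exact: open_nbhs_nbhs.
Unshelve. all: by end_near. Qed.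

Lemma time_smooth_ext J k F F1 G : open J -> (forall t, J t -> F t = G t) ->
  time_smooth J k F F1 -> time_smooth J k G F1.
Proof.
move=> oJ FG.
have D t x l : J t -> is_derive t (1 : R) (F ^~ x) l -> is_derive t (1 : R) (G ^~ x) l.
  by move=> Jt; apply: (is_derive_ext_open oJ Jt) => s /FG ->.
case: k => [|k] [dF H]; split => //; try by move=> t x Jt; apply: D => //; exact: dF.
move: H => [Fx [F1x [d1 d2 d3]]]; exists Fx, F1x; split => //.
by move=> t x Jt; rewrite -FG//; exact: d1.
Qed.

Lemma Wk_ext J k F G : (forall t, J t -> F t = G t) -> Wk J k F -> Wk J k G.
Proof.
move=> FG.
have E : dominated J F -> dominated J G.
  move=> [cF [g [gi Fg]]]; split; first by move=> t Jt; rewrite -FG//; exact: cF.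
  by exists g; split => // t x Jt; rewrite -FG//; exact: Fg.
case: k => [|k] [/E dG H]; split => //.
by move: H => [F' [dF' ?]]; exists F'; split => // t x Jt; rewrite -FG//; exact: dF'.
Qed.

Lemma time_smoothD J k F F1 G G1 : time_smooth J k F F1 -> time_smooth J k G G1 ->
  time_smooth J k (fun t x => F t x + G t x) (fun t x => F1 t x + G1 t x).
Proof.
elim: k F F1 G G1 => [|k IH] F F1 G G1.
  move=> [dF _] [dG _]; split => // t x Jt; apply: is_derive_fD; [exact: dF|exact: dG].
move=> [dF [Fx [F1x [d1 d2 tF]]]] [dG [Gx [G1x [d3 d4 tG]]]]; split.
  move=> t x Jt; apply: is_derive_fD; [exact: dF|exact: dG].
exists (fun t x => Fx t x + Gx t x), (fun t x => F1x t x + G1x t x); split; last exact: IH.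
  by move=> t x Jt; apply: is_derive_fD; [exact: d1|exact: d3].
by move=> t x Jt; apply: is_derive_fD; [exact: d2|exact: d4].
Qed.

Lemma time_smoothM J k F F1 G G1 : time_smooth J k F F1 -> time_smooth J k G G1 ->
  time_smooth J k (fun t x => F t x * G t x) (fun t x => F1 t x * G t x + F t x * G1 t x).
Proof.
elim: k F F1 G G1 => [|k IH] F F1 G G1.
  move=> [dF _] [dG _]; split => // t x Jt.
  by apply: (@is_derive_fM _ (F ^~ x) (G ^~ x)); [exact: dF|exact: dG].
move=> /[dup] sF [dF [Fx [F1x [d1 d2 tF]]]] /[dup] sG [dG [Gx [G1x [d3 d4 tG]]]]; split.
  move=> t x Jt.
  by apply: (@is_derive_fM _ (F ^~ x) (G ^~ x)); [exact: dF|exact: dG].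
exists (fun t x => Fx t x * G t x + F t x * Gx t x),
  (fun t x => (F1x t x * G t x + Fx t x * G1 t x) + (F1 t x * Gx t x + F t x * G1x t x)); split.
- by move=> t x Jt; apply: is_derive_fM; [exact: d1|exact: d3].
- move=> t x Jt.
  have := is_derive_fD (is_derive_fM (d2 t x Jt) (d3 t x Jt)) (is_derive_fM (d1 t x Jt) (d4 t x Jt)).
  by move/is_derive_eq; apply; ring.
- by apply: time_smoothD; apply: IH => //; exact: time_smoothS.
Qed.

Lemma time_smooth_cst J k f : (forall k, W k f) -> time_smooth J k (fun _ => f) (fun _ _ => 0).
Proof.
have d0 (t x : R) : is_derive t (1 : R) (fun _ : R => x) 0 by exact: is_derive_cst.
elim: k f => [|k IH] f wf; first by split => // t x _; exact: d0.
split; first by move=> t x _; exact: d0.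
have [f' df _] := WS (wf 1%N).
exists (fun _ => f'), (fun _ _ => 0); split => //.
apply: IH => k'; have [f'' df'' ?] := WS (wf k'.+1).
by rewrite -(is_derive_fun df) (is_derive_fun df'').
Qed.

Lemma time_smooth_num J k (c : R -> R) (c' : R -> R) : (forall t, J t -> is_derive t (1 : R) c (c' t)) ->
  time_smooth J k (fun t _ => c t) (fun t _ => c' t).
Proof.
have d0 (t x : R) : is_derive t (1 : R) (fun _ : R => x) 0 by exact: is_derive_cst.
move=> dc.
have Z k' : time_smooth J k' (fun _ _ => 0) (fun _ _ => 0).
  elim: k' => [|k' IH]; first by split => // t x _; exact: d0.
  split; first by move=> t x _; exact: d0.
  by exists (fun _ _ => 0), (fun _ _ => 0); split => // t x _; exact: d0.
case: k => [|k]; first by split => // t x; exact: dc.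
split; first by move=> t x; exact: dc.
by exists (fun _ _ => 0), (fun _ _ => 0); split => // t x _; exact: d0.
Qed.

Lemma time_smooth_pow J k F F1 p : (forall t x, J t -> 0 < F t x) -> time_smooth J k F F1 ->
  time_smooth J k (fun t x => F t x `^ p) (fun t x => p * F t x `^ (p - 1) * F1 t x).
Proof.
move=> F0; have D t x q : J t -> is_derive t (1 : R) (F^~ x) (F1 t x) ->
    is_derive t (1 : R) (fun s => F s x `^ q) (q * F t x `^ (q - 1) * F1 t x).
  by move=> Jt d; apply: (@is_derive_pow _ (F ^~ x)) => //; exact: F0.
elim: k p => [|k IH] p.
  move=> [dF _].
  by split => // t x Jt; apply: D => //; exact: dF.
move=> /[dup] sF [dF [Fx [F1x [d1 d2 tF]]]]; split.
  by move=> t x Jt; apply: D => //; exact: dF.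
exists (fun t x => p * F t x `^ (p - 1) * Fx t x),
 (fun t x => (p * (p - 1) * F t x `^ (p - 1 - 1) * F1 t x) * Fx t x + p * F t x `^ (p - 1) * F1x t x); split.
- by move=> t x Jt; apply: is_derive_pow; [exact: F0|exact: d1].
- move=> t x Jt.
  have c : is_derive x (1 : R) (fun _ : R => p) 0 by exact: is_derive_cst.
  have dp := is_derive_pow (p - 1) (F0 t x Jt) (d1 t x Jt).
  have := is_derive_fM (is_derive_fM c dp) (d2 t x Jt).
  by move/is_derive_eq; apply; ring.
- have c : time_smooth J k (fun _ _ => p) (fun _ _ => 0).
    by apply: (@time_smooth_num J k (fun _ => p)) => t _; exact: is_derive_cst.
  have := time_smoothM (time_smoothM c (IH (p - 1) (time_smoothS sF))) tF.
  congr time_smooth; apply/funext => t; apply/funext => x; ring.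
Qed.

Definition convex_set J := forall s t c, J s -> J t -> s <= c <= t \/ t <= c <= s -> J c.

(** The mean value theorem in time at fixed [x]: the function dominating [F1] on [J] serves as a
    Lipschitz constant integrable in [x], so seminorms of increments are of order [|s - t|]. *)
Lemma time_lipschitz J k F F1 : open J -> convex_set J -> time_smooth J k F F1 -> Wk J k F1 ->
  exists g, Int g /\ forall s t x, J s -> J t ->
    `|derive1n k (fun y => F s y - F t y) x| <= `|s - t| * g x.
Proof.
move=> oJ cJ; elim: k F F1 => [|k IH] F F1.
  move=> [dF _] [[_ [g [gi Fg]]] _]; exists g; split => // s t x Js Jt.
  have [c tcs e] := @MVT_mean _ (F ^~ x) (F1 ^~ x) t s (fun c tcs => dF c x (cJ t s c Jt Js tcs)).
  by rewrite derive1n0 e normrM mulrC ler_wpM2l// Fg//; exact: (cJ t s c).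
move=> [dF [Fx [F1x [d1 d2 tF]]]] [_ [F1x' [d2' wF]]].
have [|g [gi Fg]] := IH Fx F1x tF.
  apply: Wk_ext wF => t Jt; apply/funext => x.
  exact: (is_derive_uniq (d2' t x Jt) (d2 t x Jt)).
exists g; split => // s t x Js Jt; rewrite derive1Sn.
have -> : derive1 (fun y => F s y - F t y) = (fun y => Fx s y - Fx t y).
  by apply: is_derive_fun => y; apply: is_derive_fB; exact: d1.
exact: Fg.
Qed.

(** The difference quotient equals [F1 c x] for an intermediate [c] that depends on [x]; the
    Lipschitz bound of [F1] compares it with [F1 t x], and [|c - t| <= |s - t|]. *)
Lemma time_taylor J k F F1 F2 : open J -> convex_set J -> time_smooth J k F F1 ->
  time_smooth J k F1 F2 -> Wk J k F2 ->
  exists g, Int g /\ forall s t x, J s -> J t -> s != t ->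
    `|derive1n k (fun y => (F s y - F t y) / (s - t) - F1 t y) x| <= `|s - t| * g x.
Proof.
move=> oJ cJ; elim: k F F1 F2 => [|k IH] F F1 F2.
  move=> [dF _] s1 w2; have [g [gi Fg]] := time_lipschitz oJ cJ s1 w2.
  exists g; split => // s t x Js Jt st.
  have [c tcs e] := @MVT_mean _ (F ^~ x) (F1 ^~ x) t s (fun c tcs => dF c x (cJ t s c Jt Js tcs)).
  have Jc := cJ t s c Jt Js tcs.
  rewrite derive1n0 e mulfK ?subr_eq0//.
  apply: (le_trans (Fg c t x Jc Jt)).
  (* The sign of [g x] is read off its own estimate, applied to [s] when [c = t]. *)
  have g0 : 0 <= g x.
    have [_ | ct] := eqVneq c t.
      have := Fg s t x Js Jt; rewrite -(pmulr_rge0 _ (_ : 0 < `|s - t|)) ?normr_gt0 ?subr_eq0//.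
      exact: le_trans.
    have := Fg c t x Jc Jt; rewrite -(pmulr_rge0 _ (_ : 0 < `|c - t|)) ?normr_gt0 ?subr_eq0//.
    exact: le_trans.
  apply: ler_wpM2r => //; case: tcs => /andP[? ?].
    by rewrite !ger0_norm; lra.
  by rewrite !ler0_norm; lra.
move=> [dF [Fx [F1x [d1 d2 tF]]]] [dF1 [F1x' [F2x [d3 d4 tF1]]]] [_ [F2x' [d4' wF]]].
have [||g [gi Fg]] := IH Fx F1x F2x tF.
- apply: time_smooth_ext tF1 => // t Jt; apply/funext => x.
  exact: (is_derive_uniq (d3 t x Jt) (d2 t x Jt)).
- apply: Wk_ext wF => t Jt; apply/funext => x.
  exact: (is_derive_uniq (d4' t x Jt) (d4 t x Jt)).
exists g; split => // s t x Js Jt st; rewrite derive1Sn.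
have -> : derive1 (fun y => (F s y - F t y) / (s - t) - F1 t y) =
    (fun y => (Fx s y - Fx t y) / (s - t) - F1x t y); last exact: Fg.
apply: is_derive_fun => y; apply: is_derive_fB; last exact: d2.
have c : is_derive y (1 : R) (fun _ : R => (s - t)^-1) 0 by exact: is_derive_cst.
have := is_derive_fM (is_derive_fB (d1 s y Js) (d1 t y Jt)) c.
by move/is_derive_eq; apply; rewrite mulr0 addr0.
Qed.

End TimeSmooth.

(** * Derivatives as limits of difference quotients *)

Section Slopes.
Context {R : realType}.
Implicit Types (f : R -> R) (t l C : R).

(** [C1_path] states differentiability by difference quotients, a form that also makes sense within
    an interval. *)
Lemma is_derive_slope f t l :
  is_derive t (1 : R) f l <-> (f s - f t) / (s - t) @[s --> t^'] --> l.
Proof.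
split.
  move=> /is_derive1_caratheodory [g [fg cg <-]].
  have /continuous_withinNx cg' : {for t, continuous g} by exact: cg.
  apply: cvg_trans cg'; apply: near_eq_cvg; near=> s.
  by rewrite fg mulfK// subr_eq0; near: s; exact: nbhs_dnbhs_neq.
move=> fl; apply/is_derive1_caratheodory.
exists (fun s => if s == t then l else (f s - f t) / (s - t)); split; last by rewrite eqxx.
  move=> s; case: eqVneq => [->|st]; first by rewrite !subrr mulr0.
  by rewrite divfK// subr_eq0.
apply/continuous_withinNx; rewrite eqxx.
apply: cvg_trans fl; apply: near_eq_cvg; near=> s.
by rewrite ifN//; near: s; exact: nbhs_dnbhs_neq.
Unshelve. all: by end_near. Qed.

Lemma cvg_abs_id (F : set_system R) t C : Filter F -> (F --> t) ->
  `|s - t| * C @[s --> F] --> (0 : R).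
Proof.
move=> FF Ft; rewrite -(mul0r C); apply: cvgM; last exact: cvg_cst.
rewrite -(normr0 R) -(subrr t); apply: cvg_norm; apply: cvgB => //; exact: cvg_cst.
Qed.

Lemma is_derive_est (J : set R) f t l C : open J -> J t ->
  (forall s, J s -> s != t -> `|(f s - f t) / (s - t) - l| <= `|s - t| * C) ->
  is_derive t (1 : R) f l.
Proof.
move=> oJ Jt H; apply/is_derive_slope; apply/subr_cvg0.
apply: norm_cvg0.
apply: (@squeeze_cvgr _ _ _ _ (cst 0) (fun s => `|s - t| * C)); last 2 first.
- exact: cvg_cst.
- by apply: cvg_abs_id; exact: cvg_within.
near=> s; rewrite normr_ge0 /= H//.
  near: s; apply: (cvg_within (F := nbhs t)); exact: open_nbhs_nbhs.
near: s; exact: nbhs_dnbhs_neq.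
Unshelve. all: by end_near. Qed.

End Slopes.

(** * Seminorm estimates and powers of functions close to 1 *)

Section Seminorms.
Context {R : realType}.
Local Notation mu := (@lebesgue_measure R).
Local Notation Int f := (mu.-integrable setT (EFin \o f)).
Implicit Types (f g h : R -> R) (k : nat) (p r M eps : R).

Lemma is_derive_c (c t : R) : is_derive t (1 : R) (fun _ : R => c) 0.
Proof. exact: is_derive_cst. Qed.

Lemma is_derive_idR (t : R) : is_derive t (1 : R) (fun s : R => s) 1.
Proof. exact: is_derive_id. Qed.

Lemma W_derive1n k n f : W (k + n) f -> W n (derive1n k f).
Proof.
elim: k f => [|k IH] f //; rewrite addSn => /WS[f' df /IH].
by rewrite derive1Sn (is_derive_fun df).
Qed.

Lemma seminorm_le k f f' g : (forall x, is_derive x (1 : R) f (f' x)) ->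
  (forall j, W j f') -> Int g -> (forall x, `|derive1n k f' x| <= g x) ->
  (seminorm k f <= (\int[mu]_x g x)%:E)%E.
Proof.
move=> df wf gi fg; rewrite /seminorm derive1Sn (is_derive_fun df) /Rintegral fineK; last exact: integrable_fin_num.
have w : W 0 (derive1n k f') by apply: W_derive1n.
apply: ge0_le_integral => //=.
- apply/measurable_EFinP; apply: continuous_measurable_fun => x.
  by apply: continuous_comp; [exact: (W_cont w)|exact: norm_continuous].
- by have /measurable_int := gi.
- by move=> x _; rewrite lee_fin fg.
Qed.

Lemma seminorm_fin k f f' : (forall x, is_derive x (1 : R) f (f' x)) ->
  (forall j, W j f') -> seminorm k f = (\int[mu]_x `|derive1n k f' x|)%:E.
Proof.
move=> df wf; rewrite /seminorm derive1Sn (is_derive_fun df) /Rintegral fineK//.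
apply: integrable_fin_num => //.
have w : W 0 (derive1n k f') by apply: W_derive1n.
exact: (Int_norm (W_Int w)).
Qed.

Lemma pow_lip p eps M : 0 < eps -> exists2 C, 0 < C & forall y z,
  eps <= y <= M -> eps <= z <= M -> `|y `^ p - z `^ p| <= C * `|y - z|.
Proof.
move=> e0; exists (`|p| * (eps `^ (p - 1) + M `^ (p - 1)) + 1).
  by rewrite ltr_wpDl// mulr_ge0// addr_ge0 ?powR_ge0.
move=> y z /andP[ey yM] /andP[ez zM].
have [|c tcs e] := @MVT_mean _ (fun y => y `^ p) (fun y => p * y `^ (p - 1)) z y.
  by move=> c H; apply: is_derive1_powR; apply: (lt_le_trans e0); case: H => /andP[? ?]; lra.
have [ec cM] : eps <= c /\ c <= M by case: tcs => /andP[? ?]; split; lra.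
rewrite e normrM ler_wpM2r// ler_wpDr// normrM ler_wpM2l// ger0_norm ?powR_ge0//.
have c0 : 0 < c by exact: lt_le_trans ec.
have M0 : 0 < M by exact: lt_le_trans cM.
have [p0|p0] := leP 0 (p - 1).
  by rewrite ler_wpDl ?powR_ge0//; apply: ge0_ler_powR => //; rewrite nnegrE ltW.
rewrite ler_wpDr ?powR_ge0// -(opprK (p - 1)) !(powRN _ (- (p - 1))) lef_pV2 ?posrE ?powR_gt0//.
by apply: ge0_ler_powR => //; rewrite ?nnegrE ?oppr_ge0 ltW.
Qed.

(** The power is Lipschitz between [min eps 1] and [1 + M], an interval that contains 1, so
    [|(1 + f)^p - 1| <= C |f|] is integrable. Every derivative carries a factor coming from [f']. *)
Lemma W_pow1 f p : (forall k, W k f) -> (forall x, -1 < f x) ->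
  forall k, W k (fun x => (1 + f x) `^ p - 1).
Proof.
move=> wf f1.
have [eps e0 He] := W_gap (wf 1%N) f1.
have [M M0 HM] := W_int_abs (wf 1%N).
have [C C0 HC] := @pow_lip p (Num.min eps 1) (1 + M) ltac:(by rewrite lt_min e0 ltr01).
have [f' df _] := WS (wf 1%N).
have wf' k : W k f' by have [f'' df'' ?] := WS (wf k.+1); rewrite -(is_derive_fun df) (is_derive_fun df'').
have d x : is_derive x (1 : R) (fun x => (1 + f x) `^ p - 1) (p * (1 + f x) `^ (p - 1) * f' x).
  rewrite -[X in is_derive _ _ _ X]subr0; apply: is_derive_fB.
  apply: is_derive_pow; first by rewrite (lt_le_trans e0).
  by rewrite -[X in is_derive _ _ _ X]add0r; apply: is_derive_fD.
have i : Int (fun x => (1 + f x) `^ p - 1).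
  apply: (@Int_le _ _ (fun x => C * `|f x|)).
  - by move=> x; exact: (is_derive_cont (d x)).
  - move=> x; have := HC (1 + f x) 1; rewrite powR1 (_ : 1 + f x - 1 = f x); last by ring.
    apply.
      by rewrite ge_min He/= lerD2l (le_trans (ler_norm _)).
    by rewrite ge_min lexx orbT lerDl ltW.
  - by apply/IntZ/Int_norm; exact: (W_Int (wf 0%N)).
have H k : W k.+1 (fun x => (1 + f x) `^ p - 1).
  apply: (WSI d i).
  have -> : (fun x => p * (1 + f x) `^ (p - 1) * f' x) = (fun x => f' x * (p * (1 + f x) `^ (p - 1))).
    by apply/funext => x; rewrite mulrC.
  apply: WkM; first exact: wf'.
  apply: BkZ; apply: (@Bk_pow _ _ _ k (fun _ x => 1 + f x) (p - 1) eps) => //.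
  by apply: BkD; [exact: Bk_const|exact: (Wk_Bk (wf k.+1))].
by move=> k; exact: (WkS (H k)).
Qed.

End Seminorms.

(** * Paths whose slope has an [r]-th root affine in time: regularity *)

Section AffinePath.
Context {R : realType}.
Local Notation mu := (@lebesgue_measure R).
Local Notation Int f := (mu.-integrable setT (EFin \o f)).
Implicit Types (J : set R) (k : nat) (s t x eps M : R) (m : R -> R).
Variables (r : R) (p n : R -> R).
Hypotheses (wp : forall k, W k (fun x => p x - 1)) (wn : forall k, W k n).

(* phi_x = (p + t n)^r, whose r-th root is affine in t. *)
Definition affine_base t x := p x + t * n x.
(** Uniform rather than pointwise positivity: this is what persists at nearby times and keeps
    negative powers of the base bounded. *)
Definition affine_good t := exists2 eps, 0 < eps & forall x, eps <= affine_base t x.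
Definition path_slope t x := affine_base t x `^ r - 1.
Definition affine_path t x := x + prim (path_slope t) x.
Definition velocity_slope t x := r * n x * affine_base t x `^ (r - 1).
Definition velocity t := prim (velocity_slope t).
Definition accel_slope t x := (r - 1) * (r * n x * n x) * affine_base t x `^ (r - 1 - 1).

Lemma good_near t : affine_good t -> exists2 J, [/\ open J, J t & convex_set J] &
  exists2 eps, 0 < eps & (forall s x, J s -> eps <= affine_base s x) /\
  forall s, J s -> `|s| <= `|t| + 1.
Proof.
move=> [eps e0 He]; have [M M0 HM] := W_int_abs (wn 1).
(* Within this radius [|(s - t) n x| <= eps / 2], which keeps half of the gap, and
   [|s| <= |t| + 1]. *)
pose d := Num.min 1 (eps / 2 / M).
have d0 : 0 < d by rewrite lt_min ltr01 !divr_gt0.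
have JP s : `]t - d, t + d[%classic s -> `|s - t| < d.
  by rewrite /= in_itv /= => /andP[? ?]; rewrite ltr_norml; lra.
exists `]t - d, t + d[%classic.
  split; first exact: interval_open.
    by rewrite /= in_itv /=; lra.
  move=> s t' c; rewrite /= !in_itv /= => /andP[? ?] /andP[? ?] [] /andP[? ?]; lra.
exists (eps / 2); first by rewrite divr_gt0.
split=> [s x|s] /JP sd.
  have : `|(s - t) * n x| <= eps / 2.
    rewrite normrM (@le_trans _ _ (d * M))//; first by rewrite ler_pM// ltW.
    by rewrite -ler_pdivlMr// ge_min lexx orbT.
  have := He x; rewrite /affine_base ler_norml => ? /andP[? _]; nra.
have := ler_normD (s - t) t; rewrite subrK; move: sd; rewrite /d lt_min => /andP[+ _].
lra.
Qed.

Lemma base_W t : forall k, W k (fun x => affine_base t x - 1).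
Proof.
move=> k; have -> : (fun x => affine_base t x - 1) = (fun x => (p x - 1) + t * n x).
  by apply/funext => x; rewrite /affine_base addrAC.
by apply: WkD; [exact: wp|apply: WkZ; exact: wn].
Qed.

Lemma base_smooth J k : time_smooth J k affine_base (fun _ => n).
Proof.
have tn := time_smoothM (@time_smooth_num R J k id (fun=> 1) (fun t _ => is_derive_idR t)) (@time_smooth_cst R J k n wn).
have tp := time_smoothD (@time_smooth_num R J k (fun=> 1) (fun=> 0) (fun t _ => is_derive_c 1 t)) (@time_smooth_cst R J k _ wp).
have := time_smoothD tp tn; congr time_smooth.
  by apply/funext => t; apply/funext => x; rewrite /affine_base; ring.
by apply/funext => t; apply/funext => x; ring.
Qed.

Lemma base_B J k M : (forall t, J t -> `|t| <= M) -> Bk J k affine_base.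
Proof.
move=> HM.
have -> : affine_base = (fun t x => (1 + (p x - 1)) + t * n x).
  by apply/funext => t; apply/funext => x; rewrite /affine_base; ring.
apply: BkD; first apply: BkD.
- exact: Bk_const.
- exact: (B_fam J (Wk_Bk (wp k.+1))).
- by apply: BkM; [exact: Bk_cst HM|exact: (B_fam J (Wk_Bk (wn k.+1)))].
Qed.

(** The velocity, the acceleration and the next time derivative all have the form [m x] times a
    power of the base, hence general [m] and [q]. *)
Lemma mpow_W J k m q eps M : 0 < eps -> (forall s x, J s -> eps <= affine_base s x) ->
  (forall t, J t -> `|t| <= M) -> (forall k, W k m) -> Wk J k (fun t x => m x * affine_base t x `^ q).
Proof.
move=> e0 He HM wm; apply: WkM; first exact: (W_fam J (wm k)).
exact: (Bk_pow q e0 (base_B k HM) He).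
Qed.

Lemma mpow_smooth J k m q eps : 0 < eps -> (forall s x, J s -> eps <= affine_base s x) ->
  (forall k, W k m) ->
  time_smooth J k (fun t x => m x * affine_base t x `^ q) (fun t x => q * (m x * n x) * affine_base t x `^ (q - 1)).
Proof.
move=> e0 He wm.
have b0 t x : J t -> 0 < affine_base t x by move=> Jt; exact: (lt_le_trans e0 (He t x Jt)).
have := time_smoothM (@time_smooth_cst R J k m wm) (time_smooth_pow q b0 (base_smooth J k)).
by congr time_smooth; apply/funext => t; apply/funext => x; ring.
Qed.

Section AtGoodTime.
Variable t : R.
Hypothesis gt : affine_good t.

Lemma good_gt0 x : 0 < affine_base t x.
Proof. by case: gt => eps e0 He; exact: lt_le_trans (He x). Qed.

Lemma wrn : forall k, W k (fun x => r * n x).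
Proof. by move=> k; apply: WkZ; exact: wn. Qed.

Lemma wrnn : forall k, W k (fun x => (r - 1) * (r * n x * n x)).
Proof.
by move=> k; apply: WkZ; apply: WkM; [exact: wrn|exact: (Wk_Bk (wn k.+1))].
Qed.

Lemma good_mpow k m q : (forall k, W k m) -> W k (fun x => m x * affine_base t x `^ q).
Proof.
move=> wm; have [J [oJ Jt cJ] [eps e0 [He HM]]] := good_near gt.
exact: (fam_W Jt (mpow_W k q e0 He HM wm)).
Qed.

Lemma pathF_W k : W k (path_slope t).
Proof.
have -> : path_slope t = (fun x => (1 + (affine_base t x - 1)) `^ r - 1).
  by apply/funext => x; rewrite /path_slope [1 + _]addrC subrK.
apply: W_pow1; first exact: base_W.
by move=> x; rewrite ltrBrDr addNr good_gt0.
Qed.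

Lemma pathF_gt x : -1 < path_slope t x.
Proof. by rewrite /path_slope ltrBrDr addNr powR_gt0// good_gt0. Qed.

Lemma aff_diff : diff_with (affine_path t) (path_slope t).
Proof. by apply: prim_diff; [exact: pathF_W|exact: pathF_gt]. Qed.

Lemma affv1_W k : W k (velocity_slope t).
Proof. exact: good_mpow wrn. Qed.

Lemma affv_lie : lie_with (velocity t) (velocity_slope t).
Proof. by apply: prim_lie; exact: affv1_W. Qed.

Lemma affa1_W k : W k (accel_slope t).
Proof. exact: good_mpow wrnn. Qed.

End AtGoodTime.

Lemma pathF_smooth J k eps : 0 < eps -> (forall s x, J s -> eps <= affine_base s x) ->
  time_smooth J k path_slope velocity_slope.
Proof.
move=> e0 He.
have b0 t x : J t -> 0 < affine_base t x by move=> Jt; exact: (lt_le_trans e0 (He t x Jt)).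
have tp := time_smoothD (time_smooth_pow r b0 (base_smooth J k)) (@time_smooth_num R J k (fun=> -1) (fun=> 0) (fun t _ => is_derive_c (-1) t)).
by have := tp; congr time_smooth; apply/funext => t; apply/funext => x; rewrite /velocity_slope; ring.
Qed.

(** One integrable [g], a sum of absolute values, serves all five estimates. The first and third
    make the path a [C1_path]; the second yields the time derivative of [velocity], which enters the
    Eulerian acceleration; the third and fourth give joint continuity in time and space. *)
Lemma good_estimates t : affine_good t -> forall k, exists2 J, [/\ open J, J t & forall s, J s -> affine_good s] &
  exists g, Int g /\ [/\
  forall s x, J s -> s != t ->
    `|derive1n k (fun y => (path_slope s y - path_slope t y) / (s - t) - velocity_slope t y) x| <= `|s - t| * g x,
  forall s x, J s -> s != t ->
    `|derive1n k (fun y => (velocity_slope s y - velocity_slope t y) / (s - t) - accel_slope t y) x| <= `|s - t| * g x,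
  forall s x, J s -> `|derive1n k (fun y => velocity_slope s y - velocity_slope t y) x| <= `|s - t| * g x,
  forall s x, J s -> `|derive1n k (fun y => path_slope s y - path_slope t y) x| <= `|s - t| * g x &
  forall s x, J s -> `|derive1n k (fun y => accel_slope s y - accel_slope t y) x| <= `|s - t| * g x].
Proof.
move=> gt k; have [J [oJ Jt cJ] [eps e0 [He HM]]] := good_near gt.
have s0 := pathF_smooth k e0 He.
have s1 : time_smooth J k velocity_slope accel_slope := mpow_smooth k (r - 1) e0 He wrn.
have s2 := mpow_smooth k (r - 1 - 1) e0 He wrnn.
have w1 : Wk J k velocity_slope := mpow_W k (r - 1) e0 He HM wrn.
have w2 : Wk J k accel_slope := mpow_W k (r - 1 - 1) e0 He HM wrnn.
have w3n : forall j, W j (fun x => (r - 1 - 1) * ((r - 1) * (r * n x * n x) * n x)).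
  by move=> j; apply: WkZ; apply: WkM; [exact: wrnn|exact: (Wk_Bk (wn j.+1))].
have w3 := mpow_W k (r - 1 - 1 - 1) e0 He HM w3n.
have [g1 [g1i H1]] := time_taylor oJ cJ s0 s1 w2.
have [g2 [g2i H2]] := time_taylor oJ cJ s1 s2 w3.
have [g3 [g3i H3]] := time_lipschitz oJ cJ s1 w2.
have [g4 [g4i H4]] := time_lipschitz oJ cJ s0 w1.
have [g5 [g5i H5]] := time_lipschitz oJ cJ s2 w3.
exists J; first by split => // s Js; exists eps => // x; exact: He.
exists (fun x => `|g1 x| + `|g2 x| + `|g3 x| + `|g4 x| + `|g5 x|).
split; first by do 4 (apply: IntD; last exact: Int_norm); exact: Int_norm.
have n1 x := normr_ge0 (g1 x); have n2 x := normr_ge0 (g2 x); have n3 x := normr_ge0 (g3 x).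
have n4 x := normr_ge0 (g4 x); have n5 x := normr_ge0 (g5 x).
have l1 x := ler_norm (g1 x); have l2 x := ler_norm (g2 x); have l3 x := ler_norm (g3 x).
have l4 x := ler_norm (g4 x); have l5 x := ler_norm (g5 x).
split.
- move=> s x Js st; apply: (le_trans (H1 s t x Js Jt st)); apply: ler_wpM2l => //.
  by have := (n1 x, n2 x, n3 x, n4 x, n5 x, l1 x); move=> [[[[[? ?] ?] ?] ?] ?]; lra.
- move=> s x Js st; apply: (le_trans (H2 s t x Js Jt st)); apply: ler_wpM2l => //.
  by have := (n1 x, n2 x, n3 x, n4 x, n5 x, l2 x); move=> [[[[[? ?] ?] ?] ?] ?]; lra.
- move=> s x Js; apply: (le_trans (H3 s t x Js Jt)); apply: ler_wpM2l => //.
  by have := (n1 x, n2 x, n3 x, n4 x, n5 x, l3 x); move=> [[[[[? ?] ?] ?] ?] ?]; lra.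
- move=> s x Js; apply: (le_trans (H4 s t x Js Jt)); apply: ler_wpM2l => //.
  by have := (n1 x, n2 x, n3 x, n4 x, n5 x, l4 x); move=> [[[[[? ?] ?] ?] ?] ?]; lra.
- move=> s x Js; apply: (le_trans (H5 s t x Js Jt)); apply: ler_wpM2l => //.
  by have := (n1 x, n2 x, n3 x, n4 x, n5 x, l5 x); move=> [[[[[? ?] ?] ?] ?] ?]; lra.
Qed.

End AffinePath.

(** * The affine paths as curves in the group, and their speed *)

Section AffineCurve.
Context {R : realType}.
Local Notation mu := (@lebesgue_measure R).
Local Notation Int f := (mu.-integrable setT (EFin \o f)).
Implicit Types (J I : set R) (k : nat) (s t x eps M C : R) (F G : R -> R -> R).
Variables (r : R) (p n : R -> R).
Hypotheses (r1 : 1 < r) (wp : forall k, W k (fun x => p x - 1)) (wn : forall k, W k n).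
Local Notation good := (affine_good p n).
Local Notation pathF := (path_slope r p n).
Local Notation aff := (affine_path r p n).
Local Notation affv1 := (velocity_slope r p n).
Local Notation affv := (velocity r p n).
Local Notation affa1 := (accel_slope r p n).

(** Differentiation under the integral sign: the remainder [|s - t| g], integrated over the line,
    bounds the error of the difference quotient. *)
Lemma prim_slope J F G t x g : open J -> J t -> (forall s, J s -> W 0 (F s)) -> W 0 (G t) -> Int g ->
  (forall s y, J s -> s != t -> `|(F s y - F t y) / (s - t) - G t y| <= `|s - t| * g y) ->
  is_derive t (1 : R) (fun s => prim (F s) x) (prim (G t) x).
Proof.
move=> oJ Jt wF wG gi H; apply: (@is_derive_est _ J _ _ _ (\int[mu]_y g y)) => // s Js st.
have iF s' : J s' -> Int (F s') by move=> /wF /W_Int.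
have cF s' : J s' -> continuous (F s') by move=> /wF /W_cont.
have iD : Int (fun y => (s - t)^-1 * (F s y - F t y)) by apply/IntZ/IntB; exact: iF.
have e : (prim (F s) x - prim (F t) x) / (s - t) - prim (G t) x =
    prim (fun y => (s - t)^-1 * (F s y - F t y) - G t y) x.
  rewrite primB//; last exact: (W_Int wG).
  by rewrite primZ ?primB//; [rewrite mulrC|exact: iF|exact: iF|apply: IntB; exact: iF].
rewrite e (le_trans (prim_norm _ _))//.
  by apply: IntB => //; exact: (W_Int wG).
rewrite -RintegralZl//; apply: Rint_le.
- by apply: Int_norm; apply: IntB => //; exact: (W_Int wG).
- exact: IntZ.
- by move=> y; rewrite mulrC; exact: H.
Qed.

Lemma aff_Dt t x : good t -> is_derive t (1 : R) (aff ^~ x) (affv t x).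
Proof.
move=> gt; have [J [oJ Jt gJ] [g [gi [H1 _ _ _ _]]]] := good_estimates r wp wn gt 0.
rewrite -[X in is_derive _ _ _ X]add0r; apply: (is_derive_fD (is_derive_c x t)).
apply: (prim_slope x oJ Jt _ _ gi) => [s Js||s y Js st].
- exact: (pathF_W _ wp wn (gJ s Js)).
- exact: affv1_W.
- exact: H1.
Qed.

Lemma affv_Dt t x : good t -> is_derive t (1 : R) (affv ^~ x) (prim (affa1 t) x).
Proof.
move=> gt; have [J [oJ Jt gJ] [g [gi [_ H1 _ _ _]]]] := good_estimates r wp wn gt 0.
apply: (prim_slope x oJ Jt _ _ gi) => [s Js||s y Js st].
- exact: (affv1_W _ wp wn (gJ s Js)).
- exact: affa1_W.
- exact: H1.
Qed.

Lemma prim_lip (f g h : R -> R) C x : Int f -> Int g -> Int h -> (forall y, `|f y - g y| <= C * h y) ->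
  `|prim f x - prim g x| <= C * \int[mu]_y h y.
Proof.
move=> fi gi hi H.
have <- : prim (fun y => f y - g y) x = prim f x - prim g x by rewrite primB.
rewrite (le_trans (prim_norm _ _))//; first exact: IntB.
rewrite -RintegralZl//; apply: Rint_le => //; last exact: IntZ.
by apply: Int_norm; exact: IntB.
Qed.

Lemma good_lipschitz t : good t -> exists2 J, [/\ open J, J t & forall s, J s -> good s] &
  exists C, forall s x, J s -> [/\ `|aff s x - aff t x| <= `|s - t| * C,
    `|affv s x - affv t x| <= `|s - t| * C &
    `|prim (affa1 s) x - prim (affa1 t) x| <= `|s - t| * C].
Proof.
move=> gt; have [J [oJ Jt gJ] [g [gi [_ _ H3 H4 H5]]]] := good_estimates r wp wn gt 0.
exists J => //; exists (\int[mu]_y g y) => s x Js; have gs := gJ s Js; split.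
- have -> : aff s x - aff t x = prim (pathF s) x - prim (pathF t) x.
    by rewrite /affine_path opprD addrACA subrr add0r.
  apply: prim_lip => //; last by move=> y; exact: H4.
    exact: (W_Int (pathF_W r wp wn gs 0)).
  exact: (W_Int (pathF_W r wp wn gt 0)).
- apply: prim_lip => //; last by move=> y; exact: H3.
    exact: (W_Int (affv1_W r wp wn gs 0)).
  exact: (W_Int (affv1_W r wp wn gt 0)).
- apply: prim_lip => //; last by move=> y; exact: H5.
    exact: (W_Int (affa1_W r wp wn gs 0)).
  exact: (W_Int (affa1_W r wp wn gt 0)).
Qed.

Lemma seminorm_squeeze (FF : set_system R) t (f : R -> \bar R) C : Filter FF -> (FF --> t) ->
  (\forall s \near FF, (0 <= f s <= (`|s - t| * C)%:E)%E) -> f s @[s --> FF] --> 0%E.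
Proof.
move=> fF Ft H; apply: (@squeeze_cvge _ _ _ _ (cst 0%E) _ (fun s => (`|s - t| * C)%:E)) => //.
  exact: cvg_cst.
by apply: cvg_EFin; [exact: nearW|exact: cvg_abs_id].
Qed.

Lemma within_dnbhs I t : within I t^' --> t.
Proof. by apply: cvg_trans (cvg_within _); exact: cvg_within. Qed.

Lemma seminorm_ge0 k (f : R -> R) : (0 <= seminorm k f)%E.
Proof. by apply: integral_ge0 => x _; rewrite lee_fin. Qed.

Lemma aff_C1_path I : (forall t, I t -> good t) -> C1_path I aff affv.
Proof.
move=> gI t It; have gt := gI t It.
have dt := aff_diff r wp wn gt.
split.
- exact: diff_with_Diff dt.
- by apply/(tangent_lie dt); exact: (lie_with_algebra (affv_lie r wp wn gt)).
- move=> k; have [J [oJ Jt gJ] [g [gi [H1 _ _ _ _]]]] := good_estimates r wp wn gt k.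
  apply: (@seminorm_squeeze _ t _ (\int[mu]_x g x)).
    exact: within_dnbhs.
  near=> s; rewrite seminorm_ge0 /=.
  have Js : J s.
    near: s; apply: (cvg_within (F := dnbhs t)); apply: (cvg_within (F := nbhs t)).
    exact: open_nbhs_nbhs.
  have st : s != t.
    near: s; apply: (cvg_within (F := dnbhs t)). exact: withinT.
  have gs := gJ s Js; have ds := aff_diff r wp wn gs.
  rewrite -RintegralZl//.
  have d x : is_derive x (1 : R) (fun x => (aff s x - aff t x) / (s - t) - affv t x)
      ((pathF s x - pathF t x) / (s - t) - affv1 t x).
    have c : is_derive x (1 : R) (fun _ : R => (s - t)^-1) 0 by exact: is_derive_c.
    have [dds _ _ _] := ds; have [ddt _ _ _] := dt.
    have [dv _ _] := affv_lie r wp wn gt.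
    have := is_derive_fB (is_derive_fM (is_derive_fB (dds x) (ddt x)) c) (dv x).
    by move/is_derive_eq; apply; rewrite mulr0 addr0 opprD addrACA subrr add0r.
  apply: (seminorm_le d) => //.
  + move=> j; apply: WkB; last exact: affv1_W.
    have -> : (fun x => (pathF s x - pathF t x) / (s - t)) = (fun x => (s - t)^-1 * (pathF s x - pathF t x)).
      by apply/funext => x; rewrite mulrC.
    by apply/WkZ/WkB; exact: pathF_W.
  + exact: IntZ.
  + by move=> x; exact: H1.
- move=> k; have [J [oJ Jt gJ] [g [gi [_ _ H3 _ _]]]] := good_estimates r wp wn gt k.
  apply: (@seminorm_squeeze _ t _ (\int[mu]_x g x)); first exact: cvg_within.
  near=> s; rewrite seminorm_ge0 /=.
  have Js : J s.
    near: s; apply: (cvg_within (F := nbhs t)).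
    exact: open_nbhs_nbhs.
  have gs := gJ s Js; have [dvs _ _] := affv_lie r wp wn gs; have [dvt _ _] := affv_lie r wp wn gt.
  rewrite -RintegralZl//.
  have d x : is_derive x (1 : R) (fun x => affv s x - affv t x) (affv1 s x - affv1 t x).
    exact: is_derive_fB.
  apply: (seminorm_le d) => //.
  + by move=> j; apply: WkB; exact: affv1_W.
  + exact: IntZ.
  + by move=> x; exact: H3.
Unshelve. all: by end_near. Qed.

(** The exponents [r - 1] of the velocity and [r (1/r - 1)] of the metric cancel, so that time
    disappears. *)
Lemma finsler_aff t : good t ->
  finsler r (aff t) (affv t) = (normr_pow r (fun x => r * n x) `^ r^-1)%:E.
Proof.
move=> gt; rewrite (finslerE r1 (aff_diff r wp wn gt) (affv_lie r wp wn gt)).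
have r0 : 0 < r by rewrite (lt_trans ltr01).
suff -> : (fun x => affv1 t x * (1 + pathF t x) `^ (r^-1 - 1)) = (fun x => r * n x) by [].
apply/funext => x; have b0 := good_gt0 gt x.
rewrite /path_slope addrC subrK -powRrM /velocity_slope -mulrA -powRD; last by rewrite (gt_eqF b0) implybT.
have -> : r - 1 + r * (r^-1 - 1) = 0 by field; rewrite gt_eqF.
by rewrite powRr0 mulr1.
Qed.

End AffineCurve.

(** * The signed power: Young's inequality and its equality case *)

Section SignedPower.
Context {R : realType}.
Implicit Types (r y z m : R).

(** The derivative of [|y|^r / r], that is, the duality map of $L^r$ applied pointwise. *)
Definition spow r y := y * `|y| `^ (r - 2).

Lemma norm_spow r y : 1 < r -> `|spow r y| = `|y| `^ (r - 1).
Proof.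
move=> r1; rewrite /spow normrM (ger0_norm (powR_ge0 _ _)).
have [->|y0] := eqVneq y 0.
  by rewrite normr0 mul0r powR0// subr_eq0 gt_eqF.
have y1 : 0 < `|y| by rewrite normr_gt0.
rewrite -[X in X * _](powRr1 (ltW y1)) -powRD; last by rewrite (gt_eqF y1) implybT.
by congr (_ `^ _); ring.
Qed.

Lemma spowM r y : 1 < r -> y * spow r y = `|y| `^ r.
Proof.
move=> r1; have [->|y0] := eqVneq y 0.
  by rewrite mul0r normr0 powR0// gt_eqF// (lt_trans ltr01).
have y1 : 0 < `|y| by rewrite normr_gt0.
rewrite /spow mulrA -expr2 -real_normK ?num_real// -powR_mulrn// -powRD; last by rewrite (gt_eqF y1) implybT.
by congr (_ `^ _); ring.
Qed.

(** Young's inequality for [r] and the conjugate exponent [q = r / (r - 1)], since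
    [|spow r m|^q = |m|^r]. *)
Lemma spow_young r m y : 1 < r -> spow r m * y <= r^-1 * `|y| `^ r + (1 - r^-1) * `|m| `^ r.
Proof.
move=> r1; have r0 : 0 < r by rewrite (lt_trans ltr01).
have rm : 0 < r - 1 by rewrite subr_gt0.
pose q := r / (r - 1).
have q0 : 0 < q by rewrite divr_gt0.
have rq : r^-1 + q^-1 = 1 by rewrite /q; field; rewrite !gt_eqF.
apply: (le_trans (ler_norm _)); rewrite normrM norm_spow// mulrC.
apply: (le_trans (conjugate_powR (normr_ge0 _) (powR_ge0 _ _) r0 q0 rq)).
rewrite mulrC lerD2l -powRrM (_ : (r - 1) * q = r); last by rewrite /q; field; rewrite gt_eqF.
by rewrite mulrC (_ : q^-1 = 1 - r^-1)// -rq addrAC subrr add0r.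
Qed.

(** The height at [y] of the graph of [|.|^r] above its tangent line at [m]; by [spowM] it is also,
    up to the factor [r], the defect in [spow_young]. *)
Definition tangent_gap r m y := `|y| `^ r - `|m| `^ r - r * spow r m * (y - m).

Lemma tangent_gap_ge0 r m y : 1 < r -> 0 <= tangent_gap r m y.
Proof.
move=> r1; have r0 : 0 < r by rewrite (lt_trans ltr01).
have := spow_young m y r1; rewrite -(ler_pM2l r0).
have -> : r * (r^-1 * `|y| `^ r + (1 - r^-1) * `|m| `^ r) = `|y| `^ r + (r - 1) * `|m| `^ r.
  by field; rewrite gt_eqF.
have := spowM m r1; rewrite /tangent_gap mulrBr => e.
have -> : r * spow r m * m = r * (m * spow r m) by ring.
rewrite e; lra.
Qed.

Lemma spow_inj r : 1 < r -> injective (spow r).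
Proof.
move=> r1 y z e.
have n : `|y| = `|z|.
  have := congr1 (fun x : R => `|x|) e; rewrite !norm_spow//; apply: powR_injective; rewrite ?nnegrE//.
  by rewrite subr_gt0.
have [z0|z0] := eqVneq z 0.
  by move: n; rewrite z0 normr0 => /normr0P/eqP.
have : `|z| `^ (r - 2) != 0 by rewrite gt_eqF// powR_gt0// normr_gt0.
by move: e; rewrite /spow n => /mulIf /[apply].
Qed.

(** Strict convexity without second derivatives. With [z] the midpoint, the tangent inequalities
    from [z] to [y], from [z] to [m] and from [m] to [z] force the slopes at [z] and [m] to agree if
    [y] differs from [m]; injectivity of [spow r] then gives [z = m]. *)
Lemma tangent_gap_eq0 r m y : 1 < r -> tangent_gap r m y = 0 -> y = m.
Proof.
move=> r1 H; have r0 : 0 < r by rewrite (lt_trans ltr01).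
pose z := (m + y) / 2.
have h1 := tangent_gap_ge0 z y r1; have h2 := tangent_gap_ge0 z m r1.
have h3 := tangent_gap_ge0 m z r1.
move: H h1 h2 h3; rewrite /tangent_gap.
set Y := `|y| `^ r; set M := `|m| `^ r; set Z := `|z| `^ r; set sz := spow r z; set sm := spow r m.
have -> : y - z = (y - m) / 2 by rewrite /z; field.
have -> : m - z = - ((y - m) / 2) by rewrite /z; field.
have -> : z - m = (y - m) / 2 by rewrite /z; field.
move=> e h1 h2 h3.
have [yz|ne] := eqVneq y m; first by [].
have d0 : y - m != 0 by rewrite subr_eq0.
have : r * (sz - sm) * (y - m) = 0.
  pose u := r * sm * (y - m); pose v := r * sz * (y - m).
  have -> : r * (sz - sm) * (y - m) = v - u by rewrite /u /v; ring.
  have uE : r * sm * ((y - m) / 2) = u / 2 by rewrite /u; field.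
  have vE : r * sz * ((y - m) / 2) = v / 2 by rewrite /v; field.
  have vN : r * sz * (- ((y - m) / 2)) = - (v / 2) by rewrite mulrN vE.
  move: e h1 h2 h3; rewrite uE vE vN -/u.
  lra.
move/eqP; rewrite !mulf_eq0 (negbTE d0) (gt_eqF r0) /= orbF subr_eq0 => /eqP.
rewrite /sz /sm => /(spow_inj r1); rewrite /z => e2.
have : y - m = 0 by move: e2; lra.
by move/eqP; rewrite (negbTE d0).
Qed.

(** At 0 the difference quotient has absolute value [|z|^(r-1)], which tends to 0 because
    [1 < r]. *)
Lemma is_derive_norm_pow r y : 1 < r -> is_derive y (1 : R) (fun z => `|z| `^ r) (r * spow r y).
Proof.
move=> r1; have r0 : 0 < r by rewrite (lt_trans ltr01).
have P z : 0 < z -> is_derive z (1 : R) (fun z => `|z| `^ r) (r * spow r z).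
  move=> z0; have zz : `]0, +oo[%classic z by rewrite /= in_itv /= z0.
  have oz : open (`]0, +oo[%classic : set R) by exact: interval_open.
  apply: (is_derive_ext_open (f := fun z => z `^ r) oz zz).
  - by move=> u /=; rewrite in_itv /= andbT => u0; rewrite gtr0_norm.
  - have -> : spow r z = z `^ (r - 1); last exact: is_derive1_powR.
    have e2 : r - 2 = r - 1 - 1 by ring.
    by rewrite /spow gtr0_norm// e2 mulr_powRB1 ?subr_gt0// ltW.
have [y0|y0|<-] := ltgtP 0 y; first exact: P.
  have ny : 0 < - y by rewrite oppr_gt0.
  have dN : is_derive y (1 : R) (fun z : R => - z) (- 1) by exact: is_deriveN.
  have := @is_derive_comp _ _ (fun z : R => - z) y _ _ (P (- y) ny) dN.
  have -> : (fun z : R => `|- z| `^ r) = (fun z => `|z| `^ r) by apply/funext => z; rewrite normrN.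
  by rewrite /spow normrN mulrN1 mulNr mulrN opprK.
apply/is_derive_slope.
have z0 : spow r 0 = 0 by rewrite /spow mul0r.
rewrite z0 mulr0; apply: norm_cvg0.
have c : (fun z : R => `|z| `^ (r - 1)) z @[z --> (0 : R)^'] --> (0 : R).
  have rm : 0 < r - 1 by rewrite subr_gt0.
  have := @continuous_norm_pow _ (fun z : R => z) _ rm (fun x => cvg_id) 0.
  rewrite /continuous_at normr0 (powR0 (lt0r_neq0 rm)) => c.
  exact: cvg_within_filter c.
apply: cvg_trans c; apply: near_eq_cvg; near=> z.
have zn : z != 0 by near: z; exact: nbhs_dnbhs_neq.
have zp : 0 < `|z| by rewrite normr_gt0.
rewrite normr0 (powR0 (lt0r_neq0 r0)) !subr0 normrM normfV (ger0_norm (powR_ge0 _ _)).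
by rewrite powRB ?(gt_eqF zp) ?implybT// powRr1// ltW.
Unshelve. all: by end_near. Qed.

Lemma spow_cont r : 1 < r -> continuous (spow r).
Proof.
move=> r1 y; have rm : 0 < r - 1 by rewrite subr_gt0.
have [->|y0] := eqVneq y 0.
  have s0 : spow r 0 = 0 by rewrite /spow mul0r.
  rewrite /continuous_at s0; apply: norm_cvg0.
  under eq_fun do rewrite norm_spow//.
  have := @continuous_norm_pow _ (fun z : R => z) _ rm (fun x => cvg_id) 0.
  by rewrite /continuous_at normr0 (powR0 (lt0r_neq0 rm)).
apply: cvgM; first exact: cvg_id.
apply: (@continuous_comp _ _ _ (fun y : R => `|y|) (fun z => z `^ (r - 2))).
  exact: norm_continuous.
by apply: powR_cont; rewrite normr_gt0.
Qed.

End SignedPower.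

(** * Difference quotients within a closed interval *)

Section WithinSlopes.
Context {R : realType}.
Implicit Types (f l : R -> R) (a b t e : R).

Lemma within_slope_derive f a b t (d : R) : a < t < b ->
  (f s - f t) / (s - t) @[s --> within `[a, b] t^'] --> d -> is_derive t (1 : R) f d.
Proof.
move=> /andP[at_ tb] H; apply/is_derive_slope; apply: cvg_trans H.
apply: cvg_app => A; rewrite /within /= => HA.
have : nbhs t (`]a, b[%classic : set R).
  by apply: open_nbhs_nbhs; split; [exact: interval_open|rewrite /= in_itv /= at_].
move=> /nbhs_dnbhs HI; near=> s.
have sI : `[a, b]%classic s.
  have : `]a, b[%classic s by near: s.
  by rewrite /= !in_itv /= => /andP[/ltW -> /ltW ->].
by move: sI; near: s.
Unshelve. all: by end_near. Qed.

Lemma within_slope_cont f l a b : (forall t, `[a, b]%classic t ->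
  (f s - f t) / (s - t) @[s --> within `[a, b] t^'] --> l t) -> {within `[a, b], continuous f}.
Proof.
move=> H; apply/subspace_continuousP => t tI; have {}H := H t tI.
have c : (f s - f t) / (s - t) * (s - t) @[s --> within `[a, b] t^'] --> 0.
  rewrite -[X in _ --> X](mulr0 (l t)); apply: cvgM => //.
  by apply/subr_cvg0; exact: within_dnbhs.
have {}c : f s - f t @[s --> within `[a, b] t^'] --> 0.
  apply: cvg_trans c; apply: near_eq_cvg; near=> s.
  by rewrite mulfVK// subr_eq0; near: s; apply: (cvg_within (F := dnbhs t)); exact: withinT.
apply/cvgrPdist_lt => e e0.
move/cvgr0Pnorm_lt : c => /(_ _ e0); rewrite !near_withinE => c.
apply: filterS c => s; have [->|st] := eqVneq s t.
  by move=> _ _; rewrite subrr normr0.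
by move=> /(_ isT) c sI; rewrite distrC; exact: c.
Unshelve. all: by end_near. Qed.

Lemma within_mono (F : set_system R) (A B : set R) : Filter F -> A `<=` B -> within A F --> within B F.
Proof.
move=> FF AB P; rewrite /within /= !nbhs_simpl /within /= => H; apply: filterS H => x Px /AB; exact: Px.
Qed.

(** Nonnegative slopes make [f] nondecreasing, so [f b <= f a] leaves only constants. Slopes are
    taken within [[a, b]] because curves have one-sided velocities at the end points. *)
Lemma within_MVT_ge0 f l a b : a < b -> (forall t, `[a, b]%classic t ->
  (f s - f t) / (s - t) @[s --> within `[a, b] t^'] --> l t) ->
  (forall t, a < t < b -> 0 <= l t) -> f b <= f a -> forall t, a < t < b -> l t = 0.
Proof.
move=> ab H l0 fba.
have cf := within_slope_cont H.
have d t : a < t < b -> is_derive t (1 : R) f (l t).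
  move=> tab; apply: (within_slope_derive tab); apply: H.
  by rewrite /= in_itv /=; case/andP: tab => /ltW -> /ltW ->.
have mono x y : a <= x -> x <= y -> y <= b -> f x <= f y.
  move=> ax xy yb; move: xy; rewrite le_eqVlt => /predU1P[->//|xy].
  have [z zxy|z|z zxy e] := @MVT _ f l x y xy.
  - apply: d; move: zxy; rewrite in_itv /= => /andP[xz zy].
    by rewrite (le_lt_trans ax xz) (lt_le_trans zy yb).
  - apply: continuous_subspaceW cf z => z; rewrite /= !in_itv /= => /andP[xz zy].
    by rewrite (le_trans ax xz) (le_trans zy yb).
  rewrite -subr_ge0 e mulr_ge0 ?subr_ge0 ?(ltW xy)//; apply: l0.
  move: zxy; rewrite in_itv /= => /andP[xz zy].
  by rewrite (le_lt_trans ax xz) (lt_le_trans zy yb).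
have fc t : a <= t <= b -> f t = f a.
  move=> /andP[at_ tb]; apply/eqP; rewrite eq_le (mono a t)// andbT.
  exact: (le_trans (mono t b at_ tb (lexx b)) fba).
move=> t tab; have := d t tab; have c : is_derive t (1 : R) (fun _ : R => f a) 0 by exact: is_derive_c.
move=> dt; apply: (is_derive_uniq dt).
have tI : (`]a, b[%classic : set R) t by rewrite /= in_itv.
have oI : open (`]a, b[%classic : set R) by exact: interval_open.
apply: (is_derive_ext_open oI tI _ c) => s /=; rewrite in_itv /= => /andP[/ltW a1 /ltW b1].
by rewrite fc// a1.
Qed.

End WithinSlopes.

(** * Monotonicity of integrals of nonnegative functions *)

Section NonnegIntegral.
Local Open Scope ereal_scope.
Context d (T : measurableType d) (R : realType) (mu : {measure set T -> \bar R}).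

(* No measurability of [g] is needed: both sides are suprema over simple functions. *)
Lemma nn_le_integral (D : set T) (f g : T -> \bar R) : (forall x, D x -> 0 <= f x) ->
  (forall x, D x -> f x <= g x) -> \int[mu]_(x in D) f x <= \int[mu]_(x in D) g x.
Proof.
move=> f0 fg; rewrite integral_mkcond [leRHS]integral_mkcond.
have H0 x : 0 <= (f \_ D) x by exact: erestrict_ge0.
have H1 x : (f \_ D) x <= (g \_ D) x.
  by rewrite !patchE; case: ifP => // /set_mem; exact: fg.
rewrite !ge0_integralTE//; last by move=> x; exact: le_trans (H1 x).
apply: le_ereal_sup => _ [h hf <-]; exists h => // x.
exact: le_trans (hf x) (H1 x).
Qed.

End NonnegIntegral.

(** * From Young's inequality to Hoelder's *)

Section YoungScaling.
Context {R : realType}.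
Implicit Types (r s y k X : R).

Lemma powR_root r s : 0 < r -> 0 <= s -> (s `^ r^-1) `^ r = s.
Proof. by move=> r0 s0; rewrite -powRrM mulVf ?(lt0r_neq0 r0)// powRr1. Qed.

Lemma powR_compl s p : 0 < s -> s `^ p = (s `^ (1 - p))^-1 * s.
Proof.
move=> s0; rewrite -{1}(subKr 1 p) powRB ?powRr1 ?(ltW s0)// 1?mulrC//.
by rewrite (gt_eqF s0) implybT.
Qed.

(* Optimising Young's inequality over dilations [k] gives Hoelder's. *)
Lemma young_scaling r s y X : 1 < r -> 0 < s -> 0 <= y ->
  (forall k, 0 < k -> k * X <= r^-1 * (k `^ r * y) + (1 - r^-1) * s) ->
  X <= s `^ (1 - r^-1) * y `^ r^-1.
Proof.
move=> r1 s0 y0 H; have r0 : 0 < r by exact: lt_trans r1.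
have ri : r^-1 != 0 by rewrite invr_eq0 lt0r_neq0.
move: y0; rewrite le_eqVlt => /predU1P[y0|y0].
  rewrite -y0 powR0// mulr0 leNgt; apply/negP => X0.
  have q0 : 0 <= (1 - r^-1) * s.
    by rewrite mulr_ge0 ?(ltW s0)// subr_ge0 invf_le1// ltW.
  have k0 : 0 < ((1 - r^-1) * s + 1) / X by rewrite divr_gt0// ltr_wpDl.
  have := H _ k0; rewrite -y0 !mulr0 add0r divfK ?(lt0r_neq0 X0)//.
  by rewrite gerDl ler10.
have N0 : 0 < s `^ r^-1 by exact: powR_gt0.
have L0 : 0 < y `^ r^-1 by exact: powR_gt0.
have kr : (s `^ r^-1 / y `^ r^-1) `^ r * y = s.
  rewrite -{2}(powR_root r0 (ltW y0)) -powRM ?divr_ge0 ?(ltW N0) ?(ltW L0)//.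
  by rewrite divfK ?(lt0r_neq0 L0)// powR_root// ltW.
have := H _ (divr_gt0 N0 L0); rewrite kr -mulrDl subrKC mul1r mulrAC ler_pdivrMr// => h.
have e : s `^ (1 - r^-1) = s / s `^ r^-1.
  by rewrite powRB ?powRr1 ?(ltW s0)// (gt_eqF s0) implybT.
by rewrite e mulrAC ler_pdivlMr// mulrC.
Qed.

End YoungScaling.

(** * Curves in the flat $L^r$ geometry: length bound and rigidity *)

Section Curves.
Context {R : realType}.
Local Notation mu := (@lebesgue_measure R).
Local Notation Int f := (mu.-integrable setT (EFin \o f)).
Variables (r a b c : R) (g gt : R -> R -> R).
Hypotheses (r1 : 1 < r) (ab : a < b).
Local Notation I := (`[a, b]%classic : set R).
Hypothesis g_W : forall t, I t -> W 1 (fun x => g t x - c).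
Hypothesis gt_W : forall t, I t -> W 1 (gt t).
Hypothesis g_slope : forall t, I t ->
  \int[mu]_x `|(g s x - g t x) / (s - t) - gt t x| @[s --> within I t^'] --> 0.
Hypothesis gt_cont : forall t, I t ->
  \int[mu]_x `|gt s x - gt t x| @[s --> within I (nbhs t)] --> 0.

Let r0 : 0 < r. Proof. by rewrite (lt_trans ltr01). Qed.
Let Ia : I a. Proof. by rewrite /= in_itv /= lexx ltW. Qed.
Let Ib : I b. Proof. by rewrite /= in_itv /= lexx ltW. Qed.
Let ba0 : 0 < b - a. Proof. by rewrite subr_gt0. Qed.

Definition mean_slope x := (g b x - g a x) / (b - a).
Local Notation n := mean_slope.

Lemma mean_slope_W : W 1 n.
Proof.
have -> : n = (fun x => (b - a)^-1 * ((g b x - c) - (g a x - c))).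
  by apply/funext => x; rewrite /mean_slope; field; rewrite gt_eqF.
by apply/WkZ/WkB; exact: g_W.
Qed.

Let w x := spow r (n x).

Let w_cont : continuous w.
Proof.
move=> x; apply: (@continuous_comp _ _ _ n (spow r)); first exact: (W_cont mean_slope_W).
exact: spow_cont.
Qed.

Let w_bound : exists2 M, 0 < M & forall x, `|w x| <= M.
Proof.
have [M M0 HM] := W_int_abs mean_slope_W.
exists (M `^ (r - 1)); first exact: powR_gt0.
move=> x; rewrite /w norm_spow//; apply: ge0_ler_powR => //.
- by rewrite subr_ge0 ltW.
- by rewrite nnegrE ltW.
Qed.

Let w_int f : continuous f -> Int f -> Int (fun x => w x * f x).
Proof.
move=> cf fi; have [M _ HM] := w_bound.
have := Int_mul_bounded cf w_cont fi HM.
by congr (_.-integrable setT (EFin \o _)); apply/funext => x; rewrite mulrC.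
Qed.

Let w_norm f M : (forall x, `|w x| <= M) -> continuous f -> Int f ->
  `|\int[mu]_x (w x * f x)| <= M * \int[mu]_x `|f x|.
Proof.
move=> HM cf fi; apply: (le_trans (le_normr_Rintegral measurableT (w_int cf fi))).
rewrite -RintegralZl//; last exact: Int_norm.
apply: Rint_le; [exact/Int_norm/w_int|exact/IntZ/Int_norm|].
by move=> x; rewrite normrM ler_wpM2r.
Qed.

(** [g s] tends to [c] at infinity; subtracting [c] makes the pairing integrable and does not affect
    increments in [s]. *)
Let G s := \int[mu]_x (w x * (g s x - c)).
Let G' s := \int[mu]_x (w x * gt s x).

Let G_slope t : I t -> (G s - G t) / (s - t) @[s --> within I t^'] --> G' t.
Proof.
move=> It; have [M M0 HM] := w_bound.
apply/subr_cvg0; apply: norm_cvg0.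
have lim0 : M * \int[mu]_x `|(g s x - g t x) / (s - t) - gt t x| @[s --> within I t^'] --> 0.
  by rewrite -(mulr0 M); apply: cvgM; [exact: cvg_cst|exact: g_slope].
apply: (squeeze_cvgr _ (cvg_cst _) lim0); near=> s.
have Is : I s by near: s; exact: withinT.
have W1 : W 1 (fun x => (s - t)^-1 * ((g s x - c) - (g t x - c)) - gt t x).
  by apply: WkB; [apply/WkZ/WkB; exact: g_W|exact: gt_W].
have i1 s' : I s' -> Int (fun x => w x * (g s' x - c)).
  by move=> Is'; apply: w_int; [exact: (W_cont (g_W Is'))|exact: (W_Int (g_W Is'))].
have i2 : Int (fun x => w x * gt t x).
  by apply: w_int; [exact: (W_cont (gt_W It))|exact: (W_Int (gt_W It))].
rewrite normr_ge0 /=.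
have -> : (G s - G t) / (s - t) - G' t =
    \int[mu]_x (w x * ((s - t)^-1 * ((g s x - c) - (g t x - c)) - gt t x)).
  rewrite /G /G' -RintegralB//; [|exact: i1|exact: i1].
  rewrite mulrC -RintegralZl//; last by apply: IntB; exact: i1.
  rewrite -RintegralB//; last by apply/IntZ/IntB; exact: i1.
  by apply: eq_Rintegral => x _; ring.
have <- : \int[mu]_x `|(s - t)^-1 * ((g s x - c) - (g t x - c)) - gt t x| =
    \int[mu]_x `|(g s x - g t x) / (s - t) - gt t x|.
  by apply: eq_Rintegral => x _; congr (`|_|); ring.
apply: w_norm => //; [exact: (W_cont W1)|exact: (W_Int W1)].
Unshelve. all: by end_near. Qed.

Let G'_cont : {within I, continuous G'}.
Proof.
apply/subspace_continuousP => t It; have [M M0 HM] := w_bound.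
apply/subr_cvg0; apply: norm_cvg0.
have lim0 : M * \int[mu]_x `|gt s x - gt t x| @[s --> within I (nbhs t)] --> 0.
  by rewrite -(mulr0 M); apply: cvgM; [exact: cvg_cst|exact: gt_cont].
apply: (squeeze_cvgr _ (cvg_cst _) lim0); near=> s.
have Is : I s by near: s; exact: withinT.
have W1 : W 1 (fun x => gt s x - gt t x) by apply: WkB; exact: gt_W.
have i2 s' : I s' -> Int (fun x => w x * gt s' x).
  by move=> Is'; apply: w_int; [exact: (W_cont (gt_W Is'))|exact: (W_Int (gt_W Is'))].
rewrite normr_ge0 /= /G' -RintegralB//; [|exact: i2|exact: i2].
have -> : \int[mu]_x (w x * gt s x - w x * gt t x) = \int[mu]_x (w x * (gt s x - gt t x)).
  by apply: eq_Rintegral => x _; ring.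
by apply: w_norm => //; [exact: (W_cont W1)|exact: (W_Int W1)].
Unshelve. all: by end_near. Qed.

Let S := normr_pow r.

Let G_diff : G b - G a = (b - a) * S n.
Proof.
have i1 s' : I s' -> Int (fun x => w x * (g s' x - c)).
  by move=> Is'; apply: w_int; [exact: (W_cont (g_W Is'))|exact: (W_Int (g_W Is'))].
rewrite /G -RintegralB//; [|exact: i1|exact: i1].
rewrite /S /normr_pow -RintegralZl//; last exact: (W_pow_Int r1 mean_slope_W).
apply: eq_Rintegral => x _; rewrite -(spowM _ r1) /w /mean_slope; field.
by rewrite gt_eqF.
Qed.

Let int_pow f : W 1 f -> Int (fun x => `|f x| `^ r).
Proof. exact: W_pow_Int. Qed.

Let S_young f : W 1 f -> \int[mu]_x (w x * f x) <= r^-1 * S f + (1 - r^-1) * S n.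
Proof.
move=> wf; rewrite /S /normr_pow -!RintegralZl//; [|exact: int_pow mean_slope_W|exact: int_pow].
rewrite -RintegralD//; [|apply: IntZ; exact: int_pow|apply: IntZ; exact: int_pow mean_slope_W].
apply: Rint_le.
- by apply: w_int; [exact: (W_cont wf)|exact: (W_Int wf)].
- by apply: IntD; apply: IntZ; [exact: int_pow|exact: (int_pow mean_slope_W)].
- by move=> x; exact: spow_young.
Qed.

Let S_scale k f : 0 <= k -> W 1 f -> S (fun x => k * f x) = k `^ r * S f.
Proof.
move=> k0 wf; rewrite /S /normr_pow -RintegralZl//; last exact: int_pow.
by apply: eq_Rintegral => x _; rewrite normrM powRM// (ger0_norm k0).
Qed.

Let S_hoelder f : W 1 f -> 0 < S n ->
  \int[mu]_x (w x * f x) <= (S n) `^ (1 - r^-1) * (S f) `^ r^-1.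
Proof.
move=> wf Sn; apply: (young_scaling r1 Sn (normr_pow_ge0 r f)) => k k0.
have := S_young (WkZ k wf); rewrite (S_scale (ltW k0) wf).
suff -> : \int[mu]_x (w x * (k * f x)) = k * \int[mu]_x (w x * f x) by [].
rewrite -RintegralZl//; last exact: (w_int (W_cont wf) (W_Int wf)).
by apply: eq_Rintegral => x _; rewrite mulrCA.
Qed.

(* Pairing the velocity with w = n |n|^(r-2), where n is the mean slope, gives an
   exact derivative; Hoelder then bounds the length of the curve from below. *)
Lemma curve_length_ge :
  ((S n `^ r^-1 * (b - a))%:E <= \int[mu]_(s in I) (S (gt s) `^ r^-1)%:E)%E.
Proof.
have Sn0 : 0 <= S n by exact: normr_pow_ge0.
move: Sn0; rewrite le_eqVlt => /predU1P[Sn|Sn].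
  rewrite -Sn powR0 ?invr_eq0 ?gt_eqF// mul0r.
  by apply: integral_ge0 => s _; rewrite lee_fin powR_ge0.
have P0 : 0 < S n `^ (1 - r^-1) by exact: powR_gt0.
have FTCG : (\int[mu]_(s in I) (G' s)%:E = (G b)%:E - (G a)%:E)%E.
  have cG := within_slope_cont G_slope.
  have [ca cb cc] := (continuous_within_itvP _ ab).1 cG.
  apply: (continuous_FTC2 ab G'_cont).
    split => // x; rewrite in_itv /= => xab.
    have xI : I x by rewrite /= in_itv /=; case/andP: xab => /ltW -> /ltW ->.
    by have [] := within_slope_derive xab (G_slope xI).
  move=> x; rewrite in_itv /= => xab.
  have xI : I x by rewrite /= in_itv /=; case/andP: xab => /ltW -> /ltW ->.
  by apply: is_derive1E; exact: (within_slope_derive xab (G_slope xI)).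
pose K := (S n `^ (1 - r^-1))^-1.
have K0 : 0 < K by rewrite invr_gt0.
have iG : mu.-integrable I (EFin \o G').
  by apply: continuous_compact_integrable => //; exact: segment_compact.
have -> : ((S n `^ r^-1 * (b - a))%:E = \int[mu]_(s in I) (K * G' s)%:E)%E.
  under eq_integral do rewrite EFinM.
  rewrite integralZl// FTCG -EFinB G_diff -EFinM; congr EFin.
  by rewrite (powR_compl _ Sn) -/K mulrCA mulrC.
have iK : mu.-integrable I (fun s => (K * G' s)%:E).
  by apply: eq_integrable (integrableZl _ K iG).
(* [K * G'] may be negative, while comparison with a speed of unknown measurability is available for
   nonnegative functions: pass through the positive part. *)
apply: (@le_trans _ _ (\int[mu]_(s in I) ((fun s => (K * G' s)%:E)^\+ s)%E)%E).
  apply: le_integral => //; first exact: integrable_funepos.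
  by move=> s _; rewrite funeposE le_max lexx.
apply: nn_le_integral => s Is; rewrite funeposE; first by rewrite le_max lexx orbT.
rewrite ge_max !lee_fin powR_ge0 andbT /K mulrC ler_pdivrMr// mulrC.
exact: S_hoelder (gt_W Is) Sn.
Qed.

(** By Young and [C <= S n], the function [S n * s - G s] has nonnegative slope, and it takes equal
    values at [a] and [b]. So Young is an equality at each interior time, the integral of the
    nonnegative continuous [tangent_gap] vanishes, and strict convexity identifies the velocity at
    every point. *)
Lemma curve_rigidity C : (forall s, I s -> S (gt s) = C) -> C <= S n ->
  forall s x, a < s < b -> gt s x = n x.
Proof.
move=> SC CS.
have II s : a < s < b -> I s by rewrite /= in_itv /= => /andP[/ltW -> /ltW ->].
have H s : a < s < b -> S n - G' s = 0.
  pose H s := S n * s - G s.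
  apply: (@within_MVT_ge0 _ (fun s => S n * s - G s) (fun s => S n - G' s) a b ab).
  - move=> t It.
    have L : S n - (G s - G t) / (s - t) @[s --> within I t^'] --> S n - G' t.
      by apply: cvgB; [exact: cvg_cst|exact: G_slope].
    apply: cvg_trans L; apply: near_eq_cvg; near=> z.
    have st : z != t.
      by near: z; apply: (cvg_within (F := dnbhs t)); exact: withinT.
    by field; rewrite subr_eq0.
  - move=> t /II It; have := S_young (gt_W It); rewrite (SC t It) -/(G' t) => h.
    have : r^-1 * C <= r^-1 * S n by rewrite ler_wpM2l// invr_ge0 ltW.
    rewrite mulrBl mul1r in h; lra.
  - by have := G_diff; rewrite mulrBl => ?; lra.
move=> s x sab; have Is := II s sab; have e := H s sab.
have wt := gt_W Is.
pose D x := tangent_gap r (n x) (gt s x).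
have i1 : Int (fun x => w x * gt s x) by apply: w_int; [exact: (W_cont wt)|exact: (W_Int wt)].
have DE : D = (fun x => `|gt s x| `^ r - (1 - r) * `|n x| `^ r - r * (w x * gt s x)).
  by apply/funext => y; rewrite /D /tangent_gap -(spowM (n y) r1) /w; ring.
have iD : Int D.
  rewrite DE; apply: IntB; last exact: IntZ.
  by apply: IntB; [exact: int_pow|apply: IntZ; exact: int_pow mean_slope_W].
have cD : continuous D.
  rewrite DE => y.
  apply: cvgB; [apply: cvgB|].
  - by apply: (continuous_norm_pow r0 (W_cont wt)).
  - by apply: cvgM; [exact: cvg_cst|apply: (continuous_norm_pow r0 (W_cont mean_slope_W))].
  - by apply: cvgM; [exact: cvg_cst|apply: cvgM; [exact: w_cont|exact: (W_cont wt)]].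
apply: (@tangent_gap_eq0 _ r (n x) (gt s x) r1).
apply: (@Rint_eq0 _ D cD iD) => [y|]; first exact: tangent_gap_ge0.
rewrite DE RintegralB//; last 2 first.
- by apply: IntB; [exact: int_pow|apply: IntZ; exact: int_pow mean_slope_W].
- exact: IntZ.
rewrite RintegralB//; last 2 first.
- exact: int_pow.
- by apply: IntZ; exact: int_pow mean_slope_W.
rewrite !RintegralZl//; last exact: int_pow mean_slope_W.
rewrite -/(normr_pow r (gt s)) -/(normr_pow r n) -/(G' s) -/S (SC s Is).
have -> : G' s = S n by lra.
lra.
Unshelve. all: by end_near. Qed.

End Curves.

(** * Pointwise inequalities for powers *)

Section PowerEstimates.
Context {R : realType}.
Implicit Types (p eps M y z : R).

Lemma pow_bound p eps M : 0 < eps -> exists2 K, 0 < K & forall y, eps <= y <= M -> y `^ p <= K.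
Proof.
move=> e0; have [C C0 HC] := @pow_lip R p eps M e0.
exists (eps `^ p + C * `|M - eps|).
  by rewrite ltr_pwDl ?powR_gt0// mulr_ge0// ltW.
move=> y /andP[ey yM].
have := HC y eps; rewrite ey yM lexx (le_trans ey yM) => /(_ isT isT) h.
rewrite -lerBlDl (le_trans (ler_norm _))// (le_trans h)// ler_wpM2l ?(ltW C0)//.
by rewrite !ger0_norm ?subr_ge0// ?lerB// (le_trans ey).
Qed.

Lemma pow_taylor p eps M : 0 < eps -> exists2 C, 0 < C & forall y z,
  eps <= y <= M -> eps <= z <= M ->
  `|z `^ p - y `^ p - p * y `^ (p - 1) * (z - y)| <= C * (z - y) ^+ 2.
Proof.
move=> e0; have [C C0 HC] := @pow_lip R (p - 1) eps M e0.
exists (`|p| * C + 1); first by rewrite ltr_wpDl// mulr_ge0// ltW.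
move=> y z /andP[ey yM] /andP[ez zM].
have [|c tcs e] := @MVT_mean _ (fun y => y `^ p) (fun y => p * y `^ (p - 1)) y z.
  by move=> c H; apply: is_derive1_powR; apply: (lt_le_trans e0); case: H => /andP[? ?]; lra.
have [ec cM] : eps <= c /\ c <= M by case: tcs => /andP[? ?]; split; lra.
rewrite e -mulrBl -mulrBr normrM normrM -(real_normK (num_real (z - y))) expr2 mulrA.
rewrite ler_wpM2r// mulrDl mul1r ler_wpDr// -mulrA ler_wpM2l//.
have := HC c y; rewrite ec cM ey yM => /(_ isT isT) h; apply: (le_trans h).
apply: ler_wpM2l; first exact: ltW.
case: tcs => /andP[? ?].
  by rewrite !ger0_norm; lra.
by rewrite !ler0_norm; lra.
Qed.

Lemma slope_shift (x y d c e : R) : (x - y) / d - e = d^-1 * ((x - c) - (y - c)) - e.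
Proof. by rewrite [RHS]addrC [LHS]addrC mulrC opprB addrA subrK. Qed.

(** The inequality behind [slope_ctrl]: [P] and [Q] are the roots of the slopes of the two
    diffeomorphisms, [w] the difference of those slopes over the time lapse [d], [b] the slope of
    the velocity. In the quadratic remainder one factor [w] is bounded by [|d| (1 + N)] and the
    other is kept, so that the result remains integrable in space. *)
Lemma slope_bound (r d P Q Y K C N b w : R) : 0 < r -> d != 0 -> 0 <= Y -> Y <= K ->
  0 <= C -> 0 <= N -> `|P - Q - r^-1 * Y * w| <= C * w ^+ 2 -> `|w| <= `|d| * (1 + N) ->
  `|(r * P - r * Q) / d - b * Y| <= (K + r * C * (1 + N)) * `|w / d - b| +
     `|d| * (K + r * C * (1 + N)) * (`|w / d - b| + `|b|).
Proof.
move=> r0 d0 Y0 YK C0 N0 hT hw.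
have -> : (r * P - r * Q) / d - b * Y = Y * (w / d - b) + r * (P - Q - r^-1 * Y * w) / d.
  by field; rewrite d0 gt_eqF.
set A := w / d - b; set T := P - Q - r^-1 * Y * w in hT *.
have dn : 0 < `|d| by rewrite normr_gt0.
have wE : w = (A + b) * d by rewrite /A subrK divfK.
have hT2 : `|r * T / d| <= r * C * (1 + N) * `|d| * (`|A| + `|b|).
  rewrite !normrM normfV ler_pdivrMr// (gtr0_norm r0) -!mulrA ler_wpM2l ?(ltW r0)//.
  apply: (le_trans hT); rewrite ler_wpM2l// -(real_normK (num_real _)) expr2.
  apply: (@le_trans _ _ ((`|d| * (1 + N)) * `|w|)); first by rewrite ler_wpM2r.
  have -> : (1 + N) * (`|d| * ((`|A| + `|b|) * `|d|)) = (`|d| * (1 + N)) * ((`|A| + `|b|) * `|d|) by ring.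
  rewrite ler_wpM2l ?mulr_ge0 ?addr_ge0// wE normrM ler_wpM2r//.
  exact: ler_normD.
apply: (le_trans (ler_normD _ _)); rewrite normrM (ger0_norm Y0).
have p1 : Y * `|A| <= K * `|A| by rewrite ler_wpM2r.
have q1 : 0 <= r * C * (1 + N) * `|A| by rewrite !mulr_ge0 ?addr_ge0// ltW.
have q2 : 0 <= `|d| * K * (`|A| + `|b|) by rewrite !mulr_ge0 ?addr_ge0// (le_trans Y0).
have -> : (K + r * C * (1 + N)) * `|A| + `|d| * (K + r * C * (1 + N)) * (`|A| + `|b|) =
  K * `|A| + r * C * (1 + N) * `|d| * (`|A| + `|b|) + (r * C * (1 + N) * `|A| + `|d| * K * (`|A| + `|b|)) by ring.
by apply: ler_wpDr; [exact: addr_ge0|exact: lerD].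
Qed.

Lemma velocity_bound (d P Q K C N b b' w : R) : 0 <= P -> P <= K ->
  0 <= C -> 0 <= N -> `|P - Q| <= C * `|w| -> `|w| <= `|d| * (1 + N) ->
  `|b' * P - b * Q| <= (K + C * (1 + N)) * `|b' - b| + `|d| * (K + C * (1 + N)) * `|b|.
Proof.
move=> P0 PK C0 N0 hT hw.
have -> : b' * P - b * Q = P * (b' - b) + b * (P - Q) by ring.
apply: (le_trans (ler_normD _ _)); rewrite !normrM (ger0_norm P0).
have p1 : P * `|b' - b| <= K * `|b' - b| by rewrite ler_wpM2r.
have p2 : `|b| * `|P - Q| <= C * (1 + N) * `|d| * `|b|.
  rewrite mulrC ler_wpM2r// (le_trans hT)// -mulrA ler_wpM2l// (le_trans hw)// mulrC.
  by [].
have q1 : 0 <= C * (1 + N) * `|b' - b| by rewrite !mulr_ge0 ?addr_ge0.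
have q2 : 0 <= `|d| * K * `|b| by rewrite !mulr_ge0// (le_trans P0).
have -> : (K + C * (1 + N)) * `|b' - b| + `|d| * (K + C * (1 + N)) * `|b| =
  K * `|b' - b| + C * (1 + N) * `|d| * `|b| + (C * (1 + N) * `|b' - b| + `|d| * K * `|b|) by ring.
by apply: ler_wpDr; [exact: addr_ge0|exact: lerD].
Qed.

End PowerEstimates.

(** * Arbitrary curves of the group in the flattening coordinate *)

Section PathCoordinates.
Context {R : realType}.
Local Notation mu := (@lebesgue_measure R).
Local Notation Int f := (mu.-integrable setT (EFin \o f)).
Implicit Types (phi u f : R -> R) (t s x : R) (I : set R).

Lemma cvg_abs_within I t (C : R) : `|s - t| * C @[s --> within I (nbhs t)] --> 0.
Proof. exact: (@cvg_abs_id R (within I (nbhs t)) t C _ (@cvg_within _ (nbhs t) _ I)). Qed.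

Lemma cvg_abs_punct I t : `|s - t| @[s --> within I t^'] --> (0 : R).
Proof.
rewrite -(normr0 R) -(subrr t); apply: cvg_norm; apply: cvgB; last exact: cvg_cst.
exact: within_dnbhs.
Qed.

Lemma near_within_punct I t (P : R -> Prop) :
  (\forall s \near within I t^', P s) -> \forall s \near within I (nbhs t), s != t -> P s.
Proof.
move=> H; have {}H : nbhs t (fun s => s != t -> I s -> P s) := H.
suff : nbhs t (fun s => I s -> s != t -> P s) by [].
by apply: filterS H => s H Is st; exact: H.
Qed.

Lemma near_punct_within I t (P : R -> Prop) :
  (\forall s \near within I (nbhs t), P s) -> \forall s \near within I t^', P s.
Proof.
move=> H; have {}H : nbhs t (fun s => I s -> P s) := H.
suff : nbhs t (fun s => s != t -> I s -> P s) by [].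
by apply: filterS H => s H _ Is; exact: H.
Qed.

(* The map phi |-> r phi_x^(1/r) turns F into the L^r norm. *)
Definition coord (r : R) phi x := r * derive1 phi x `^ r^-1.
Definition coord_vel (r : R) phi u x := derive1 u x * derive1 phi x `^ (r^-1 - 1).

Lemma coord_W r phi : Diff phi -> forall k, W k (fun x => coord r phi x - r).
Proof.
move=> /Diff_with[a d] k; rewrite /coord (diff_withE d).
have -> : (fun x => r * (1 + a x) `^ r^-1 - r) = (fun x => r * ((1 + a x) `^ r^-1 - 1)).
  by apply/funext => x; ring.
by case: d => _ wa a1 _; exact: (WkZ r (W_pow1 r^-1 wa a1 k)).
Qed.

Lemma coord_vel_W r phi u : Diff phi -> lie_algebra u -> forall k, W k (coord_vel r phi u).
Proof.
move=> /Diff_with[a d] /lie_algebraP[_ w _] k; rewrite /coord_vel (diff_withE d).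
exact: (WkM (w k) (B_1a d k _)).
Qed.

Lemma finsler_coord r phi u : 1 < r -> Diff phi -> lie_algebra u ->
  finsler r phi u = (normr_pow r (coord_vel r phi u) `^ r^-1)%:E.
Proof.
move=> r1 /Diff_with[a d] /lie_algebraP l; rewrite (finslerE r1 d l).
by rewrite /coord_vel (diff_withE d).
Qed.

(** The order 0 seminorm is the $L^1$ norm of [f'] and the order 1 seminorm bounds [f'] uniformly,
    by the Sobolev embedding. Uniform control keeps the slopes away from 0; $L^1$ control gives the
    limits of integrals. *)
Lemma seminorm_sup f f' : (forall x, is_derive x (1 : R) f (f' x)) ->
  (forall j, W j f') -> [/\ \int[mu]_x `|f' x| = fine (seminorm 0 f) &
    forall x, `|f' x| <= fine (seminorm 1 f)].
Proof.
move=> df w; rewrite !(seminorm_fin _ df w) derive1n0; split => // x.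
have [f'' df' w'] := WS (w 1%N).
rewrite derive1n1 (is_derive_fun df') /=.
by apply: (le_sup_int x df'); [exact: (W_cont w')|exact: (W_Int (w 0%N))|exact: (W_Int w')].
Qed.

Variables (r : R) (I : set R) (gamma v : R -> R -> R).
Hypotheses (r1 : 1 < r) (C1 : C1_path I gamma v).

Let r0 : 0 < r. Proof. by rewrite (lt_trans ltr01). Qed.

Lemma C1_Diff t : I t -> Diff (gamma t). Proof. by move=> /C1[]. Qed.

Lemma C1_lie t : I t -> lie_algebra (v t).
Proof. by move=> /C1[/Diff_with[a d] + _ _] => /(tangent_lie d). Qed.

Let a s x := derive1 (gamma s) x - 1.
Let b s := derive1 (v s).
Let da s : I s -> diff_with (gamma s) (a s).
Proof. by move=> /C1_Diff/DiffP. Qed.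
Let lb s : I s -> lie_with (v s) (b s).
Proof. by move=> /C1_lie/lie_algebraP. Qed.

(** The error of the difference quotient of the slopes at time [t]. *)
Let A t s x := (a s x - a t x) / (s - t) - b t x.

Let A_ctrl t : I t -> exists sg0 sg1 : R -> R,
  [/\ sg0 s @[s --> within I t^'] --> 0, sg1 s @[s --> within I t^'] --> 0 &
   forall s, I s -> [/\ forall k, W k (A t s), \int[mu]_x `|A t s x| <= sg0 s &
     forall x, `|A t s x| <= sg1 s] ].
Proof.
move=> It; have [_ _ H _] := C1 It.
pose f s x := (gamma s x - gamma t x) / (s - t) - v t x.
exists (fun s => fine (seminorm 0 (f s))), (fun s => fine (seminorm 1 (f s))).
split; [exact: fine_cvg (H 0%N)|exact: fine_cvg (H 1%N)|move=> s Is].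
have [dt wt _ _] := da It; have [ds ws _ _] := da Is; have [db wb _] := lb It.
have d x : is_derive x (1 : R) (f s) (A t s x).
  have c : is_derive x (1 : R) (fun _ : R => (s - t)^-1) 0 by exact: is_derive_c.
  have := is_derive_fB (is_derive_fM (is_derive_fB (ds x) (dt x)) c) (db x).
  by move/is_derive_eq; apply; rewrite /A; ring.
have w k : W k (A t s).
  rewrite /A; have -> : (fun x => (a s x - a t x) / (s - t) - b t x) =
     (fun x => (s - t)^-1 * (a s x - a t x) - b t x) by apply/funext => x; ring.
  exact: (WkB (WkZ _ (WkB (ws k) (wt k))) (wb k)).
by have [-> H1] := seminorm_sup d w; split.
Qed.

Let B_ctrl t : I t -> exists tau0 tau1 : R -> R,
  [/\ tau0 s @[s --> within I (nbhs t)] --> 0, tau1 s @[s --> within I (nbhs t)] --> 0 &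
   forall s, I s -> [/\ \int[mu]_x `|b s x - b t x| <= tau0 s &
     forall x, `|b s x - b t x| <= tau1 s] ].
Proof.
move=> It; have [_ _ _ H] := C1 It.
pose f s x := v s x - v t x.
exists (fun s => fine (seminorm 0 (f s))), (fun s => fine (seminorm 1 (f s))).
split; [exact: fine_cvg (H 0%N)|exact: fine_cvg (H 1%N)|move=> s Is].
have [dbt wbt _] := lb It; have [dbs wbs _] := lb Is.
have d x : is_derive x (1 : R) (f s) (b s x - b t x) by apply: is_derive_fB.
have w k : W k (fun x => b s x - b t x) := WkB (wbs k) (wbt k).
have [e H1] := seminorm_sup d w; split; last exact: H1.
by move: e => /= ->.
Qed.

(* Uniform range of phi_x near t, and first-order control of its variation. *)
Let range_ctrl t : I t -> exists eps M Mb, [/\ 0 < eps, 0 < Mb,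
  forall x, `|b t x| <= Mb,
  forall x, eps <= 1 + a t x <= M &
  \forall s \near within I (nbhs t), forall x,
   eps <= 1 + a s x <= M /\ `|a s x - a t x| <= `|s - t| * (1 + Mb)].
Proof.
move=> It; have dt := da It; have [_ wb _] := lb It.
have [eps e0 He] := diff_gap dt; have [M M0 HM] := W_int_abs (diff_W dt 1).
have [Mb Mb0 HMb] := W_int_abs (wb 1%N).
have [sg0 [sg1 [_ l1 HA]]] := A_ctrl It.
exists (eps / 2), (1 + M + eps / 2), Mb; split => //.
- by rewrite divr_gt0.
- move=> x; have := He x; have := HM x; rewrite ler_norml => /andP[_ ?] ?.
  by apply/andP; split; lra.
have sg1_1 : \forall s \near within I (nbhs t), s != t -> `|sg1 s| < 1.
  exact: (near_within_punct (cvgr0_norm_lt _ l1 _ ltr01)).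
have nb : \forall s \near within I (nbhs t), `|s - t| * (1 + Mb) < eps / 2.
  have c : `|s - t| * (1 + Mb) @[s --> within I (nbhs t)] --> 0.
    exact: cvg_abs_within.
  have e2 : 0 < eps / 2 by rewrite divr_gt0.
  have c2 := cvgr0_norm_lt _ c _ e2; near=> s.
  have : `|(`|s - t| * (1 + Mb))| < eps / 2 by near: s; exact: c2.
  by rewrite ger0_norm// mulr_ge0// addr_ge0// ltW.
near=> s => x.
have Is : I s by near: s; exact: withinT.
have h2 : `|a s x - a t x| <= `|s - t| * (1 + Mb).
  have [->|st] := eqVneq s t; first by rewrite !subrr normr0 mul0r.
  have s1 : `|sg1 s| < 1 by move: st; near: s.
  have -> : a s x - a t x = (s - t) * (A t s x + b t x).
    by rewrite /A; field; rewrite subr_eq0.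
  rewrite normrM ler_wpM2l// (le_trans (ler_normD _ _))// lerD//.
  have [_ _ H] := HA s Is; apply: (le_trans (H x)).
  by apply: ltW; apply: le_lt_trans s1; exact: ler_norm.
split => //.
have h3 : `|s - t| * (1 + Mb) < eps / 2 by near: s.
have := He x; have := HM x; rewrite ler_norml => /andP[_ ?] ?.
by move: (le_lt_trans h2 h3); rewrite ltr_norml => /andP[? ?]; apply/andP; split; lra.
Unshelve. all: by end_near. Qed.

Lemma coordE s x : I s -> coord r (gamma s) x = r * (1 + a s x) `^ r^-1.
Proof. by move=> _; rewrite /coord /a addrC subrK. Qed.

Lemma coord_velE s x : I s -> coord_vel r (gamma s) (v s) x = b s x * (1 + a s x) `^ (r^-1 - 1).
Proof. by move=> _; rewrite /coord_vel /a [1 + _]addrC subrK. Qed.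

Let cslope t s x := (coord r (gamma s) x - coord r (gamma t) x) / (s - t) - coord_vel r (gamma t) (v t) x.

(** [A t s] and [b t] are both integrable and bounded, so this one bound gives the pointwise limit
    [coord_slope_pt] as well as the $L^1$ limit [coord_slope]. *)
Let slope_ctrl t : I t -> exists2 K, 0 < K &
  \forall s \near within I t^', forall x,
    `|cslope t s x| <= K * `|A t s x| + `|s - t| * K * (`|A t s x| + `|b t x|).
Proof.
move=> It; have [eps [M [Mb [e0 Mb0 HMb Ht Hs]]]] := range_ctrl It.
have [C C0 HC] := @pow_taylor R r^-1 eps M e0.
have [K K0 HK] := @pow_bound R (r^-1 - 1) eps M e0.
exists (K + r * C * (1 + Mb)).
  by rewrite addr_gt0// !mulr_gt0// addr_gt0.
have Hs' : \forall s \near within I t^', forall x,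
   eps <= 1 + a s x <= M /\ `|a s x - a t x| <= `|s - t| * (1 + Mb).
  exact: near_punct_within Hs.
near=> s => x.
have Is : I s by near: s; exact: withinT.
have st : s - t != 0.
  rewrite subr_eq0; near: s; apply: (cvg_within (F := dnbhs t)); exact: withinT.
have /(_ x)[hs h2] : forall x, eps <= 1 + a s x <= M /\ `|a s x - a t x| <= `|s - t| * (1 + Mb).
  by near: s; exact: Hs'.
have d0 : 0 < `|s - t| by rewrite normr_gt0.
have ht := Ht x.
rewrite /cslope !coordE// coord_velE//.
have zy : (1 + a s x) - (1 + a t x) = a s x - a t x by rewrite opprD addrACA subrr add0r.
have hT := HC _ _ ht hs; rewrite zy in hT.
exact: (slope_bound _ r0 st (powR_ge0 _ _) (HK _ ht) (ltW C0) (ltW Mb0) hT h2).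
Unshelve. all: by end_near. Qed.

Let vel_ctrl t : I t -> exists2 K, 0 < K &
  \forall s \near within I (nbhs t), forall x,
    `|coord_vel r (gamma s) (v s) x - coord_vel r (gamma t) (v t) x| <=
       K * `|b s x - b t x| + `|s - t| * K * `|b t x|.
Proof.
move=> It; have [eps [M [Mb [e0 Mb0 HMb Ht Hs]]]] := range_ctrl It.
have [C C0 HC] := @pow_lip R (r^-1 - 1) eps M e0.
have [K K0 HK] := @pow_bound R (r^-1 - 1) eps M e0.
exists (K + C * (1 + Mb)); first by rewrite addr_gt0// mulr_gt0// addr_gt0.
near=> s => x.
have Is : I s by near: s; exact: withinT.
have /(_ x)[hs h2] : forall x, eps <= 1 + a s x <= M /\ `|a s x - a t x| <= `|s - t| * (1 + Mb).
  by near: s; exact: Hs.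
have ht := Ht x.
rewrite !coord_velE//.
have zy : (1 + a s x) - (1 + a t x) = a s x - a t x by rewrite opprD addrACA subrr add0r.
have hT := HC _ _ hs ht; rewrite zy in hT.
exact: (velocity_bound _ _ (powR_ge0 _ _) (HK _ hs) (ltW C0) (ltW Mb0) hT h2).
Unshelve. all: by end_near. Qed.

Lemma coord_slope_pt t x : I t ->
  (coord r (gamma s) x - coord r (gamma t) x) / (s - t) @[s --> within I t^'] -->
  coord_vel r (gamma t) (v t) x.
Proof.
move=> It; have [K K0 HK] := slope_ctrl It; have [sg0 [sg1 [_ l1 HA]]] := A_ctrl It.
apply/subr_cvg0; apply: norm_cvg0.
have lim0 : K * sg1 s + `|s - t| * (K * (sg1 s + `|b t x|)) @[s --> within I t^'] --> 0.
  rewrite (_ : 0 = K * 0 + 0 * (K * (0 + `|b t x|))); last by rewrite mul0r mulr0 addr0.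
  have c0 : `|s - t| @[s --> within I t^'] --> 0.
    exact: cvg_abs_punct.
  apply: cvgD; first by apply: cvgM => //; exact: cvg_cst.
  apply: cvgM => //; apply: cvgM; first exact: cvg_cst.
  by apply: cvgD => //; exact: cvg_cst.
apply: (squeeze_cvgr _ (cvg_cst _) lim0); near=> s.
have Is : I s by near: s; exact: withinT.
rewrite normr_ge0 /=.
have /(_ x) h : forall x, `|cslope t s x| <= K * `|A t s x| + `|s - t| * K * (`|A t s x| + `|b t x|).
  by near: s; exact: HK.
apply: (le_trans h); have [_ _ /(_ x) H] := HA s Is.
rewrite -mulrA; apply: lerD; first by rewrite ler_wpM2l// ltW.
by rewrite !ler_wpM2l// ?lerD2r// ltW.
Unshelve. all: by end_near. Qed.

Lemma coord_vel_cont_pt t x : I t ->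
  coord_vel r (gamma s) (v s) x @[s --> within I (nbhs t)] --> coord_vel r (gamma t) (v t) x.
Proof.
move=> It; have [K K0 HK] := vel_ctrl It; have [sg0 [sg1 [_ l1 HA]]] := B_ctrl It.
apply/subr_cvg0; apply: norm_cvg0.
have lim0 : K * sg1 s + `|s - t| * (K * `|b t x|) @[s --> within I (nbhs t)] --> 0.
  rewrite (_ : 0 = K * 0 + 0); last by rewrite mulr0 addr0.
  apply: cvgD; first by apply: cvgM => //; exact: cvg_cst.
  exact: cvg_abs_within.
apply: (squeeze_cvgr _ (cvg_cst _) lim0); near=> s.
have Is : I s by near: s; exact: withinT.
rewrite normr_ge0 /=.
have /(_ x) h : forall x, `|coord_vel r (gamma s) (v s) x - coord_vel r (gamma t) (v t) x| <=
       K * `|b s x - b t x| + `|s - t| * K * `|b t x|.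
  by near: s; exact: HK.
apply: (le_trans h); have [_ /(_ x) H] := HA s Is.
by rewrite -mulrA; apply: lerD => //; rewrite ler_wpM2l// ltW.
Unshelve. all: by end_near. Qed.

Lemma coord_slope t : I t ->
  \int[mu]_x `|(coord r (gamma s) x - coord r (gamma t) x) / (s - t) - coord_vel r (gamma t) (v t) x|
   @[s --> within I t^'] --> 0.
Proof.
move=> It; have [K K0 HK] := slope_ctrl It; have [sg0 [sg1 [l0 _ HA]]] := A_ctrl It.
pose Ib := \int[mu]_x `|b t x|.
have lim0 : K * sg0 s + `|s - t| * (K * (sg0 s + Ib)) @[s --> within I t^'] --> 0.
  rewrite (_ : 0 = K * 0 + 0 * (K * (0 + Ib))); last by rewrite mul0r mulr0 addr0.
  have c0 : `|s - t| @[s --> within I t^'] --> 0.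
    exact: cvg_abs_punct.
  apply: cvgD; first by apply: cvgM => //; exact: cvg_cst.
  apply: cvgM => //; apply: cvgM; first exact: cvg_cst.
  by apply: cvgD => //; exact: cvg_cst.
apply: (squeeze_cvgr _ (cvg_cst _) lim0); near=> s.
have Is : I s by near: s; exact: withinT.
rewrite Rintegral_ge0 /=; last by [].
have h : forall x, `|cslope t s x| <= K * `|A t s x| + `|s - t| * K * (`|A t s x| + `|b t x|).
  by near: s; exact: HK.
have [wA H _] := HA s Is.
have [_ wb _] := lb It.
have iA := Int_norm (W_Int (wA 0%N)); have ib := Int_norm (W_Int (wb 0%N)).
have ws s' : I s' -> W 0 (fun x => coord r (gamma s') x - r).
  by move=> Is'; apply: coord_W; exact: C1_Diff.
have wc : W 0 (cslope t s).
  have -> : cslope t s = (fun x => (s - t)^-1 * ((coord r (gamma s) x - r) - (coord r (gamma t) x - r)) -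
      coord_vel r (gamma t) (v t) x).
    by apply/funext => x; exact: slope_shift.
  exact: (WkB (WkZ _ (WkB (ws s Is) (ws t It))) (coord_vel_W r (C1_Diff It) (C1_lie It) 0)).
have j1 : Int (fun x => K * `|A t s x|) by exact: IntZ.
have j2 : Int (fun x => `|A t s x| + `|b t x|) by exact: IntD.
have j3 : Int (fun x => `|s - t| * K * (`|A t s x| + `|b t x|)) by exact: IntZ.
apply: (le_trans (Rint_le (Int_norm (W_Int wc)) (IntD j1 j3) h)).
rewrite RintegralD// !RintegralZl// RintegralD// -mulrA.
apply: lerD; first by rewrite ler_wpM2l// ltW.
by rewrite !ler_wpM2l// ?lerD2r// ltW.
Unshelve. all: by end_near. Qed.

Lemma coord_vel_cont t : I t ->
  \int[mu]_x `|coord_vel r (gamma s) (v s) x - coord_vel r (gamma t) (v t) x|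
    @[s --> within I (nbhs t)] --> 0.
Proof.
move=> It; have [K K0 HK] := vel_ctrl It; have [sg0 [sg1 [l0 _ HA]]] := B_ctrl It.
pose Ib := \int[mu]_x `|b t x|.
have lim0 : K * sg0 s + `|s - t| * (K * Ib) @[s --> within I (nbhs t)] --> 0.
  rewrite (_ : 0 = K * 0 + 0); last by rewrite mulr0 addr0.
  apply: cvgD; first by apply: cvgM => //; exact: cvg_cst.
  exact: cvg_abs_within.
apply: (squeeze_cvgr _ (cvg_cst _) lim0); near=> s.
have Is : I s by near: s; exact: withinT.
rewrite Rintegral_ge0 /=; last by [].
have h : forall x, `|coord_vel r (gamma s) (v s) x - coord_vel r (gamma t) (v t) x| <=
       K * `|b s x - b t x| + `|s - t| * K * `|b t x|.
  by near: s; exact: HK.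
have [H _] := HA s Is.
have [_ wb _] := lb It; have [_ wbs _] := lb Is.
have ib := Int_norm (W_Int (wb 0%N)).
have id_ : Int (fun x => `|b s x - b t x|) by apply: Int_norm; apply: (W_Int (WkB (wbs 0%N) (wb 0%N))).
have wv s' : I s' -> W 0 (coord_vel r (gamma s') (v s')).
  by move=> Is'; apply: coord_vel_W; [exact: C1_Diff|exact: C1_lie].
have wc := WkB (wv s Is) (wv t It).
have j1 : Int (fun x => K * `|b s x - b t x|) by exact: IntZ.
have j3 : Int (fun x => `|s - t| * K * `|b t x|) by exact: IntZ.
apply: (le_trans (Rint_le (Int_norm (W_Int wc)) (IntD j1 j3) h)).
rewrite RintegralD// !RintegralZl// -mulrA.
by apply: lerD => //; rewrite ler_wpM2l// ltW.
Unshelve. all: by end_near. Qed.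

End PathCoordinates.

(** * Comparison of numbers through their roots *)

Section Roots.
Context {R : realType}.
Implicit Types r y z : R.

Lemma powR_root_inj r y z : 0 < r -> 0 <= y -> 0 <= z -> y `^ r^-1 = z `^ r^-1 -> y = z.
Proof. by move=> r0 y0 z0 e; rewrite -(powR_root r0 y0) e powR_root. Qed.

Lemma powR_root_le r y z : 0 < r -> 0 <= y -> 0 <= z -> y `^ r^-1 <= z `^ r^-1 -> y <= z.
Proof.
move=> r0 y0 z0 e; rewrite -(powR_root r0 y0) -(powR_root r0 z0).
by apply: ge0_ler_powR => //; rewrite ?nnegrE ?powR_ge0// ltW.
Qed.

End Roots.

(** * Affine paths minimise, and constant-speed minimisers are affine *)

Section GeodesicTheory.
Context {R : realType}.
Local Notation mu := (@lebesgue_measure R).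
Implicit Types (phi u f : R -> R) (a b s t x : R) (I J : set R) (gamma v eta w : R -> R -> R).
Variable r : R.
Hypothesis r1 : 1 < r.

Let r0 : 0 < r. Proof. exact: lt_trans r1. Qed.

Lemma C1_path_sub I J gamma v : J `<=` I -> C1_path I gamma v -> C1_path J gamma v.
Proof.
move=> JI H t Jt; have [h1 h2 h3 h4] := H t (JI t Jt).
split; [exact: h1|exact: h2|move=> k|move=> k].
  apply: (cvg_trans _ (h3 k)); apply: cvg_app; exact: within_mono JI.
apply: (cvg_trans _ (h4 k)); apply: cvg_app; exact: within_mono JI.
Qed.

Lemma coord_div phi x : coord r phi x / r = derive1 phi x `^ r^-1.
Proof. by rewrite /coord mulrAC mulfV ?(lt0r_neq0 r0) ?mul1r. Qed.

Lemma coordK phi x : Diff phi -> (coord r phi x / r) `^ r = derive1 phi x.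
Proof.
move=> /Diff_with[f d]; rewrite coord_div (diff_withE d).
exact: (powR_root r0 (ltW (diff_pos d x))).
Qed.

Lemma coord_gap phi : Diff phi -> exists2 eps, 0 < eps & forall x, eps <= coord r phi x / r.
Proof.
move=> /Diff_with[f d]; have [eps e0 He] := diff_gap d.
exists (eps `^ r^-1); first exact: powR_gt0.
move=> x; rewrite coord_div (diff_withE d).
have ri : 0 <= r^-1 by rewrite invr_ge0 ltW.
apply: (ge0_ler_powR ri _ _ (He x)); rewrite nnegrE; first exact: ltW.
exact: (ltW (diff_pos d x)).
Qed.

Lemma Diff_prim phi : Diff phi -> phi = (fun x => x + prim (fun y => derive1 phi y - 1) x).
Proof. by move=> /DiffP/diff_primE. Qed.

Section Path.
Variables (a b : R) (eta w : R -> R -> R).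
Hypotheses (ab : a < b) (C1 : C1_path `[a, b] eta w).

Let g s := coord r (eta s).
Let gt s := coord_vel r (eta s) (w s).

Lemma path_W t : `[a, b]%classic t -> W 1 (fun x => g t x - r).
Proof. by move=> It; exact: (coord_W r (C1_Diff C1 It) 1). Qed.

Lemma path_vel_W t : `[a, b]%classic t -> W 1 (gt t).
Proof. by move=> It; exact: (coord_vel_W r (C1_Diff C1 It) (C1_lie C1 It) 1). Qed.

Lemma path_lengthE : path_length r a b eta w =
  (\int[mu]_(s in `[a, b]) (normr_pow r (gt s) `^ r^-1)%:E)%E.
Proof.
apply: eq_integral => s /set_mem Is.
by rewrite (finsler_coord r1 (C1_Diff C1 Is) (C1_lie C1 Is)).
Qed.

Lemma path_length_ge :
  ((normr_pow r (mean_slope a b g) `^ r^-1 * (b - a))%:E <= path_length r a b eta w)%E.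
Proof.
rewrite path_lengthE; apply: (@curve_length_ge R r a b r g gt r1 ab).
- exact: path_W.
- exact: path_vel_W.
- by move=> t It; exact: (coord_slope r1 C1 It).
- by move=> t It; exact: (coord_vel_cont r C1 It).
Qed.

Lemma path_rigidity C : (forall s, `[a, b]%classic s -> normr_pow r (gt s) = C) ->
  C <= normr_pow r (mean_slope a b g) ->
  forall s x, a < s < b -> gt s x = mean_slope a b g x.
Proof.
apply: (@curve_rigidity R r a b r g gt r1 ab).
- exact: path_W.
- exact: path_vel_W.
- by move=> t It; exact: (coord_slope r1 C1 It).
Qed.

End Path.

Section AffineGeodesic.
Variables (p n : R -> R).
Hypotheses (wp : forall k, W k (fun x => p x - 1)) (wn : forall k, W k n).

Lemma coord_affine t x : affine_good p n t -> coord r (affine_path r p n t) x = r * affine_base p n t x.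
Proof.
move=> gt; have d := aff_diff r wp wn gt.
rewrite /coord (diff_withE d) /path_slope addrC subrK -powRrM mulfV ?gt_eqF//.
by rewrite powRr1// ltW// good_gt0.
Qed.

Lemma affine_mean_slope a b : a < b -> affine_good p n a -> affine_good p n b ->
  mean_slope a b (fun s => coord r (affine_path r p n s)) = (fun x => r * n x).
Proof.
move=> ab ga gb; apply/funext => x; rewrite /mean_slope.
transitivity ((r * affine_base p n b x - r * affine_base p n a x) / (b - a)).
  by congr ((_ - _) / _); exact: coord_affine.
by rewrite /affine_base; field; rewrite subr_eq0 gt_eqF.
Qed.

Lemma affine_length a b : a < b -> (forall t, `[a, b]%classic t -> affine_good p n t) ->
  path_length r a b (affine_path r p n) (velocity r p n) =
  (normr_pow r (fun x => r * n x) `^ r^-1 * (b - a))%:E.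
Proof.
move=> ab good; rewrite /path_length.
transitivity (\int[mu]_(s in `[a, b]) cst (normr_pow r (fun x => r * n x) `^ r^-1)%:E s)%E.
  by apply: eq_integral => s /set_mem Is; rewrite (finsler_aff r1 wp wn (good s Is)).
by rewrite integral_cst//= lebesgue_measure_itv /= lte_fin ab -EFinD -EFinM.
Qed.

Lemma affine_geodesic I : (forall a b s, I a -> I b -> a <= s <= b -> I s) ->
  (forall t, I t -> affine_good p n t) -> geodesic r I (affine_path r p n) (velocity r p n).
Proof.
move=> cI good; split.
- exact: aff_C1_path.
- move=> s t Is It.
  exact: (etrans (finsler_aff r1 wp wn (good s Is)) (esym (finsler_aff r1 wp wn (good t It)))).
(* Any [delta] would do: an affine path minimises between any two of its times. *)
- move=> t0 It0; exists 1; first exact: ltr01.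
  move=> a b Ia Ib _ _ ab eta w C1 ea eb.
  have gab t : `[a, b]%classic t -> affine_good p n t.
    by rewrite /= in_itv /= => tab; apply: good; exact: (cI a b t).
  rewrite (affine_length ab gab).
  (* The lower bound for the length of [eta] depends only on its end points, hence on the mean slope
     of the affine path. *)
  suff <- : mean_slope a b (fun s => coord r (eta s)) = (fun x => r * n x).
    exact: path_length_ge.
  rewrite -(affine_mean_slope ab (good a Ia) (good b Ib)).
  by apply/funext => x; rewrite /mean_slope ea eb.
Qed.

End AffineGeodesic.

(** The competitor is the affine path with the same end points; it stays in the group because its
    base is a convex combination of two functions bounded below by positive constants. Minimality
    and constant speed bound the speed by the norm of the mean slope, the equality case treated by
    [path_rigidity]. *)
Lemma geodesic_segment a b gamma v c : a < b -> C1_path `[a, b] gamma v ->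
  (forall s, `[a, b]%classic s -> finsler r (gamma s) (v s) = c) ->
  (forall eta w, C1_path `[a, b] eta w -> eta a = gamma a -> eta b = gamma b ->
     (path_length r a b gamma v <= path_length r a b eta w)%E) ->
  exists n, forall s x, a < s < b -> coord_vel r (gamma s) (v s) x = n x.
Proof.
move=> ab C1 cst_speed minimal.
have Ia : `[a, b]%classic a by rewrite /= in_itv /= lexx ltW.
have Ib : `[a, b]%classic b by rewrite /= in_itv /= lexx ltW.
have Da := C1_Diff C1 Ia; have Db := C1_Diff C1 Ib.
have ba0 : b - a != 0 by rewrite subr_eq0 gt_eqF.
pose ms := mean_slope a b (fun s => coord r (gamma s)).
pose n x := r^-1 * ms x.
(* Chosen so that the base [p + s n] equals [coord / r] at both times [a] and [b]. *)
pose p x := coord r (gamma a) x / r - a * n x.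
have wms k : W k ms.
  have -> : ms = (fun x => (b - a)^-1 * ((coord r (gamma b) x - r) - (coord r (gamma a) x - r))).
    by apply/funext => x; rewrite /ms /mean_slope mulrC opprB addrA subrK.
  exact: (WkZ _ (WkB (coord_W r Db k) (coord_W r Da k))).
have wn k : W k n by exact: (WkZ _ (wms k)).
have wp k : W k (fun x => p x - 1).
  have -> : (fun x => p x - 1) = (fun x => r^-1 * (coord r (gamma a) x - r) - a * n x).
    by apply/funext => x; rewrite /p mulrBr mulVf ?gt_eqF// addrAC [_ / r]mulrC.
  exact: (WkB (WkZ _ (coord_W r Da k)) (WkZ _ (wn k))).
have baseE s x : affine_base p n s x =
    ((b - s) * (coord r (gamma a) x / r) + (s - a) * (coord r (gamma b) x / r)) / (b - a).
  rewrite /affine_base /p /n /ms /mean_slope.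
  move: (coord r (gamma a) x) (coord r (gamma b) x) => ca cb; field.
  by rewrite ba0 gt_eqF.
have [ea ea0 Ha] := coord_gap Da; have [eb eb0 Hb] := coord_gap Db.
have good s : `[a, b]%classic s -> affine_good p n s.
  rewrite /= in_itv /= => /andP[as_ sb]; exists (Num.min ea eb); first by rewrite lt_min ea0.
  move=> x; rewrite baseE ler_pdivlMr ?subr_gt0//.
  have h1 : Num.min ea eb <= coord r (gamma a) x / r by rewrite ge_min Ha.
  have h2 : Num.min ea eb <= coord r (gamma b) x / r by rewrite ge_min Hb orbT.
  have -> : Num.min ea eb * (b - a) = (b - s) * Num.min ea eb + (s - a) * Num.min ea eb by ring.
  rewrite -subr_ge0 in as_; rewrite -subr_ge0 in sb.
  exact: (lerD (ler_wpM2l sb h1) (ler_wpM2l as_ h2)).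
have ends s : `[a, b]%classic s -> (forall x, affine_base p n s x = coord r (gamma s) x / r) ->
    affine_path r p n s = gamma s.
  move=> Is e; rewrite [RHS](Diff_prim (C1_Diff C1 Is)); apply/funext => x.
  congr (x + prim _ x); apply/funext => y.
  by rewrite /path_slope e coordK//; exact: (C1_Diff C1 Is).
have endA : affine_path r p n a = gamma a.
  by apply: ends => // x; rewrite baseE subrr mul0r addr0 mulrAC mulfV// mul1r.
have endB : affine_path r p n b = gamma b.
  by apply: ends => // x; rewrite baseE subrr mul0r add0r mulrAC mulfV// mul1r.
have := minimal _ _ (aff_C1_path r wp wn good) endA endB.
rewrite (affine_length wp wn ab good).
have -> : (fun x => r * n x) = ms by apply/funext => x; rewrite /n mulrA mulfV ?gt_eqF// mul1r.
have ba : 0 < b - a by rewrite subr_gt0.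
pose N := normr_pow r (coord_vel r (gamma a) (v a)).
have Nc s : `[a, b]%classic s -> normr_pow r (coord_vel r (gamma s) (v s)) `^ r^-1 = N `^ r^-1.
  move=> Is.
  have e1 := finsler_coord r1 (C1_Diff C1 Is) (C1_lie C1 Is).
  have e2 := finsler_coord r1 (C1_Diff C1 Ia) (C1_lie C1 Ia).
  have e3 := etrans (esym e1) (etrans (etrans (cst_speed s Is) (esym (cst_speed a Ia))) e2).
  exact: EFin_inj e3.
have -> : path_length r a b gamma v = (N `^ r^-1 * (b - a))%:E.
  rewrite (path_lengthE C1).
  transitivity (\int[mu]_(s in `[a, b]) cst (N `^ r^-1)%:E s)%E.
    by apply: eq_integral => s /set_mem Is; exact: (congr1 EFin (Nc s Is)).
  by rewrite integral_cst//= lebesgue_measure_itv /= lte_fin ab -EFinD -EFinM.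
rewrite lee_fin ler_pM2r// => Nle.
have N0 : 0 <= N by exact: normr_pow_ge0.
have M0 : 0 <= normr_pow r ms by exact: normr_pow_ge0.
exists ms; apply: (@path_rigidity a b gamma v ab C1 N).
  move=> s Is; exact: (powR_root_inj r0 (normr_pow_ge0 _ _) N0 (Nc s Is)).
exact: (powR_root_le r0 N0 M0 Nle).
Qed.

End GeodesicTheory.

(** * Geodesics from the identity: existence, uniqueness, lifespan *)

Section FlowTheory.
Context {R : realType}.
Variables (r : R) (u0 : R -> R).
Hypotheses (r1 : 1 < r) (lu0 : lie_algebra u0).
Implicit Types (t s x : R) (T : \bar R) (gamma v : R -> R -> R).

Let r0 : 0 < r. Proof. exact: lt_trans r1. Qed.

Local Notation a := (derive1 u0).

Lemma datum_lie : lie_with u0 a. Proof. exact/lie_algebraP. Qed.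

Lemma datum_W k : W k a. Proof. by case: datum_lie. Qed.

(** The base at time 0, where the path is the identity and has slope 1. *)
Definition unit_fun (x : R) : R := 1.
Definition rate x := r^-1 * a x.

Lemma unit_W k : W k (fun x => unit_fun x - 1).
Proof.
have -> : (fun x => unit_fun x - 1) = (fun x => 0 * a x).
  by apply/funext => x; rewrite subrr mul0r.
exact: (WkZ 0 (datum_W k)).
Qed.

Lemma rate_W k : W k rate. Proof. exact: (WkZ _ (datum_W k)). Qed.

Local Notation good := (affine_good unit_fun rate).
Local Notation path := (affine_path r unit_fun rate).
Local Notation vel := (velocity r unit_fun rate).

Lemma rateM t x : t * rate x = t * a x / r.
Proof. by rewrite /rate mulrCA mulrC. Qed.

Lemma flowE : flow r u0 = path.
Proof.
have E t : (fun y => (t * a y / r + 1) `^ r - 1) = path_slope r unit_fun rate t.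
  apply/funext => y; rewrite /path_slope /affine_base /unit_fun rateM.
  by congr (_ `^ _ - _); exact: addrC.
by apply/funext => t; apply/funext => x; rewrite /flow /affine_path /prim -E.
Qed.

Lemma path0 : path 0 = id.
Proof.
apply/funext => x; rewrite /affine_path.
have -> : path_slope r unit_fun rate 0 = (fun x => 0 * a x).
  by apply/funext => y; rewrite /path_slope /affine_base /unit_fun mul0r addr0 powR1 subrr mul0r.
by rewrite primZ ?mul0r ?addr0//; exact: (W_Int (datum_W 0)).
Qed.

Lemma vel0 : vel 0 = u0.
Proof.
rewrite (lie_prim datum_lie) /velocity; congr prim; apply/funext => y.
by rewrite /velocity_slope /affine_base /unit_fun mul0r addr0 powR1 mulr1 /rate mulrA mulfV ?mul1r// lt0r_neq0.
Qed.

Lemma flow_exists T : (0 < T)%E -> (forall t, time_interval T t -> good t) ->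
  geodesic_exists r id u0 T.
Proof.
move=> T0 gT; exists path, vel; split; [|exact: path0|exact: vel0].
apply: (affine_geodesic r1 unit_W rate_W _ gT) => b c s [b0 _] [_ cT] /andP[bs sc]; split.
  exact: le_trans bs.
by apply: le_lt_trans cT; rewrite lee_fin.
Qed.

Section Uniqueness.
Variables (T : \bar R) (gamma v : R -> R -> R).
Hypothesis gf : geodesic_from r id u0 T gamma v.
Local Notation I := (time_interval T).

Let C1 : C1_path I gamma v. Proof. by case: gf => -[]. Qed.

Let I_sub s t : 0 <= s -> I t -> `[s, t]%classic `<=` I.
Proof.
move=> s0 [_ tT] z; rewrite /= in_itv /= => /andP[sz zt]; split; first exact: le_trans sz.
by apply: le_lt_trans tT; rewrite lee_fin.
Qed.

Lemma coord_id x : coord r id x = r.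
Proof. by rewrite /coord derive1_id powR1 mulr1. Qed.

Lemma geodesic_vel0 x : coord_vel r (gamma 0) (v 0) x = a x.
Proof. by case: gf => _ -> ->; rewrite /coord_vel derive1_id powR1 mulr1. Qed.

Lemma geodesic_vel_locally_constant t0 x : 0 < t0 -> I t0 ->
  is_derive t0 (1 : R) (fun s => coord_vel r (gamma s) (v s) x) 0.
Proof.
move=> t00 It0; case: gf => -[_ cst_speed locmin] _ _.
have [d d0 Hd] := locmin t0 It0.
have [e e0 He] : exists2 e : R, 0 < e & ((t0 + e)%:E < T)%E.
  case: It0 => _; case: (T) => [T'||//].
    rewrite lte_fin => tT; exists ((T' - t0) / 2); first by rewrite divr_gt0// subr_gt0.
    by rewrite lte_fin; lra.
  by exists 1 => //; exact: ltry.
(* The three bounds keep [t0 - k] and [t0 + k] within the minimality radius [d], below [T] and above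
   0. *)
pose k := Num.min (Num.min (d / 2) (e / 2)) (t0 / 2).
have k0 : 0 < k by rewrite !lt_min !divr_gt0.
have [kd ke kt] : [/\ k <= d / 2, k <= e / 2 & k <= t0 / 2].
  by rewrite /k !ge_min !lexx ?orbT.
have Ib : I (t0 + k).
  split; first by lra.
  by apply: lt_trans He; rewrite lte_fin; lra.
have Ia : I (t0 - k) by apply: (I_sub (lexx 0) Ib); rewrite /= in_itv /=; lra.
have ab : t0 - k < t0 + k by lra.
have sub : `[t0 - k, t0 + k]%classic `<=` I by apply: I_sub => //; lra.
have [n Hn] : exists n, forall s x, t0 - k < s < t0 + k -> coord_vel r (gamma s) (v s) x = n x.
  apply: (@geodesic_segment R r r1 _ _ gamma v (finsler r (gamma (t0 - k)) (v (t0 - k))) ab (C1_path_sub sub C1)).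
    by move=> s /sub Is; exact: cst_speed.
  move=> eta w Ce ea eb; apply: (Hd _ _ Ia Ib _ _ ab eta w Ce ea eb).
    by rewrite ltr_norml; lra.
  by rewrite ltr_norml; lra.
have tI : (`]t0 - k, t0 + k[%classic : set R) t0 by rewrite /= in_itv /=; lra.
have oI : open (`]t0 - k, t0 + k[%classic : set R) by exact: interval_open.
apply: (is_derive_ext_open oI tI _ (is_derive_c (n x) t0)) => s.
by rewrite /= in_itv /= => /Hn ->.
Qed.

(** The derivative vanishes at positive times only; continuity within the interval at time 0 ties
    the constant to the initial velocity. *)
Lemma geodesic_vel t x : I t -> coord_vel r (gamma t) (v t) x = a x.
Proof.
move=> It; rewrite -geodesic_vel0.
have [t0 _] := It; have sub := I_sub (lexx 0) It.
have [s|s|c _] := @MVT_segment _ (fun s => coord_vel r (gamma s) (v s) x) (fun _ => 0) 0 t t0.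
- rewrite in_itv /= => /andP[s0 st]; apply: geodesic_vel_locally_constant => //.
  by apply: sub; rewrite /= in_itv /= !ltW.
- move: s; apply/subspace_continuousP => s sI.
  by have := @coord_vel_cont_pt R r I gamma v C1 s x (sub s sI); apply: cvg_trans; apply: cvg_app; exact: within_mono.
by rewrite mul0r => /subr0_eq.
Qed.

Lemma geodesic_coord t x : I t -> coord r (gamma t) x = r + t * a x.
Proof.
move=> It; have [t0 _] := It; have sub := I_sub (lexx 0) It.
have L s : `[0, t]%classic s ->
    (coord r (gamma z) x - coord r (gamma s) x) / (z - s) @[z --> within `[0, t] s^'] --> a x.
  move=> sI; rewrite -(geodesic_vel x (sub s sI)).
  by apply: cvg_trans (@coord_slope_pt R r I gamma v r1 C1 s x (sub s sI)); apply: cvg_app; exact: within_mono.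
have c := within_slope_cont L.
have [s sI||z _] := @MVT_segment _ (fun s => coord r (gamma s) x) (fun _ => a x) 0 t t0.
- move: sI; rewrite in_itv /= => sI; apply: (within_slope_derive sI); apply: L.
  by rewrite /= in_itv /=; case/andP: sI => /ltW -> /ltW ->.
- exact: c.
- by rewrite subr0 mulrC; case: gf => _ -> _; rewrite coord_id => <-; rewrite subrKC.
Qed.

Lemma geodesic_flow t : I t -> gamma t = path t.
Proof.
move=> It; have D := C1_Diff C1 It.
rewrite (Diff_prim D); apply/funext => x; congr (_ + prim _ x); apply/funext => y.
rewrite -(coordK r1 y D) (geodesic_coord y It) /path_slope /affine_base /unit_fun rateM mulrDl.
by rewrite mulfV ?lt0r_neq0.
Qed.

Lemma geodesic_pos t x : I t -> 0 < r + t * a x.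
Proof.
move=> It; rewrite -(geodesic_coord x It) /coord mulr_gt0// powR_gt0//.
by have [f d] := Diff_with (C1_Diff C1 It); rewrite (diff_withE d); exact: diff_pos d x.
Qed.

End Uniqueness.

Section NegativeSlope.
Variable x0 : R.
Hypothesis ax0 : a x0 < 0.

Lemma slope_min : exists xm, [/\ a xm < 0, forall x, a xm <= a x & inf (range a) = a xm].
Proof.
have [xm Hm] := W_min (datum_W 1) ax0; exists xm; split => //.
  exact: le_lt_trans ax0.
apply/eqP; rewrite eq_le; apply/andP; split.
  apply: ge_inf; last by exists xm.
  by exists (a xm) => _ [x _ <-].
apply: lb_le_inf; first by exists (a xm), xm.
by move=> _ [x _ <-].
Qed.

Local Notation Tstar := (- (r / inf (range a))).

Lemma Tstar_gt0 : 0 < Tstar.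
Proof.
have [xm [am _ ->]] := slope_min.
by rewrite -mulrN -invrN mulr_gt0 ?invr_gt0 ?oppr_gt0.
Qed.

Lemma Tstar_good t : 0 <= t < Tstar -> good t.
Proof.
have [xm [am Hm e]] := slope_min; rewrite e => /andP[t0 tT].
(* The value of the base at the minimum point of [a], positive since [t < Tstar]. *)
exists (1 + t * a xm / r).
  rewrite -mulrN -invrN ltr_pdivlMr ?oppr_gt0// mulrN in tT.
  have : - (t * a xm) / r < 1 by rewrite ltr_pdivrMr ?mul1r.
  by rewrite mulNr; lra.
move=> x; rewrite /affine_base /unit_fun rateM lerD2l; apply: ler_wpM2r; first by rewrite invr_ge0 ltW.
exact: (ler_wpM2l t0).
Qed.

Lemma Tstar_exists T : (0 < T)%E -> (geodesic_exists r id u0 T <-> (T <= Tstar%:E)%E).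
Proof.
move=> T0; split=> [[gamma [v gf]]|TT].
  rewrite leNgt; apply/negP => TT.
  (* Time intervals are half-open: [Tstar] itself is a time of the geodesic exactly when
     [Tstar < T]. *)
  have IT : time_interval T Tstar by split => //; exact: ltW Tstar_gt0.
  have [xm [am Hm e]] := slope_min.
  have := geodesic_pos gf xm IT; rewrite e mulNr divfK ?lt_eqF// subrr ltxx.
  by [].
apply: flow_exists => // t [t0 tT]; apply: Tstar_good; rewrite t0 /=.
by rewrite -lte_fin; exact: lt_le_trans TT.
Qed.

End NegativeSlope.

Lemma nonneg_exists : (forall x, 0 <= a x) -> geodesic_exists r id u0 +oo%E.
Proof.
move=> a0; apply: flow_exists => // t [t0 _]; exists 1 => // x.
by rewrite /affine_base /unit_fun rateM lerDl divr_ge0 ?mulr_ge0// ltW.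
Qed.

Lemma exists_nonneg : geodesic_exists r id u0 +oo%E <-> (forall x, 0 <= a x).
Proof.
split; last exact: nonneg_exists.
move=> H x; rewrite leNgt; apply/negP => ax.
by have := (Tstar_exists ax (ltry 0)).1 H; rewrite leye_eq.
Qed.

End FlowTheory.

(** * An explicit initial velocity with negative slope *)

Section LogisticDatum.
Context {R : realType}.
Local Notation mu := (@lebesgue_measure R).
Local Notation Int f := (mu.-integrable setT (EFin \o f)).
Implicit Types (x : R) (k : nat).

(** Decreasing, with derivative a polynomial in itself, so that all derivatives are reached by
    induction. It makes incompleteness rest on an actual datum. *)
Definition logistic x : R := (1 + expR x)^-1.
Definition bump x := logistic x * (1 - logistic x).

Let D0 x : 0 < 1 + expR x. Proof. by rewrite addr_gt0// expR_gt0. Qed.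

Lemma logistic_itv x : 0 < logistic x < 1.
Proof. by rewrite invr_gt0 D0 /= invf_lt1// ltrDl expR_gt0. Qed.

Lemma bump_gt0 x : 0 < bump x.
Proof. by have /andP[? ?] := logistic_itv x; rewrite mulr_gt0// subr_gt0. Qed.

Lemma logistic_derive x : is_derive x (1 : R) logistic (- bump x).
Proof.
have d : is_derive x (1 : R) (fun y : R => 1 + expR y) (expR x).
  rewrite -[X in is_derive _ _ _ X]add0r.
  exact: (is_derive_fD (is_derive_c 1 x) (is_derive_expR x)).
have := @is_derive_fV R (fun y => 1 + expR y) x _ (lt0r_neq0 (D0 x)) d; move/is_derive_eq; apply.
rewrite /bump /logistic; field; exact: lt0r_neq0.
Qed.

Lemma bump_derive x : is_derive x (1 : R) bump (bump x * (2 * logistic x - 1)).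
Proof.
have d := logistic_derive x.
have := is_derive_fM d (is_derive_fB (is_derive_c 1 x) d).
by move/is_derive_eq; apply; ring.
Qed.

Lemma bump_sym x : bump (- x) = bump x.
Proof.
rewrite /bump /logistic expRN; have := expR_gt0 x; set e := expR x => e0.
by field; rewrite !lt0r_neq0// addr_gt0.
Qed.

Lemma logistic_cvgy : logistic x @[x --> +oo] --> 0.
Proof.
apply: (squeeze_cvgr _ (cvg_cst 0) (@cvgr_expR R)); apply: nearW => x.
have /andP[/ltW -> _] := logistic_itv x.
rewrite expRN /logistic lef_pV2 ?posrE ?expR_gt0 ?D0//.
by rewrite lerDr ler01.
Qed.

Lemma logisticN x : logistic (- x) = 1 - logistic x.
Proof.
rewrite /logistic expRN; have := expR_gt0 x; set e := expR x => e0.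
by field; rewrite !lt0r_neq0// addr_gt0.
Qed.

(** Evenness reduces to the half-line from 0, where the primitive [- logistic] has a finite
    limit. *)
Lemma bump_Int : Int bump.
Proof.
have cb : continuous bump by move=> x; exact: (is_derive_cont (bump_derive x)).
have cl : continuous logistic by move=> x; exact: (is_derive_cont (logistic_derive x)).
apply/integrableP; split.
  by apply/measurable_EFinP; exact: continuous_measurable_fun.
under eq_integral do rewrite abse_EFin (ger0_norm (ltW (bump_gt0 _))).
rewrite ge0_symfun_integralT//; last 2 first.
- by move=> x; exact: ltW (bump_gt0 x).
- by move=> x; rewrite /= bump_sym.
rewrite -set_itvcy (@ge0_continuous_FTC2y R bump (fun x => - logistic x) 0 0).
- by rewrite -EFinB -EFinM ltry.
- by move=> x _; exact: ltW (bump_gt0 x).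
- exact: continuous_subspaceT.
- by rewrite -[X in _ --> X]oppr0; exact: (cvgN logistic_cvgy).
- by move=> x _; have := is_derive_fN (logistic_derive x); case.
- by apply: cvgN; apply: cvg_at_right_filter; exact: cl.
- by move=> x _; rewrite (is_derive1E (is_derive_fN (logistic_derive x))) opprK.
Qed.

(** [logistic] is bounded with all its derivatives, and the derivative of [bump] is [bump] times an
    affine function of [logistic]; integrability of [bump] therefore passes to all orders. *)
Lemma bump_W k : W k bump.
Proof.
have cl : continuous logistic by move=> x; exact: (is_derive_cont (logistic_derive x)).
have bl : bounded_family [set: unit] (fun _ => logistic).
  split => [_ _|]; first exact: cl.
  exists 1 => _ x _; have /andP[/ltW l0 /ltW l1] := logistic_itv x.
  by rewrite ger0_norm.
have Bl j : B j logistic.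
  elim: j => [|j IH]; first by split.
  split=> //; exists (fun _ x => - bump x); split => [_ x _|]; first exact: logistic_derive.
  have -> : (fun (_ : unit) x => - bump x) = (fun _ x => logistic x * (logistic x + (- 1))).
    by apply/funext => _; apply/funext => x; rewrite /bump; ring.
  exact: (BkM IH (BkD IH (Bk_const _ _ _))).
elim: k => [|k IH].
  split => //; split => [_ _ x|]; first exact: (is_derive_cont (bump_derive x)).
  by exists (fun x => `|bump x|); split => //; exact: (Int_norm bump_Int).
apply: (WSI bump_derive bump_Int).
exact: (WkM IH (BkD (BkZ 2 (Bl k)) (Bk_const _ k (-1)))).
Qed.

(** Shifted by 1 so as to vanish at [-oo]. *)
Definition steep x := logistic x - 1.

Lemma steep_lie : lie_with steep (fun x => - bump x).
Proof.
split.
- move=> x; rewrite -[X in is_derive _ _ _ X]subr0.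
  exact: (is_derive_fB (logistic_derive x) (is_derive_c 1 x)).
- move=> k; have -> : (fun x => - bump x) = (fun x => -1 * bump x).
    by apply/funext => x; rewrite mulN1r.
  exact: (WkZ (-1) (bump_W k)).
- have L : - logistic x @[x --> +oo] --> (0 : R).
    by rewrite -[X in _ --> X]oppr0; exact: (cvgN logistic_cvgy).
  apply/cvgNy_compNP.
  have -> : steep \o -%R = (fun x => - logistic x).
    by apply/funext => x; rewrite /steep /= logisticN addrAC subrr add0r.
  exact: L.
Qed.

End LogisticDatum.

(** * Geodesic incompleteness *)

Section Incompleteness.
Context {R : realType}.
Variable r : R.
Hypothesis r1 : 1 < r.

Lemma Diff_id (u0 : R -> R) : lie_algebra u0 -> Diff (@id R).
Proof.
move=> lu0; rewrite -(path0 r lu0).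
have good0 : affine_good unit_fun (rate r u0) 0.
  by exists 1 => // x; rewrite /affine_base mul0r addr0.
exact: (diff_with_Diff (aff_diff r (unit_W lu0) (rate_W r lu0) good0)).
Qed.

Lemma tangent_id (u0 : R -> R) : lie_algebra u0 -> tangent id u0.
Proof. by move=> lu0; exists u0. Qed.

Lemma not_geodesically_complete : ~ geodesically_complete r.
Proof.
move=> H; have ls := lie_with_algebra (@steep_lie R).
have /(exists_nonneg r1 ls) /(_ 0) := H _ _ (Diff_id ls) (tangent_id ls).
by rewrite (lie_withE steep_lie) oppr_ge0 leNgt bump_gt0.
Qed.

End Incompleteness.

(** * The flow at the critical time, and blow-up of the Eulerian velocity *)

Section CriticalTime.
Context {R : realType}.
Local Notation mu := (@lebesgue_measure R).
Local Notation Int f := (mu.-integrable setT (EFin \o f)).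
Implicit Types (y z t s x M : R).

Lemma norm_pow_lip (r M y z : R) : 1 < r -> `|y| <= M -> `|z| <= M ->
  `| `|y| `^ r - `|z| `^ r| <= r * M `^ (r - 1) * `|y - z|.
Proof.
move=> r1 yM zM; have r0 : 0 < r by exact: lt_trans r1.
have [c tcs e] := @MVT_mean _ (fun y => `|y| `^ r) (fun y => r * spow r y) z y (fun c _ => is_derive_norm_pow c r1).
rewrite e normrM ler_wpM2r// normrM (gtr0_norm r0) ler_wpM2l ?(ltW r0)// norm_spow//.
have cM : `|c| <= M.
  move: yM zM; rewrite !ler_norml => /andP[? ?] /andP[? ?].
  by case: tcs => /andP[? ?]; apply/andP; split; lra.
apply: ge0_ler_powR => //; first by rewrite subr_ge0 ltW.
by rewrite nnegrE (le_trans _ cM).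
Qed.

Variables (r : R) (u0 : R -> R).
Hypotheses (r1 : 1 < r) (lu0 : lie_algebra u0).
Let r0 : 0 < r. Proof. exact: lt_trans r1. Qed.

Local Notation a := (derive1 u0).
Local Notation good := (affine_good unit_fun (rate r u0)).
Local Notation path := (affine_path r unit_fun (rate r u0)).
Local Notation slope := (path_slope r unit_fun (rate r u0)).
Local Notation vel := (velocity r unit_fun (rate r u0)).
Local Notation vslope := (velocity_slope r unit_fun (rate r u0)).
Local Notation h := (affine_base unit_fun (rate r u0)).
Let wp := unit_W lu0.
Let wn := rate_W r lu0.

(** At [Tstar] the base has a zero and the estimates with a gap fail; but [|y|^r] is Lipschitz on
    bounded sets because [1 < r], and this bounds the slope by a multiple of [|h t x - 1|]. *)
Lemma slope_Int t : (forall x, 0 <= h t x) -> continuous (slope t) /\ Int (slope t).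
Proof.
move=> h0; have wb := base_W wp wn t.
have ch : continuous (h t).
  move=> x; have -> : h t = (fun x => (h t x - 1) + 1) by apply/funext => y; rewrite subrK.
  by apply: cvgD; [exact: (W_cont (wb 0%N))|exact: cvg_cst].
have e : slope t = (fun x => `|h t x| `^ r - 1).
  by apply/funext => x; rewrite /path_slope ger0_norm.
have c : continuous (slope t).
  by rewrite e => x; apply: cvgB; [exact: (continuous_norm_pow r0 ch)|exact: cvg_cst].
split=> //; have [M M0 HM] := W_int_abs (wb 1%N).
apply: (@Int_le _ _ (fun x => r * (M + 1) `^ (r - 1) * `|h t x - 1|)) => //; last first.
  exact: (IntZ _ (Int_norm (W_Int (wb 0%N)))).
move=> x; rewrite e; have := @norm_pow_lip r (M + 1) (h t x) 1 r1.
rewrite normr1 powR1; apply; last by rewrite lerDr ltW.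
by rewrite -(subrK 1 (h t x)) (le_trans (ler_normD _ _))// normr1 lerD2r.
Qed.

Lemma path_Dx t x : (forall x, 0 <= h t x) -> is_derive x (1 : R) (path t) (h t x `^ r).
Proof.
move=> h0; have [c i] := slope_Int h0.
have -> : h t x `^ r = 1 + slope t x by rewrite /path_slope addrC subrK.
exact: (is_derive_fD (is_derive_idR x) (is_derive_prim x c i)).
Qed.

Lemma baseE t x : h t x = 1 + t * a x / r.
Proof. by rewrite /affine_base rateM. Qed.

Lemma flow_Dt t x : good t -> derive1 ((flow r u0) ^~ x) t = vel t x.
Proof. by move=> gt; rewrite flowE; apply: is_derive1E; exact: (aff_Dt r wp wn x gt). Qed.

Lemma eulerianE t : good t -> eulerian (flow r u0) t = vel t \o inverse (path t).
Proof. by move=> gt; apply/funext => x /=; rewrite /eulerian /= /Dt (flow_Dt _ gt) flowE. Qed.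

Lemma slope1E t x : 1 + slope t x = h t x `^ r.
Proof. by rewrite /path_slope addrC subrK. Qed.

Lemma vslopeE t x : vslope t x = a x * h t x `^ (r - 1).
Proof. by rewrite /velocity_slope /rate mulrA mulfV ?lt0r_neq0// mul1r. Qed.

Lemma eulerian_lie_with t : good t ->
  lie_with (eulerian (flow r u0) t) (fun x => a (inverse (path t) x) / h t (inverse (path t) x)).
Proof.
move=> gt; rewrite eulerianE//.
have := W_comp_inv_lie (aff_diff r wp wn gt) (affv_lie r wp wn gt).
congr lie_with; apply/funext => x; set y := inverse _ x.
have h0 : 0 < h t y by exact: good_gt0.
rewrite slope1E vslopeE powRB; last by rewrite (gt_eqF h0) implybT.
by rewrite powRr1 ?(ltW h0)// mulrA mulrAC mulfK// gt_eqF// powR_gt0.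
Qed.

Section Negative.
Variable x0 : R.
Hypothesis ax0 : a x0 < 0.
Local Notation Tstar := (- (r / inf (range a))).

Lemma Tstar_base : exists xm, [/\ a xm < 0, h Tstar xm = 0, forall x, 0 <= h Tstar x
  & forall t, h t xm = 1 - t / Tstar].
Proof.
have [xm [am Hm e]] := slope_min lu0 ax0; exists xm; rewrite e.
have h0 : h (- (r / a xm)) xm = 0.
  by rewrite baseE mulNr divfK ?lt_eqF// mulNr mulfV ?lt0r_neq0// subrr.
split => //.
  move=> x; rewrite -h0 !baseE lerD2l ler_wpM2r ?invr_ge0 ?(ltW r0)// ler_wpM2l//.
  by rewrite -mulrN -invrN mulr_ge0 ?(ltW r0)// invr_ge0 oppr_ge0 ltW.
move=> t; rewrite baseE invrN invf_div mulrN opprK mulrA //.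
Qed.

Lemma Tstar_flow : (forall x, derivable (flow r u0 Tstar) x 1) /\
  ((exists x, Dx (flow r u0) Tstar x = 0) /\ (forall x, 0 <= Dx (flow r u0) Tstar x)).
Proof.
have [xm [am h0 hT _]] := Tstar_base.
have d x := path_Dx x hT.
rewrite /Dx flowE; split; first by move=> x; case: (d x).
split=> [|x]; last by rewrite (is_derive1E (d x)) powR_ge0.
by exists xm; rewrite (is_derive1E (d xm)) h0 powR0// lt0r_neq0.
Qed.

Lemma eulerian_blowup : blows_up_at Tstar (eulerian (flow r u0)).
Proof.
have T0 := Tstar_gt0 r1 lu0 ax0.
have [xm [am h0 hT he]] := Tstar_base.
apply/cvgeyPge => A; near=> t.
have t0 : 0 < t.
  by near: t; exact: nbhs_left_gt.
have tT : t < Tstar by near: t; exact: nbhs_left_lt.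
have gt : good t by apply: (Tstar_good r1 lu0 ax0); rewrite (ltW t0).
pose xt := path t xm.
have K := inverseK (aff_diff r wp wn gt).
have e : Dx (eulerian (flow r u0)) t xt = a xm / h t xm.
  by rewrite /Dx (lie_withE (eulerian_lie_with gt)) /xt K.
have ht : 0 < h t xm by exact: good_gt0.
apply: (@le_trans _ _ (`|Dx (eulerian (flow r u0)) t xt|%:E)); last first.
  by apply: ereal_sup_ubound; exists xt.
rewrite lee_fin e normrM normfV (gtr0_norm ht) ler_pdivlMr// he.
have A1 : 0 < `|A| + 1 by rewrite ltr_wpDl.
(* Solves [1 - t / Tstar < |a xm| / (|A| + 1)] for [t]; past this time [|a xm / h t xm|] exceeds
   [A]. The added 1 covers [A = 0]. *)
have h2 : Tstar * (1 - `|a xm| / (`|A| + 1)) < t.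
  near: t; apply: nbhs_left_gt.
  rewrite gtr_pMr// gtrBl divr_gt0// normr_gt0 lt_eqF//.
have h3 : 1 - t / Tstar < `|a xm| / (`|A| + 1).
  by rewrite mulrC -ltr_pdivlMr// in h2; lra.
have h4 : 0 < 1 - t / Tstar by rewrite -he.
apply: (@le_trans _ _ ((`|A| + 1) * (1 - t / Tstar))).
  by rewrite ler_wpM2r ?(ltW h4)// (le_trans (ler_norm _))// lerDl.
by rewrite mulrC -ler_pdivlMr// ltW.
Unshelve. all: by end_near. Qed.

End Negative.

End CriticalTime.

(** * A chain rule for functions of two variables *)

Section ChainRule.
Context {R : realType}.
Implicit Types (J : set R) (y xi : R -> R) (G Gy : R -> R -> R).

Lemma between_dist (c z z' : R) : z <= c <= z' \/ z' <= c <= z -> `|c - z| <= `|z' - z|.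
Proof.
case=> /andP[? ?]; first by rewrite !ger0_norm; lra.
by rewrite !ler0_norm; lra.
Qed.

Lemma shift_eq (p q p' d x x' : R) : p - q = d -> p = x' -> p' = x -> (x' - x) - (q - p') = d.
Proof. by move=> <- -> ->; ring. Qed.

Lemma lip_sum (p q c d w : R) : 0 <= p -> 0 <= q -> w <= q * d -> d <= c -> 0 <= c ->
  p + w <= (c + 1) * (p + q).
Proof.
move=> p0 q0 wq dc c0; have := ler_wpM2l q0 dc; have := mulr_ge0 c0 p0.
have -> : (c + 1) * (p + q) = c * p + p + q * c + q by ring.
lra.
Qed.

Lemma sub_self_eq (x w d : R) : (x - x) - w = d -> - w = d.
Proof. by rewrite subrr sub0r. Qed.

Lemma self_lip (x l c d : R) : l <= c * (`|x - x| + d) -> l <= d * c.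
Proof. by rewrite subrr normr0 add0r mulrC. Qed.

Lemma slope_cancel (p q d c l l' : R) : d != 0 -> c != 0 -> - (p - q) = c * (l' - l) ->
  - ((p - q) / d) * c^-1 = (l' - l) / d.
Proof. by move=> d0 c0 e; rewrite -mulNr e; field; rewrite d0 c0. Qed.

(** The increment in the second argument is a mean value at some [xi s] between [y t] and [y s];
    continuity of [Gy] along such choices replaces joint differentiability of [G]. *)
Lemma chain_rule2 J G Gy y (t g1 y1 : R) : open J -> J t ->
  (forall s z, J s -> is_derive z (1 : R) (G s) (Gy s z)) ->
  is_derive t (1 : R) (fun s => G s (y t)) g1 -> is_derive t (1 : R) y y1 ->
  (forall xi, xi s @[s --> t] --> y t -> Gy s (xi s) @[s --> t] --> Gy t (y t)) ->
  is_derive t (1 : R) (fun s => G s (y s)) (g1 + Gy t (y t) * y1).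
Proof.
move=> oJ Jt dG d1 dy cGy.
have H s : exists c, `|c - y t| <= `|y s - y t| /\
    (J s -> G s (y s) - G s (y t) = Gy s c * (y s - y t)).
  have [Js|nJ] := pselect (J s); last first.
    by exists (y t); split; [rewrite subrr normr0|move=> /nJ].
  have [c tcs e] := @MVT_mean _ (G s) (Gy s) (y t) (y s) (fun c _ => dG s c Js).
  by exists c; split => //; exact: between_dist.
have [xi Hxi] := choice H.
have cxi : xi s @[s --> t] --> y t.
  apply/subr_cvg0; apply: norm_cvg0.
  have c0 : `|y s - y t| @[s --> t] --> (0 : R).
    rewrite -(normr0 R) -(subrr (y t)); apply: cvg_norm.
    by apply: cvgB; [exact: (is_derive_cont dy)|exact: cvg_cst].
  apply: (squeeze_cvgr _ (cvg_cst _) c0); apply: nearW => s.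
  by rewrite normr_ge0 /=; case: (Hxi s).
apply/is_derive_slope.
have L1 : (G s (y t) - G t (y t)) / (s - t) @[s --> t^'] --> g1 by exact/is_derive_slope.
have L2 : (y s - y t) / (s - t) @[s --> t^'] --> y1 by exact/is_derive_slope.
have L3 : Gy s (xi s) @[s --> t^'] --> Gy t (y t).
  by apply: cvg_within_filter; exact: cGy.
have L : (G s (y t) - G t (y t)) / (s - t) + Gy s (xi s) * ((y s - y t) / (s - t))
    @[s --> t^'] --> g1 + Gy t (y t) * y1 by exact: (cvgD L1 (cvgM L3 L2)).
apply: (cvg_trans _ L); apply: near_eq_cvg; near=> s.
have Js : J s by near: s; apply: (cvg_within (F := nbhs t)); exact: open_nbhs_nbhs.
have [_ /(_ Js) e] := Hxi s.
have e2 : G s (y s) = Gy s (xi s) * (y s - y t) + G s (y t) by rewrite -e subrK.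
by rewrite e2; ring.
Unshelve. all: by end_near. Qed.

End ChainRule.

(** * The inverse flow and its time derivative *)

Section EulerianDerivatives.
Context {R : realType}.
Implicit Types (y z t s x : R).
Variables (r : R) (u0 : R -> R).
Hypotheses (r1 : 1 < r) (lu0 : lie_algebra u0).
Let r0 : 0 < r. Proof. exact: lt_trans r1. Qed.

Local Notation good := (affine_good unit_fun (rate r u0)).
Local Notation path := (affine_path r unit_fun (rate r u0)).
Local Notation slope := (path_slope r unit_fun (rate r u0)).
Local Notation vel := (velocity r unit_fun (rate r u0)).
Local Notation h := (affine_base unit_fun (rate r u0)).
Let wp := unit_W lu0.
Let wn := rate_W r lu0.

Definition label t x := inverse (path t) x.

Lemma good_diff t : good t -> diff_with (path t) (slope t).
Proof. by move=> gt; exact: aff_diff. Qed.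

Lemma path_dy t y : good t -> is_derive y (1 : R) (path t) (h t y `^ r).
Proof. by move=> gt; rewrite -slope1E; case: (good_diff gt). Qed.

Lemma path_label t x : good t -> path t (label t x) = x.
Proof. by move=> gt; exact: (inverseVK (good_diff gt)). Qed.

Lemma label_path t y : good t -> label t (path t y) = y.
Proof. by move=> gt; exact: (inverseK (good_diff gt)). Qed.

(** The mean value theorem for [path s] between the two labels: the displacement of the label, times
    a slope of the flow, makes up for the displacement of [x] minus the motion of the flow. Both the
    Lipschitz bound and the time derivative of [label] come from it. *)
Lemma path_label_mean t s x x' : good t -> good s -> exists c,
  `|c - label t x| <= `|label s x' - label t x| /\
  (x' - x) - (path s (label t x) - path t (label t x)) = h s c `^ r * (label s x' - label t x).
Proof.
move=> gt gs; have [c tcs e] := @MVT_mean _ (path s) (fun z => h s z `^ r)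
  (label t x) (label s x') (fun c _ => path_dy c gs).
exists c; split; first exact: between_dist.
exact: (shift_eq e (path_label x' gs) (path_label x gt)).
Qed.

Lemma label_lipschitz t : good t -> exists2 J, [/\ open J, J t & forall s, J s -> good s] &
  exists C, forall s x x', J s -> `|label s x' - label t x| <= C * (`|x' - x| + `|s - t|).
Proof.
move=> gt.
have [J1 [oJ1 Jt1 _] [eps e0 [He _]]] := good_near wn gt.
have [J2 [oJ2 Jt2 gJ2] [C HC]] := good_lipschitz r wp wn gt.
exists (J1 `&` J2); first by split; [exact: openI|by []|move=> s [_ /gJ2]].
exists ((eps `^ r)^-1 * (`|C| + 1)) => s x x' [Js1 Js2].
have gs := gJ2 s Js2.
have [c [_ e]] := path_label_mean x x' gt gs.
have P0 : 0 < eps `^ r by exact: powR_gt0.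
have P1 : eps `^ r <= h s c `^ r.
  have hc := He s c Js1.
  by apply: ge0_ler_powR => //; rewrite ?nnegrE ?(ltW r0) ?(ltW e0)// (le_trans (ltW e0)).
rewrite -mulrA ler_pdivlMl//.
apply: (@le_trans _ _ (h s c `^ r * `|label s x' - label t x|)); first by rewrite ler_wpM2r.
rewrite -(ger0_norm (powR_ge0 (h s c) r)) -normrM -e (le_trans (ler_normB _ _))//.
have [hp _ _] := HC s (label t x) Js2.
exact: (lip_sum (normr_ge0 _) (normr_ge0 _) hp (ler_norm _) (normr_ge0 _)).
Qed.

Lemma base_cvg {S : Type} t y (F : set_system S) (T xi : S -> R) : Filter F ->
  T s @[s --> F] --> t -> xi s @[s --> F] --> y -> h (T s) (xi s) @[s --> F] --> h t y.
Proof.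
move=> FF Tt xiy; rewrite /affine_base /unit_fun; apply: cvgD; first exact: cvg_cst.
apply: cvgM => //.
by apply: (@cvg_comp _ _ _ xi (rate r u0) F (nbhs y) _ xiy); exact: (W_cont (wn 0%N)).
Qed.

Lemma basepow_cvg {S : Type} t y p (F : set_system S) (T xi : S -> R) : Filter F -> good t ->
  T s @[s --> F] --> t -> xi s @[s --> F] --> y -> h (T s) (xi s) `^ p @[s --> F] --> h t y `^ p.
Proof.
move=> FF gt Tt xiy; have c := @powR_cont R p _ (good_gt0 gt y).
exact: (cvg_comp _ _ (base_cvg FF Tt xiy) c).
Qed.

(** Implicit differentiation of [path t (label t x) = x] on difference quotients: [path_label_mean]
    provides the denominator at an intermediate point [xi s], and the Lipschitz bound sends [xi s]
    to the label. *)
Lemma label_Dt t x : good t ->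
  is_derive t (1 : R) (label ^~ x) (- vel t (label t x) / h t (label t x) `^ r).
Proof.
move=> gt; have [J [oJ Jt gJ] [C HC]] := label_lipschitz gt.
have H s : exists c, J s -> `|c - label t x| <= `|label s x - label t x| /\
    - (path s (label t x) - path t (label t x)) = h s c `^ r * (label s x - label t x).
  have [Js|nJ] := pselect (J s); last by exists 0.
  have [c [c1 c2]] := path_label_mean x x gt (gJ s Js).
  exists c => _; split; [exact: c1|exact: (sub_self_eq c2)].
have [xi Hxi] := choice H.
have cxi : xi s @[s --> t^'] --> label t x.
  apply/subr_cvg0; apply: norm_cvg0.
  have c0 : `|s - t| * C @[s --> t^'] --> (0 : R).
    by apply: cvg_abs_id; exact: cvg_within.
  apply: (squeeze_cvgr _ (cvg_cst _) c0); near=> s.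
  have Js : J s by near: s; apply: (cvg_within (F := nbhs t)); exact: open_nbhs_nbhs.
  have [h1 _] := Hxi s Js; rewrite normr_ge0 /=; apply: (le_trans h1).
  exact: (self_lip (HC s x x Js)).
apply/is_derive_slope.
have L1 : (path s (label t x) - path t (label t x)) / (s - t) @[s --> t^'] --> vel t (label t x).
  by apply/is_derive_slope; exact: (aff_Dt r wp wn (label t x) gt).
have L2 : h s (xi s) `^ r @[s --> t^'] --> h t (label t x) `^ r.
  by apply: (@basepow_cvg _ t (label t x) r t^' id xi) => //; exact: cvg_within.
have p0 : h t (label t x) `^ r != 0 by rewrite gt_eqF// powR_gt0// good_gt0.
have L : - ((path s (label t x) - path t (label t x)) / (s - t)) * (h s (xi s) `^ r)^-1
    @[s --> t^'] --> - vel t (label t x) / h t (label t x) `^ r.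
  exact: (cvgM (cvgN L1) (cvgV p0 L2)).
apply: (cvg_trans _ L); apply: near_eq_cvg; near=> s.
have Js : J s by near: s; apply: (cvg_within (F := nbhs t)); exact: open_nbhs_nbhs.
have st : s - t != 0 by rewrite subr_eq0; near: s; exact: withinT.
have [_ e] := Hxi s Js.
have hs0 : h s (xi s) `^ r != 0 by exact: lt0r_neq0 (powR_gt0 _ (good_gt0 (gJ s Js) _)).
exact: (slope_cancel st hs0 e).
Unshelve. all: by end_near. Qed.

End EulerianDerivatives.

(** * The Proudman-Johnson equation in Lagrangian variables *)

Section EulerianEquation.
Context {R : realType}.
Implicit Types (y z t s x : R) (g : R -> R).
Variables (r : R) (u0 : R -> R).
Hypotheses (r1 : 1 < r) (lu0 : lie_algebra u0).
Let r0 : 0 < r. Proof. exact: lt_trans r1. Qed.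

Local Notation a := (derive1 u0).
Local Notation a1 := (derive1 (derive1 u0)).
Local Notation a2 := (derive1 (derive1 (derive1 u0))).
Local Notation good := (affine_good unit_fun (rate r u0)).
Local Notation vel := (velocity r unit_fun (rate r u0)).
Local Notation vslope := (velocity_slope r unit_fun (rate r u0)).
Local Notation acc t := (prim (accel_slope r unit_fun (rate r u0) t)).
Local Notation h := (affine_base unit_fun (rate r u0)).
Local Notation label := (label r u0).
Local Notation u := (eulerian (flow r u0)).
Let wp := unit_W lu0.
Let wn := rate_W r lu0.

Lemma pj_sum (p b c d e q' b' c' d' e' l : R) : p = q' -> b = b' -> c = c' -> d = d' -> e = e' ->
  q' + l * b' * c' + d' * e' = 0 -> p + l * b * c + d * e = 0.
Proof. by move=> -> -> -> -> ->. Qed.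

Lemma datum1 y : is_derive y (1 : R) a (a1 y).
Proof. by have [f df _] := WS (datum_W lu0 1); rewrite (is_derive1E (df y)). Qed.

Lemma datum1_W k : W k a1.
Proof. by have [f df wf] := WS (datum_W lu0 k.+1); rewrite (is_derive_fun df). Qed.

Lemma datum2 y : is_derive y (1 : R) a1 (a2 y).
Proof. by have [f df _] := WS (datum1_W 1); rewrite (is_derive1E (df y)). Qed.

(* [.._lag t y] is the value at x = phi(t, y): ux_lag = u_x o phi, and so on. *)
Definition ux_lag t y := a y / h t y.
Definition uxx_lag t y := a1 y / (h t y ^+ 2 * h t y `^ r).
Definition utx_lag t y := - (r^-1 * ux_lag t y ^+ 2) - vel t y * uxx_lag t y.
Definition ut_lag t y := acc t y - vel t y * ux_lag t y.

Section AtGoodTime.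
Variable t : R.
Hypothesis gt : good t.

Lemma base_neq0 y : h t y != 0. Proof. by rewrite gt_eqF// good_gt0. Qed.

Lemma basepow_neq0 y p : h t y `^ p != 0. Proof. by rewrite gt_eqF// powR_gt0// good_gt0. Qed.

Lemma base_dy y : is_derive y (1 : R) (h t) (t * a1 y / r).
Proof.
have -> : h t = (fun y => 1 + t / r * a y).
  by apply/funext => z; rewrite baseE mulrAC.
have := is_derive_fD (is_derive_c 1 y) (is_derive_fM (is_derive_c (t / r) y) (datum1 y)).
by move/is_derive_eq; apply; rewrite mul0r !add0r mulrAC.
Qed.

Lemma ux_lag_dy y : is_derive y (1 : R) (ux_lag t) (a1 y / h t y ^+ 2).
Proof.
have := is_derive_fM (datum1 y) (is_derive_fV (base_neq0 y) (base_dy y)).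
move/is_derive_eq; apply.
have b0 := base_neq0 y; move: b0; rewrite baseE; move: (a y) (a1 y) => A A1 b0.
by field; rewrite lt0r_neq0//=; move: b0; rewrite -(mulfV (lt0r_neq0 r0)) -mulrDl mulf_eq0 negb_or => /andP[].
Qed.

Lemma uxx_lag_dy y : exists d, is_derive y (1 : R) (uxx_lag t) d.
Proof.
have dP := is_derive_pow r (good_gt0 gt y) (base_dy y).
have dh := base_dy y.
have d2 := is_derive_fM (is_derive_fM dh dh) dP.
have n0 : (fun z => h t z * h t z * h t z `^ r) y != 0.
  by rewrite !mulf_neq0// ?base_neq0// basepow_neq0.
have := is_derive_fM (datum2 y) (@is_derive_fV R (fun z => h t z * h t z * h t z `^ r) y _ n0 d2).
have -> : (fun z => a1 z / (h t z * h t z * h t z `^ r)) = uxx_lag t.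
  by apply/funext => z; rewrite /uxx_lag expr2.
by move=> D; eexists; exact: D.
Qed.

Lemma vel_dy y : is_derive y (1 : R) (vel t) (vslope t y).
Proof. by case: (affv_lie r wp wn gt). Qed.

Lemma acc_dy y : is_derive y (1 : R) (acc t) (accel_slope r unit_fun (rate r u0) t y).
Proof.
apply: is_derive_prim; first exact: (W_cont (affa1_W r wp wn gt 0)).
exact: (W_Int (affa1_W r wp wn gt 0)).
Qed.

Lemma vslope_ux y : vslope t y = ux_lag t y * h t y `^ r.
Proof.
rewrite (vslopeE u0 r1) /ux_lag powRB; last by rewrite (negbTE (base_neq0 y)) implybT.
by rewrite powRr1 ?ltW ?good_gt0// mulrA mulrAC.
Qed.

Lemma accel_ux y : accel_slope r unit_fun (rate r u0) t y = (1 - r^-1) * (ux_lag t y ^+ 2 * h t y `^ r).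
Proof.
rewrite /accel_slope /rate /ux_lag powRB; last by rewrite (negbTE (base_neq0 y)) implybT.
rewrite powRB; last by rewrite (negbTE (base_neq0 y)) implybT.
rewrite powRr1 ?ltW ?good_gt0//; move: (base_neq0 y) (a y) (h t y `^ r) => b0 A P.
by move: (h t y) b0 => H b0; field; rewrite b0 lt0r_neq0.
Qed.

Lemma ut_lag_dy y : is_derive y (1 : R) (ut_lag t) (utx_lag t y * h t y `^ r).
Proof.
have := is_derive_fB (acc_dy y) (is_derive_fM (vel_dy y) (ux_lag_dy y)).
move/is_derive_eq; apply; rewrite accel_ux vslope_ux /utx_lag /uxx_lag.
move: (base_neq0 y) (basepow_neq0 y r) (ux_lag t y) (vel t y) (a1 y).
move: (h t y) (h t y `^ r) => H P H0 P0 X V A1; field.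
by rewrite H0 P0 lt0r_neq0.
Qed.

Lemma label_dx x : is_derive x (1 : R) (label t) (h t (label t x) `^ r)^-1.
Proof. by rewrite -slope1E; exact: (inverse_derive (good_diff lu0 gt) x). Qed.

Lemma lag_dx g d x : is_derive (label t x) (1 : R) g d ->
  is_derive x (1 : R) (fun z => g (label t z)) (d / h t (label t x) `^ r).
Proof. by move=> dg; apply: (is_derive_comp dg); exact: label_dx. Qed.

Lemma u_lag : u t = (fun x => vel t (label t x)).
Proof. by rewrite (eulerianE lu0 gt). Qed.

Lemma u_dx x : is_derive x (1 : R) (u t) (ux_lag t (label t x)).
Proof. by case: (eulerian_lie_with r1 lu0 gt). Qed.

Lemma Dx_u : Dx u t = (fun x => ux_lag t (label t x)).
Proof. exact: (is_derive_fun u_dx). Qed.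

Lemma ux_dx x : is_derive x (1 : R) (Dx u t) (uxx_lag t (label t x)).
Proof.
rewrite Dx_u; have := lag_dx (ux_lag_dy (label t x)).
move/is_derive_eq; apply; rewrite /uxx_lag.
move: (base_neq0 (label t x)) (basepow_neq0 (label t x) r).
move: (a1 _) (h t _) (h t _ `^ r) => A1 H P H0 P0; field.
by rewrite H0 P0.
Qed.

Lemma Dxx_u : Dx (Dx u) t = (fun x => uxx_lag t (label t x)).
Proof. exact: (is_derive_fun ux_dx). Qed.

Lemma u_dt x : is_derive t (1 : R) (u ^~ x) (ut_lag t (label t x)).
Proof.
have [J [oJ Jt gJ] _] := label_lipschitz r1 lu0 gt.
apply: (@is_derive_ext_open _ J (fun s => vel s (label s x))) => //.
  by move=> s Js; rewrite (eulerianE lu0 (gJ s Js)).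
have c (xi : R -> R) : xi s @[s --> t] --> label t x -> vslope s (xi s) @[s --> t] --> vslope t (label t x).
  move=> xic; under eq_fun do rewrite (vslopeE u0 r1).
  rewrite (vslopeE u0 r1); apply: cvgM.
    apply: (@cvg_comp _ _ _ xi a _ (nbhs (label t x)) _ xic).
    exact: (W_cont (datum_W lu0 0)).
  exact: (basepow_cvg lu0 _ gt cvg_id xic).
have dv s z : J s -> is_derive z (1 : R) (vel s) (vslope s z).
  by move=> Js; case: (affv_lie r wp wn (gJ s Js)).
have := chain_rule2 oJ Jt dv (affv_Dt r wp wn (label t x) gt) (label_Dt r1 lu0 x gt) c.
move/is_derive_eq; apply; rewrite vslope_ux /ut_lag.
move: (basepow_neq0 (label t x) r) (ux_lag t _) (vel t _) => P0 X V.
by move: (h t _ `^ r) P0 => P P0; field.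
Qed.

Lemma PJ_at x (lambda : R) : lambda = r^-1 ->
    [/\ derivable (u ^~ x) t 1, derivable (Dt u t) x 1,
        derivable (Dx (Dt u) t) x 1,
        [/\ derivable (u t) x 1, derivable (Dx u t) x 1
          & derivable (Dx (Dx u) t) x 1]
      & Dx (Dx (Dt u)) t x
        + (1 + 2 * lambda) * Dx u t x * Dx (Dx u) t x
        + u t x * Dx (Dx (Dx u)) t x = 0].
Proof.
move=> ->.
have DtE : Dt u t = (fun x => ut_lag t (label t x)).
  by apply/funext => z; exact: (is_derive1E (u_dt z)).
have d1 z : is_derive z (1 : R) (Dt u t) (utx_lag t (label t z)).
  rewrite DtE; have := lag_dx (ut_lag_dy (label t z)).
  by move/is_derive_eq; apply; rewrite mulfK// basepow_neq0.
have DxDtE : Dx (Dt u) t = (fun x => utx_lag t (label t x)) by exact: (is_derive_fun d1).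
have [F3 dF3] := uxx_lag_dy (label t x).
have dux := ux_lag_dy (label t x).
have d2 : is_derive (label t x) (1 : R) (utx_lag t)
   (- (2 * r^-1 * ux_lag t (label t x) * (a1 (label t x) / h t (label t x) ^+ 2)) -
    (vslope t (label t x) * uxx_lag t (label t x) + vel t (label t x) * F3)).
  have := is_derive_fB (is_derive_fN (is_derive_fM (is_derive_c r^-1 (label t x)) (is_derive_fM dux dux)))
    (is_derive_fM (vel_dy (label t x)) dF3).
  have -> : (fun y => - (r^-1 * (ux_lag t y * ux_lag t y)) - vel t y * uxx_lag t y) = utx_lag t.
    by apply/funext => z; rewrite /utx_lag expr2.
  move/is_derive_eq; apply.
  by move: (ux_lag t _) (a1 _ / _) (vslope t _ * _) (vel t _ * _) => X Y Z V; ring.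
have d3 := lag_dx d2; rewrite -DxDtE in d3.
have d4 := lag_dx dF3; rewrite -Dxx_u in d4.
split.
- by case: (u_dt x).
- by case: (d1 x).
- by case: d3.
- by split; [case: (u_dx x)|case: (ux_dx x)|case: d4].
- apply: (pj_sum (is_derive1E d3) (congr1 (fun f => f x) Dx_u) (congr1 (fun f => f x) Dxx_u)
    (congr1 (fun f => f x) u_lag) (is_derive1E d4)).
  rewrite vslope_ux /uxx_lag.
  move: (base_neq0 (label t x)) (basepow_neq0 (label t x) r).
  move: (ux_lag t _) (a1 _) (vel t _) (h t _) (h t _ `^ r) => X A1 V H P H0 P0.
  by field; rewrite H0 P0 lt0r_neq0.
Qed.

End AtGoodTime.

Lemma eulerian_PJ T : (forall t, 0 < t < T -> good t) -> Proudman_Johnson_solution r^-1 T u.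
Proof. by move=> gT t x /gT gt; exact: PJ_at. Qed.

End EulerianEquation.

(** * Measurability, continuity and mixed derivatives in the plane *)

Section Plane.
Context {R : realType}.
Local Notation mu := (@lebesgue_measure R).
Local Notation mu2 := (@lebesgue_measure R \x @lebesgue_measure R)%E.
Implicit Types (f : R * R -> R) (K psi : R -> R -> R) (t x : R).

(** Measurability refers to the product of the two sigma-algebras, so the open set is exhibited as a
    countable union of boxes with rational ends. *)
Lemma open_measurable_plane (U : set (R * R)) : open U -> measurable U.
Proof.
move=> oU.
pose box (p q p' q' : rat) : set (R * R) :=
  `](ratr p : R), (ratr q : R)[ `*` `](ratr p' : R), (ratr q' : R)[.
have -> : U = \bigcup_p \bigcup_q \bigcup_p' \bigcup_q'
    (if `[<box p q p' q' `<=` U>] then box p q p' q' else set0).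
  apply/seteqP; split=> [[t x] Utx|z [p _ [q _ [p' _ [q' _]]]]]; last first.
    by case: ifPn => // /asboolP; exact.
  have /nbhs_ballP[e /= e0 He] : nbhs (t, x) U by exact: open_nbhs_nbhs.
  have rat_lt (y : R) : exists p q : rat, [/\ ratr p < y, y < ratr q &
      forall z, ratr p < z < ratr q -> `|y - z| < e].
    have /rat_in_itvoo[p] : y - e < y by rewrite gtrBl.
    have /rat_in_itvoo[q] : y < y + e by rewrite ltrDl.
    rewrite !in_itv /= => /andP[q1 q2] /andP[p1 p2]; exists p, q; split=> // z /andP[z1 z2].
    by rewrite ltr_norml; apply/andP; split; lra.
  have [p [q [pt tq Ht]]] := rat_lt t; have [p' [q' [px xq Hx]]] := rat_lt x.
  exists p => //; exists q => //; exists p' => //; exists q' => //.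
  case: ifPn => [_|/asboolP[]].
    by split; rewrite /= in_itv /= ?pt ?tq ?px ?xq.
  move=> [s y] [/=]; rewrite !in_itv /= => hs hy; apply: He; split => /=.
    exact: Ht.
  exact: Hx.
do 4! (apply: bigcupT_measurable_rat => ?).
by case: ifPn => _; [exact: measurableX|exact: measurable0].
Qed.

Lemma continuous_measurable_plane f : continuous f -> measurable_fun setT f.
Proof.
move=> cf; apply: (measurability _ (RGenOInfty.measurableE R)).
move=> /= _ [_ [c ->]] <-; rewrite setTI; apply: open_measurable_plane.
by apply: open_comp; [move=> x _; exact: cf|exact: interval_open].
Qed.

Lemma integrable_compact_support f (al be M : R) : continuous f ->
  (forall z, f z != 0 -> al <= z.1 <= be /\ `|z.2| <= M) ->
  mu2.-integrable setT (EFin \o f).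
Proof.
move=> cf sf.
pose D : set (R * R) := `[al, be] `*` `[- M, M].
have mD : measurable D by apply: measurableX; exact: measurable_itv.
have kD : compact D by apply: compact_setX; exact: segment_compact.
have fD z : ~ D z -> f z = 0.
  move=> nD; apply/eqP/negPn/negP => /sf[h1 h2]; apply: nD.
  by split; rewrite /= in_itv //= -ler_norml.
have -> : EFin \o f = (EFin \o f) \_ D.
  apply/funext => z; rewrite /patch; case: ifPn => //.
  by rewrite notin_setE => /fD /= ->.
apply: (iffLR (@integrable_mkcond _ _ _ mu2 D (EFin \o f) mD)); apply: measurable_bounded_integrable => //.
- rewrite [ltLHS](_ : _ = mule (mu `[al, be]) (mu `[- M, M])); last first.
    by apply: product_measure1E; exact: measurable_itv.
  rewrite !lebesgue_measure_itv.
  by case: ifPn => _; case: ifPn => _; rewrite -?EFinB -?EFinM ?mule0 ?mul0e ltry.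
- exact: (measurable_funS measurableT (@subsetT _ _) (continuous_measurable_plane cf)).
have [->|/set0P D0] := eqVneq D set0.
  by exists 0; split; [exact: real0|move=> ? _ ? []].
have cn : continuous (fun z => `|f z|) by move=> z; apply: cvg_norm; exact: cf.
have [c _ Hc] := compact_EVT_max D0 kD (continuous_subspaceT cn).
exists `|f c|; split=> [|y cy z Dz]; first exact: normr_real.
by apply: le_trans (ltW cy); apply: Hc; rewrite inE.
Qed.

(** The open sets [0 < t < T] and the complement of [al <= t <= be] cover all times. Estimates on
    the flow give continuity over the first, and the support of the test function makes [K] zero
    over the second. *)
Lemma continuous_glue K (T al be : R) : 0 < al -> be < T ->
  (forall t x, 0 < t < T -> K z.1 z.2 @[z --> (t, x)] --> K t x) ->
  (forall t x, K t x != 0 -> al <= t <= be) -> continuous (fun z : R * R => K z.1 z.2).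
Proof.
move=> al0 beT cK sK [t x]; have [tT|ntT] := boolP (0 < t < T); first exact: cK.
have K0 s y : ~ (al <= s <= be) -> K s y = 0.
  by move=> n; apply/eqP/negPn/negP => /sK.
have c1 : z.1 @[z --> (t, x)] --> t by exact: cvg_fst.
have [h|h] : t < al \/ be < t.
  by move: ntT; rewrite negb_and -!leNgt => /orP[?|?]; [left|right]; lra.
- rewrite /continuous_at /= [X in _ --> X]K0; last by move=> /andP[? ?]; lra.
  apply: cvg_near_cst; near=> z; rewrite K0// => /andP[h1 _].
  have : z.1 < al by near: z; exact: (c1 _ (lt_nbhsl h)).
  by rewrite ltNge h1.
- rewrite /continuous_at /= [X in _ --> X]K0; last by move=> /andP[? ?]; lra.
  apply: cvg_near_cst; near=> z; rewrite K0// => /andP[_ h1].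
  have : be < z.1 by near: z; exact: (c1 _ (lt_nbhsr h)).
  by rewrite ltNge h1.
Unshelve. all: by end_near. Qed.

Lemma continuous_along K {S : Type} (F : set_system S) (T xi : S -> R) t x : Filter F ->
  continuous (fun z : R * R => K z.1 z.2) ->
  T s @[s --> F] --> t -> xi s @[s --> F] --> x -> K (T s) (xi s) @[s --> F] --> K t x.
Proof.
move=> FF cK Tt xix.
have c : (T s, xi s) @[s --> F] --> ((t, x) : R * R) by exact: (cvg_pair (FF := FF) (G := nbhs t) (H := nbhs x) Tt xix).
exact: (cvg_comp _ _ c (cK (t, x))).
Qed.

Lemma cancel2 (p q s : R) : s != 0 -> p * s * s = q * s * s -> p = q.
Proof. by move=> s0 /(mulIf s0)/(mulIf s0). Qed.

(** The second difference over a square of side [s] is expanded by two mean value theorems, in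
    either order; continuity of both mixed derivatives lets [s] tend to 0. *)
Lemma Schwarz psi t x : Cn2 2 psi -> Dx (Dt psi) t x = Dt (Dx psi) t x.
Proof.
move=> [_ [dt dx [_ [_ dxt _ [cxt _]]] [_ [dtx _ [ctx _] _]]]].
have mean_t s : exists c d, [/\ `|c - t| <= `|s|, `|d - x| <= `|s| &
    psi (t + s) (x + s) - psi (t + s) x - (psi t (x + s) - psi t x) = Dx (Dt psi) c d * s * s].
  have dd c : is_derive c (1 : R) (fun s' => psi s' (x + s) - psi s' x) (Dt psi c (x + s) - Dt psi c x).
    by apply: is_derive_fB; exact: derivable_is_derive.
  have [c tcs ec] := @MVT_mean _ _ _ t (t + s) (fun c _ => dd c).
  have [d xds ed] := @MVT_mean _ (Dt psi c) (Dx (Dt psi) c) x (x + s)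
    (fun d _ => derivable_is_derive (dxt c d)).
  exists c, d; split.
  - by have := between_dist tcs; rewrite addrAC subrr add0r.
  - by have := between_dist xds; rewrite addrAC subrr add0r.
  - by rewrite ec ed; ring.
have mean_x s : exists c d, [/\ `|c - t| <= `|s|, `|d - x| <= `|s| &
    psi (t + s) (x + s) - psi (t + s) x - (psi t (x + s) - psi t x) = Dt (Dx psi) c d * s * s].
  have dd d : is_derive d (1 : R) (fun y => psi (t + s) y - psi t y) (Dx psi (t + s) d - Dx psi t d).
    by apply: is_derive_fB; exact: derivable_is_derive.
  have [d xds ed] := @MVT_mean _ _ _ x (x + s) (fun d _ => dd d).
  have [c tcs ec] := @MVT_mean _ (fun c => Dx psi c d) (fun c => Dt (Dx psi) c d) t (t + s)
    (fun c _ => derivable_is_derive (dtx c d)).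
  exists c, d; split.
  - by have := between_dist tcs; rewrite addrAC subrr add0r.
  - by have := between_dist xds; rewrite addrAC subrr add0r.
  - move: ed ec; rewrite /= => ed ec.
    rewrite -[LHS]/(psi (t + s) (x + s) - psi (t + s) x - (psi t (x + s) - psi t x)).
    have -> : psi (t + s) (x + s) - psi (t + s) x - (psi t (x + s) - psi t x) =
      psi (t + s) (x + s) - psi t (x + s) - (psi (t + s) x - psi t x) by ring.
    by rewrite ed ec; ring.
have [c1 /choice[d1 H1]] := choice mean_t.
have [c2 /choice[d2 H2]] := choice mean_x.
have lim0 (c : R -> R) y : (forall s, `|c s - y| <= `|s|) -> c s @[s --> 0^'] --> y.
  move=> Hc; apply/subr_cvg0; apply: norm_cvg0.
  have n0 : `|s| @[s --> (0 : R)^'] --> (0 : R).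
    by rewrite -[X in _ --> X](normr0 R); apply: cvg_norm; exact: cvg_within.
  by apply: (squeeze_cvgr _ (cvg_cst _) n0); apply: nearW => s; rewrite normr_ge0 Hc.
have L1 : Dx (Dt psi) (c1 s) (d1 s) @[s --> 0^'] --> Dx (Dt psi) t x.
  by apply: continuous_along => //; apply: lim0 => s; case: (H1 s).
have L2 : Dt (Dx psi) (c2 s) (d2 s) @[s --> 0^'] --> Dt (Dx psi) t x.
  by apply: continuous_along => //; apply: lim0 => s; case: (H2 s).
have L3 : Dx (Dt psi) (c1 s) (d1 s) @[s --> 0^'] --> Dt (Dx psi) t x.
  apply: (cvg_trans _ L2); apply: near_eq_cvg; near=> s.
  have s0 : s != 0 by near: s; exact: withinT.
  have [_ _ e1] := H1 s; have [_ _ e2] := H2 s.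
  exact: (cancel2 s0 (etrans (esym e2) e1)).
exact: (cvg_unique (@norm_hausdorff _ _) L1 L3).
Unshelve. all: by end_near. Qed.

End Plane.

(** * Compactly supported integrands and Fubini's theorem *)

Section CompactSupport.
Context {R : realType}.
Local Notation mu := (@lebesgue_measure R).
Local Notation mu2 := (@lebesgue_measure R \x @lebesgue_measure R)%E.
Local Notation Int f := (mu.-integrable setT (EFin \o f)).
Implicit Types (f : R -> R) (K psi : R -> R -> R) (t x : R).

Lemma Int_compact f (M : R) : continuous f -> (forall x, f x != 0 -> `|x| <= M) -> Int f.
Proof.
move=> cf sf.
have -> : EFin \o f = (EFin \o f) \_ `[- M, M].
  apply/funext => x; rewrite /patch; case: ifPn => //.
  rewrite notin_setE /= in_itv /= -ler_norml => /negP xM.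
  by congr EFin; apply/eqP/negPn/negP => /sf; rewrite (negbTE xM).
have mD : measurable (`[- M, M]%classic : set R) by exact: measurable_itv.
apply: (iffLR (@integrable_mkcond _ _ _ mu _ (EFin \o f) mD)).
by apply: continuous_compact_integrable; [exact: segment_compact|exact: continuous_subspaceT].
Qed.

Lemma Rint_derive_compact f f' (M : R) : (forall x, is_derive x (1 : R) f (f' x)) ->
  continuous f' -> (forall x, f x != 0 -> `|x| <= M) -> Int f' /\ \int[mu]_x f' x = 0.
Proof.
move=> df cf' sf.
have f0 x : M < `|x| -> f x = 0.
  by rewrite ltNge => /negP n; apply/eqP/negPn/negP => /sf.
have oM : open [set x : R | M < `|x|].
  by apply: open_comp (@open_gt _ M) => x _; exact: norm_continuous.
have sf' x : f' x != 0 -> `|x| <= M.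
  apply: contraNT; rewrite -ltNge => Mx; apply/eqP.
  apply: (is_derive_uniq (df x)).
  by apply: (is_derive_ext_open oM Mx _ (is_derive_c 0 x)) => y /f0.
split; first exact: Int_compact sf'.
have N0 : M < `|M| + 1 by rewrite ltr_pwDr// ler_norm.
have N1 : 0 < `|M| + 1 by rewrite ltr_wpDl.
have -> : \int[mu]_x f' x = \int[mu]_(x in `[- (`|M| + 1), `|M| + 1]) f' x.
  rewrite [RHS]Rintegral_mkcond; congr (Rintegral _ _ _); apply/funext => x.
  rewrite /patch; case: ifPn => //; rewrite notin_setE /= in_itv /= -ler_norml => /negP xM.
  apply/eqP/negPn/negP => /sf' xM'; apply: (negP xM).
  by rewrite (le_trans xM')// ltW.
rewrite (FTC _ df cf'); last by lra.
by rewrite !f0 ?subrr// ?normrN gtr0_norm.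
Qed.

Lemma fubini_compact K (al be M : R) : continuous (fun z : R * R => K z.1 z.2) ->
  (forall t x, K t x != 0 -> al <= t <= be /\ `|x| <= M) ->
  (\int[mu2]_z (K z.1 z.2)%:E = \int[mu]_t (\int[mu]_x K t x)%:E)%E /\
  (\int[mu2]_z (K z.1 z.2)%:E = \int[mu]_x (\int[mu]_t K t x)%:E)%E.
Proof.
move=> cK sK.
have iK := integrable_compact_support cK (fun z => sK z.1 z.2).
have fK f : Int f -> ((\int[mu]_x f x)%:E = \int[mu]_x (f x)%:E)%E.
  by move=> fi; rewrite fineK//; exact: (integrable_fin_num _ fi).
split.
  rewrite -integral12_prod_meas1//; apply: eq_integral => t _.
  rewrite fK//; apply: (@Int_compact _ M) => [x|x /sK[]//].
  by apply: continuous_along => //; exact: cvg_cst.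
rewrite -integral21_prod_meas1//; apply: eq_integral => x _.
rewrite fK//; apply: (@Int_compact _ (`|al| + `|be|)) => [t|t /sK[/andP[at_ tb] _]].
  by apply: (@continuous_along _ K _ (nbhs t) id (fun=> x) t x) => //; exact: cvg_cst.
rewrite ler_norml; apply/andP; split.
  have := ler_norm (- al); have := normr_ge0 be; rewrite normrN; lra.
have := ler_norm be; have := normr_ge0 al; lra.
Qed.

(** Integrating in space first replaces [F] by [K], whose time integrals vanish; Fubini swaps the
    order in between. Only one-dimensional substitutions, at fixed time, are thus involved. *)
Lemma fubini_transport F K (al be M M' : R) :
  continuous (fun z : R * R => F z.1 z.2) -> continuous (fun z : R * R => K z.1 z.2) ->
  (forall t x, F t x != 0 -> al <= t <= be /\ `|x| <= M) ->
  (forall t x, K t x != 0 -> al <= t <= be /\ `|x| <= M') ->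
  (forall t, \int[mu]_x F t x = \int[mu]_x K t x) ->
  (forall x, \int[mu]_t K t x = 0) ->
  (\int[mu2]_z (F z.1 z.2)%:E = 0)%E.
Proof.
move=> cF cK sF sK eFK K0.
have [-> _] := fubini_compact cF sF.
have [e1 e2] := fubini_compact cK sK.
under eq_integral do rewrite eFK.
rewrite -e1 e2; under eq_integral do rewrite K0.
exact: integral0.
Qed.

Section Supported.
Variables al be M : R.

Definition supported K := forall t x, K t x != 0 -> al <= t <= be /\ `|x| <= M.

Lemma supported_out K t x : supported K -> ~ (al <= t <= be) \/ M < `|x| -> K t x = 0.
Proof.
move=> sK h; apply/eqP/negPn/negP => /sK[h1 h2]; case: h => // .
by rewrite ltNge h2.
Qed.

Lemma supported_outP K : (forall t x, ~ (al <= t <= be) \/ M < `|x| -> K t x = 0) -> supported K.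
Proof.
move=> H t x; have [h1|h1] := pselect (al <= t <= be); last by rewrite H ?eqxx//; left.
have [h2|h2] := ltP M `|x|; first by rewrite H ?eqxx//; right.
by [].
Qed.

Lemma open_time_out : open [set t | ~ (al <= t <= be)].
Proof.
have -> : [set t | ~ (al <= t <= be)] = ~` `[al, be].
  by apply/seteqP; split => t /=; rewrite in_itv.
by rewrite openC; exact: interval_closed.
Qed.

Lemma open_norm_gt : open [set x : R | M < `|x|].
Proof. by apply: open_comp (@open_gt _ M) => x _; exact: norm_continuous. Qed.

Lemma supported_Dt K : supported K -> supported (Dt K).
Proof.
move=> sK; apply: supported_outP => t x [h|h]; apply: is_derive1E.
  apply: (is_derive_ext_open open_time_out h _ (is_derive_c 0 t)) => s hs.
  by rewrite supported_out//; left.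
have -> : (K ^~ x) = (fun=> 0) by apply/funext => s; rewrite supported_out//; right.
exact: is_derive_c.
Qed.

Lemma supported_Dx K : supported K -> supported (Dx K).
Proof.
move=> sK; apply: supported_outP => t x [h|h]; apply: is_derive1E.
  have -> : K t = (fun=> 0) by apply/funext => s; rewrite supported_out//; left.
  exact: is_derive_c.
apply: (is_derive_ext_open open_norm_gt h _ (is_derive_c 0 x)) => s hs.
by rewrite supported_out//; right.
Qed.

Lemma supported_mul L K : supported K -> supported (fun t x => L t x * K t x).
Proof. by move=> sK t x; rewrite mulf_eq0 negb_or => /andP[_ /sK]. Qed.

Lemma supportedD K L : supported K -> supported L -> supported (fun t x => K t x + L t x).
Proof.
move=> sK sL; apply: supported_outP => t x h.
by rewrite (supported_out sK h) (supported_out sL h) addr0.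
Qed.

Lemma supportedB K L : supported K -> supported L -> supported (fun t x => K t x - L t x).
Proof.
move=> sK sL; apply: supported_outP => t x h.
by rewrite (supported_out sK h) (supported_out sL h) subr0.
Qed.

End Supported.

End CompactSupport.

(** * Joint continuity of the flow, its inverse and the Lagrangian derivatives *)

Section WeakEquation.
Context {R : realType}.
Implicit Types (y z t s x : R) (g : R -> R).
Variables (r : R) (u0 : R -> R).
Hypotheses (r1 : 1 < r) (lu0 : lie_algebra u0).
Let r0 : 0 < r. Proof. exact: lt_trans r1. Qed.

Local Notation a := (derive1 u0).
Local Notation good := (affine_good unit_fun (rate r u0)).
Local Notation path := (affine_path r unit_fun (rate r u0)).
Local Notation vel := (velocity r unit_fun (rate r u0)).
Local Notation label := (label r u0).
Local Notation ux_lag := (ux_lag r u0).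
Local Notation uxx_lag := (uxx_lag r u0).
Let wp := unit_W lu0.
Let wn := rate_W r lu0.

Lemma datum_cont y : {for y, continuous a}.
Proof. exact: (W_cont (datum_W lu0 0)). Qed.

Lemma dist_cvg0 {S : Type} (F : set_system S) (FF : Filter F) (f : S -> R) (l : R) :
  f z @[z --> F] --> l -> `|f z - l| @[z --> F] --> (0 : R).
Proof.
move=> fl; rewrite -(normr0 R) -(subrr l); apply: cvg_norm.
by apply: cvgB => //; exact: cvg_cst.
Qed.

(** A Lipschitz bound in time, uniform in space, upgrades continuity of the slice [G t] to joint
    continuity. *)
Lemma joint_cvg {S : Type} (F : set_system S) (FF : Filter F) (G : R -> R -> R) (C : R) (J : set R)
    (T xi : S -> R) t y : open J -> J t -> (forall s x, J s -> `|G s x - G t x| <= `|s - t| * C) ->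
  {for y, continuous (G t)} -> T z @[z --> F] --> t -> xi z @[z --> F] --> y ->
  G (T z) (xi z) @[z --> F] --> G t y.
Proof.
move=> oJ Jt HG cG Tt xiy.
have L1 : G t (xi z) @[z --> F] --> G t y by exact: (cvg_comp _ _ xiy cG).
have L2 : G (T z) (xi z) - G t (xi z) @[z --> F] --> 0.
  apply: norm_cvg0.
  have c0 : `|T z - t| * C @[z --> F] --> (0 : R).
    rewrite -[X in _ --> X](mul0r C).
    by apply: cvgM; [exact: dist_cvg0|exact: cvg_cst].
  apply: (squeeze_cvgr _ (cvg_cst _) c0).
  have : \forall z \near F, J (T z) by apply: Tt; exact: open_nbhs_nbhs.
  by apply: filterS => z Jz; rewrite normr_ge0 /= HG.
have L : G t (xi z) + (G (T z) (xi z) - G t (xi z)) @[z --> F] --> G t y + 0 by exact: cvgD.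
rewrite addr0 in L; apply: cvg_trans L; apply: near_eq_cvg; apply: nearW => z.
by rewrite addrC subrK.
Qed.

Section Limits.
Variables (F : set_system (R * R)) (t y : R) (T xi : R * R -> R).
Hypotheses (FF : Filter F) (gt : good t) (Tt : T z @[z --> F] --> t) (xiy : xi z @[z --> F] --> y).

Lemma cvg_ux : ux_lag (T z) (xi z) @[z --> F] --> ux_lag t y.
Proof.
apply: cvgM; first by apply: (cvg_comp _ _ xiy); exact: datum_cont.
by apply: cvgV; [exact: base_neq0|exact: (base_cvg lu0 FF Tt xiy)].
Qed.

Lemma cvg_uxx : uxx_lag (T z) (xi z) @[z --> F] --> uxx_lag t y.
Proof.
apply: cvgM; first by apply: (cvg_comp _ _ xiy); exact: (W_cont (datum1_W lu0 0)).
apply: cvgV; first by rewrite mulf_neq0 ?expf_neq0 ?base_neq0// basepow_neq0.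
apply: cvgM; last exact: (basepow_cvg lu0 FF gt Tt xiy).
rewrite expr2; under eq_fun do rewrite expr2.
by apply: cvgM; exact: (base_cvg lu0 FF Tt xiy).
Qed.

Lemma cvg_path : path (T z) (xi z) @[z --> F] --> path t y.
Proof.
have [J [oJ Jt _] [C HC]] := good_lipschitz r wp wn gt.
apply: (@joint_cvg _ F FF path C J T xi t y oJ Jt _ _ Tt xiy); first by move=> s x /(HC s x)[].
exact: (is_derive_cont (path_dy lu0 y gt)).
Qed.

Lemma cvg_vel : vel (T z) (xi z) @[z --> F] --> vel t y.
Proof.
have [J [oJ Jt _] [C HC]] := good_lipschitz r wp wn gt.
apply: (@joint_cvg _ F FF vel C J T xi t y oJ Jt _ _ Tt xiy); first by move=> s x /(HC s x)[].
exact: (is_derive_cont (vel_dy lu0 gt y)).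
Qed.

Lemma cvg_label : label (T z) (xi z) @[z --> F] --> label t y.
Proof.
have [J [oJ Jt _] [C HC]] := label_lipschitz r1 lu0 gt.
apply/subr_cvg0; apply: norm_cvg0.
have c0 : C * (`|xi z - y| + `|T z - t|) @[z --> F] --> (0 : R).
  rewrite -[X in _ --> X](mulr0 C); apply: cvgM; first exact: cvg_cst.
  by rewrite -[X in _ --> X](addr0 0); apply: cvgD; exact: dist_cvg0.
apply: (squeeze_cvgr _ (cvg_cst _) c0).
have : \forall z \near F, J (T z) by apply: Tt; exact: open_nbhs_nbhs.
by apply: filterS => z Jz; rewrite normr_ge0 /= HC.
Qed.

End Limits.

End WeakEquation.

(** * The weak Hunter-Saxton equation *)

Section HunterSaxton.
Context {R : realType}.
Local Notation mu := (@lebesgue_measure R).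
Local Notation mu2 := (@lebesgue_measure R \x @lebesgue_measure R)%E.
Local Notation Int f := (mu.-integrable setT (EFin \o f)).
Implicit Types (y z t s x : R) (g : R -> R).
Variables (r : R) (u0 : R -> R).
Hypotheses (r1 : 1 < r) (lu0 : lie_algebra u0).
Let r0 : 0 < r. Proof. exact: lt_trans r1. Qed.

Local Notation a := (derive1 u0).
Local Notation good := (affine_good unit_fun (rate r u0)).
Local Notation path := (affine_path r unit_fun (rate r u0)).
Local Notation vel := (velocity r unit_fun (rate r u0)).
Local Notation h := (affine_base unit_fun (rate r u0)).
Local Notation label := (label r u0).
Local Notation u := (eulerian (flow r u0)).
Local Notation ux_lag := (ux_lag r u0).
Local Notation uxx_lag := (uxx_lag r u0).
Let wp := unit_W lu0.
Let wn := rate_W r lu0.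

Section Test.
Variables (T al be M : R) (psi : R -> R -> R).
Hypotheses (gT : forall t, 0 < t < T -> good t) (psiC : forall n, Cn2 n psi).
Hypotheses (al0 : 0 < al) (beT : be < T) (spsi : supported al be M psi).

Local Notation psi1 := (Dx psi).
Local Notation psi2 := (Dx (Dx psi)).
Local Notation psit := (Dx (Dt psi)).

Lemma test_cont : [/\ continuous (fun z : R * R => psi z.1 z.2),
  continuous (fun z : R * R => psi1 z.1 z.2), continuous (fun z : R * R => psi2 z.1 z.2)
  & continuous (fun z : R * R => psit z.1 z.2)].
Proof.
by have [c [_ _ [_ [_ _ _ [ct _]]] [c1 [_ _ _ [c2 _]]]]] := psiC 2.
Qed.

Lemma test_dx t x : is_derive x (1 : R) (psi t) (psi1 t x).
Proof. by have [_ [_ d _ _]] := psiC 1; exact: derivable_is_derive. Qed.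

Lemma test_dxx t x : is_derive x (1 : R) (psi1 t) (psi2 t x).
Proof. by have [_ [_ _ _ [_ [_ d _ _]]]] := psiC 2; exact: derivable_is_derive. Qed.

Lemma test_dxt t x : is_derive t (1 : R) (psi1 ^~ x) (psit t x).
Proof.
rewrite (Schwarz t x (psiC 2)).
by have [_ [_ _ _ [_ [d _ _ _]]]] := psiC 2; exact: derivable_is_derive.
Qed.

Definition weak_density t x : R := spow r (Dx u t x) *
  (psit t x - Dx (fun t x => Dx u t x * psi t x) t x + Dx (fun t x => u t x * psi1 t x) t x).

Definition lag_density t y x : R :=
  spow r (ux_lag t y) * (psit t x - uxx_lag t y * psi t x + vel t y * psi2 t x).

Lemma density_sum (p q c d e k : R) : p - (q + c) + (c + e) = p - q + e.
Proof. by ring. Qed.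

(** Leibniz's rule produces the product of [u_x] and [psi_x] twice, with opposite signs. *)
Lemma weak_densityE t x : good t -> weak_density t x = lag_density t (label t x) x.
Proof.
move=> gt.
have d1 := is_derive_fM (ux_dx r1 lu0 gt x) (test_dx t x).
have d2 := is_derive_fM (u_dx r1 lu0 gt x) (test_dxx t x).
have e1 : Dx (fun t x => Dx u t x * psi t x) t x = _ := is_derive1E d1.
have e2 : Dx (fun t x => u t x * psi1 t x) t x = _ := is_derive1E d2.
rewrite /weak_density e1 e2 (Dx_u r1 lu0 gt) (u_lag lu0 gt) /lag_density.
by congr (_ * _); exact: density_sum.
Qed.

Lemma weak_density_supported : supported al be M weak_density.
Proof.
apply: supported_mul; apply: supportedD; first apply: supportedB.
- by apply: supported_Dx; exact: supported_Dt.
- by apply: supported_Dx; exact: supported_mul.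
- by apply: supported_Dx; apply: supported_mul; exact: supported_Dx.
Qed.

Lemma near_good_time t x : 0 < t < T -> \forall z \near (t, x), good z.1.
Proof.
move=> tT; have c1 : z.1 @[z --> (t, x)] --> t by exact: cvg_fst.
have o : open (`]0, T[%classic : set R) by exact: interval_open.
have n : nbhs t (`]0, T[%classic : set R) by apply: open_nbhs_nbhs; split; rewrite //= in_itv.
by apply: filterS (c1 _ n) => z /=; rewrite in_itv /= => /gT.
Qed.

Lemma weak_density_cont : continuous (fun z : R * R => weak_density z.1 z.2).
Proof.
apply: (continuous_glue al0 beT); last by move=> t x /weak_density_supported[].
move=> t x tT; have gt := gT tT; have [c c1 c2 ct] := test_cont.
have z1 : z.1 @[z --> (t, x)] --> t by exact: cvg_fst.
have z2 : z.2 @[z --> (t, x)] --> x by exact: cvg_snd.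
have FF : Filter (nbhs (t, x)) by exact: nbhs_filter.
have zl := cvg_label r1 lu0 FF gt z1 z2.
have L : lag_density z.1 (label z.1 z.2) z.2 @[z --> (t, x)] --> lag_density t (label t x) x.
  apply: cvgM.
    exact: (cvg_comp _ _ (cvg_ux lu0 FF gt z1 zl) (@spow_cont _ r r1 _)).
  apply: cvgD; first apply: cvgB.
  - exact: (ct (t, x)).
  - by apply: cvgM; [exact: (cvg_uxx lu0 FF gt z1 zl)|exact: (c (t, x))].
  - by apply: cvgM; [exact: (cvg_vel lu0 FF gt z1 zl)|exact: (c2 (t, x))].
rewrite (weak_densityE x gt); apply: (cvg_trans _ L); apply: near_eq_cvg.
by apply: filterS (near_good_time x tT) => z gz; rewrite weak_densityE.
Qed.

(* [lag_term] = d_t A, and [space_flux] below is B. *)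
Definition lag_term t y : R := spow r (a y) *
  (a y / r * psi1 t (path t y) + h t y * (psit t (path t y) + psi2 t (path t y) * vel t y)).

Lemma lag_term_out t y : ~ (al <= t <= be) \/ M < `|path t y| -> lag_term t y = 0.
Proof.
move=> H; have s1 := supported_Dx spsi.
rewrite /lag_term (supported_out s1 H) (supported_out (supported_Dx s1) H).
by rewrite (supported_out (supported_Dx (supported_Dt spsi)) H); ring.
Qed.

(** [label] is continuous on the compact set of [(t, x)] with [al <= t <= be] and [|x| <= M], where
    all times are good. This transfers compact support to Lagrangian variables. *)
Lemma label_bound : exists M' : R, forall t y, al <= t <= be -> `|path t y| <= M -> `|y| <= M'.
Proof.
pose D : set (R * R) := `[al, be] `*` `[- M, M].
have kD : compact D by apply: compact_setX; exact: segment_compact.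
have [D0|/set0P D0] := eqVneq D set0.
  exists 0 => t y tb yM; exfalso; have : D (t, path t y) by split; rewrite /= in_itv //= -ler_norml.
  by rewrite D0.
have gD (z : R * R) : D z -> good z.1.
  move=> [/=]; rewrite in_itv /= => /andP[h1 h2] _; apply: gT.
  by rewrite (lt_le_trans al0 h1) (le_lt_trans h2 beT).
have cl : {within D, continuous (fun z : R * R => `|label z.1 z.2|)}.
  apply: continuous_in_subspaceT => -[t x]; rewrite inE => Dz.
  have gt : good t := gD _ Dz.
  have z1 : z.1 @[z --> (t, x)] --> t by exact: cvg_fst.
  have z2 : z.2 @[z --> (t, x)] --> x by exact: cvg_snd.
  have FF : Filter (nbhs (t, x)) by exact: nbhs_filter.
  have cl := cvg_label r1 lu0 FF gt z1 z2.
  exact: (cvg_norm cl).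
have [c _ Hc] := compact_EVT_max D0 kD cl.
exists `|label c.1 c.2| => t y tb yM.
have Dz : D (t, path t y) by split; rewrite /= in_itv //= -ler_norml.
have := Hc (t, path t y); rewrite inE /= => /(_ Dz).
by rewrite (label_path lu0 y (gD _ Dz)).
Qed.

Lemma lag_term_supported : exists M', supported al be M' lag_term.
Proof.
have [M' HM] := label_bound; exists M' => t y k0.
have tb : al <= t <= be.
  by apply: contrapT => n; move: k0; rewrite lag_term_out ?eqxx//; left.
split=> //; apply: (HM t) => //; rewrite leNgt; apply/negP => n.
by move: k0; rewrite lag_term_out ?eqxx//; right.
Qed.

Lemma lag_term_cont : continuous (fun z : R * R => lag_term z.1 z.2).
Proof.
have [M' sK] := lag_term_supported.
apply: (continuous_glue al0 beT); last by move=> t x /sK[].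
move=> t y tT; have gt := gT tT; have [c c1 c2 ct] := test_cont.
have z1 : z.1 @[z --> (t, y)] --> t by exact: cvg_fst.
have z2 : z.2 @[z --> (t, y)] --> y by exact: cvg_snd.
have FF : Filter (nbhs (t, y)) by exact: nbhs_filter.
have za : a z.2 @[z --> (t, y)] --> a y by exact: (cvg_comp _ _ z2 (@datum_cont _ u0 lu0 y)).
have zp := cvg_path lu0 FF gt z1 z2.
have zh := base_cvg lu0 FF z1 z2.
apply: cvgM; first exact: (cvg_comp _ _ za (@spow_cont _ r r1 _)).
apply: cvgD; apply: cvgM.
- by apply: cvgM; [exact: za|exact: cvg_cst].
- exact: (continuous_along FF c1 z1 zp).
- exact: zh.
- apply: cvgD; first exact: (continuous_along FF ct z1 zp).
  by apply: cvgM; [exact: (continuous_along FF c2 z1 zp)|exact: (cvg_vel lu0 FF gt z1 z2)].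
Qed.

Lemma lag_term_dt t y : good t ->
  is_derive t (1 : R) (fun s => spow r (a y) * (h s y * psi1 s (path s y))) (lag_term t y).
Proof.
move=> gt; have [_ _ c2 _] := test_cont.
have dp := aff_Dt r wp wn y gt.
have cG (xi : R -> R) : xi s @[s --> t] --> path t y -> psi2 s (xi s) @[s --> t] --> psi2 t (path t y).
  by move=> xic; exact: (continuous_along _ c2 (@cvg_id _ (nbhs t)) xic).
have d1 := @chain_rule2 _ setT psi1 psi2 (path ^~ y) t _ _ openT I
  (fun s z _ => test_dxx s z) (test_dxt t (path t y)) dp cG.
have dh : is_derive t (1 : R) (fun s => h s y) (a y / r).
  have -> : (fun s => h s y) = (fun s => 1 + a y / r * s).
    by apply/funext => s; rewrite baseE -mulrA [_ * s]mulrC.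
  have := is_derive_fD (is_derive_c 1 t) (is_derive_fM (is_derive_c (a y / r) t) (is_derive_idR t)).
  by move/is_derive_eq; apply; rewrite mul0r mulr1 !add0r.
have := is_derive_fM (is_derive_c (spow r (a y)) t) (is_derive_fM dh d1).
by move/is_derive_eq; apply; rewrite mul0r add0r.
Qed.

Lemma lag_term_time_int y : \int[mu]_t lag_term t y = 0.
Proof.
have [M' sK] := lag_term_supported.
pose A s := spow r (a y) * (h s y * psi1 s (path s y)).
have sA s : ~ (al <= s <= be) -> A s = 0.
  move=> n; rewrite /A (supported_out (supported_Dx spsi)); last by left.
  by rewrite !mulr0.
have cK : continuous (fun t => lag_term t y).
  move=> t; apply: (@continuous_along _ lag_term _ (nbhs t) id (fun=> y) t y) => //.
  - exact: lag_term_cont.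
  - exact: cvg_cst.
have dA t : is_derive t (1 : R) A (lag_term t y).
  (* Times outside [[al, be]] need not be good; there [A] vanishes on an open set of times. *)
  have [tb|tb] := pselect (al <= t <= be).
    apply: lag_term_dt; apply: gT; case/andP: tb => h1 h2.
    by rewrite (lt_le_trans al0 h1) (le_lt_trans h2 beT).
  rewrite lag_term_out; last by left.
  by apply: (is_derive_ext_open (@open_time_out _ al be) tb _ (is_derive_c 0 t)) => s /sA.
apply: (proj2 (@Rint_derive_compact _ A _ (`|al| + `|be|) dA cK _)) => t.
have [tb _|tb] := pselect (al <= t <= be); last by rewrite sA ?eqxx.
case/andP: tb => h1 h2; rewrite ler_norml; apply/andP; split.
  have := ler_norm (- al); have := normr_ge0 be; rewrite normrN; lra.
have := ler_norm be; have := normr_ge0 al; lra.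
Qed.

(** [spow r] is homogeneous of degree [r - 1], so the Jacobian [H^r] leaves one factor [H]. *)
Lemma spow_div (w H P : R) : 0 < H -> P = H `^ r -> spow r (w / H) * P = spow r w * H.
Proof.
move=> H0 ->; have Hn := lt0r_neq0 H0.
rewrite /spow normrM normfV (gtr0_norm H0) powRM ?invr_ge0 ?(ltW H0)//.
rewrite -powR_inv1 ?(ltW H0)// -powRrM.
rewrite -!mulrA; congr (_ * _); rewrite mulrCA; congr (_ * _).
have -> : H `^ (-1 * (r - 2)) * H `^ r = H ^+ 2.
  rewrite -powRD; last by rewrite (negbTE Hn) implybT.
  by rewrite -powR_mulrn ?(ltW H0)//; congr (_ `^ _); ring.
by rewrite powR_inv1 ?(ltW H0)// expr2 mulKf.
Qed.

(** The algebra of [space_flux_dy]: [A] and [A1] stand for the datum slope and its derivative, [w]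
    for [spow r A], [H] for the base, [P] for its [r]-th power, [X] for [spow r] of [u_x]; [p],
    [p1], [p2], [pt] for [psi], [psi_x], [psi_xx], [psi_tx], and [V] for the velocity. *)
Lemma transport_identity (w A A1 H P X t p pt p1 p2 V : R) : H != 0 -> P != 0 ->
  H = 1 + t * A / r -> X * P = w * H ->
  - r^-1 * (r * w * A1 * (P^-1 * p)
      + A * w * (- r * (P^-1 / H) * (t * A1 / r) * p + P^-1 * (p1 * P)))
  = X * (pt - A1 / (H ^+ 2 * P) * p + V * p2) * P - w * (A / r * p1 + H * (pt + p2 * V)).
Proof.
move=> H0 P0 eH eX; have rn := lt0r_neq0 r0.
have tA : t * A = r * (H - 1) by rewrite eH; field.
rewrite [X in _ = X - _]mulrAC eX.
(* Isolates the product [t * A], the only place where the affine form of the base in time is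
   used. *)
transitivity (- r^-1 * (r * w * A1 * (P^-1 * p) - w * (P^-1 / H) * A1 * p * (t * A) + A * w * p1)).
  by field; rewrite H0 P0 rn.
by rewrite tA; field; rewrite H0 P0 rn.
Qed.

Definition space_flux t y : R := - r^-1 * (`|a y| `^ r * (h t y `^ (- r) * psi t (path t y))).

(** Only [|a|^r] is differentiated in [y], and it is of class $C^1$ since [1 < r]. The rougher
    factor [spow r (a y)] is differentiated in time alone, where it is constant. *)
Lemma space_flux_dy t y : good t -> is_derive y (1 : R) (space_flux t)
  (weak_density t (path t y) * h t y `^ r - lag_term t y).
Proof.
move=> gt; have hy := good_gt0 gt y; have hn := lt0r_neq0 hy.
have dN := is_derive_comp (is_derive_norm_pow (a y) r1) (datum1 lu0 y).
have dH := is_derive_pow (- r) hy (base_dy r lu0 t y).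
have dpsi := is_derive_comp (test_dx t (path t y)) (path_dy lu0 y gt).
have := is_derive_fM (is_derive_c (- r^-1) y) (is_derive_fM dN (is_derive_fM dH dpsi)).
move/is_derive_eq; apply; rewrite mul0r add0r.
rewrite (weak_densityE _ gt) (label_path lu0 y gt) /lag_density /lag_term -(spowM _ r1).
have -> : h t y `^ (- r - 1) = (h t y `^ r)^-1 / h t y.
  by rewrite powRD ?(negbTE hn) ?implybT// powRN powR_inv1// ltW.
rewrite powRN.
exact: (transport_identity _ _ _ _ _ _ hn (lt0r_neq0 (powR_gt0 r hy)) (baseE r u0 t y) (spow_div _ hy erefl)).
Qed.

(** After the substitution [x = path t y] the two integrands differ by the [y]-derivative of
    [space_flux t], which has compact support and thus integral 0. *)
Lemma weak_density_transport t : \int[mu]_x weak_density t x = \int[mu]_y lag_term t y.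
Proof.
have [tb|tb] := pselect (al <= t <= be); last first.
  congr (Rintegral _ _ _); apply/funext => x.
  by rewrite lag_term_out ?(supported_out weak_density_supported)//; left.
have gt : good t.
  by case/andP: tb => h1 h2; apply: gT; rewrite (lt_le_trans al0 h1) (le_lt_trans h2 beT).
have [M' sK] := lag_term_supported; have [M1 HM] := label_bound.
have slice (G : R -> R -> R) : continuous (fun z : R * R => G z.1 z.2) -> continuous (G t).
  move=> cG x; apply: (@continuous_along _ G _ (nbhs x) (fun=> t) id t x) => //.
  exact: cvg_cst.
have cF := slice _ weak_density_cont; have cL := slice _ lag_term_cont.
have iF : Int (weak_density t) by apply: (@Int_compact _ _ M cF) => x /weak_density_supported[].
have iL : Int (lag_term t) by apply: (@Int_compact _ _ M' cL) => x /sK[].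
have dg := good_diff lu0 gt.
rewrite (change_var dg cF iF).
have iFp := iffLR (Int_change dg cF) iF.
pose D y := weak_density t (path t y) * h t y `^ r - lag_term t y.
have cP : continuous (fun y => weak_density t (path t y) * (1 + path_slope r unit_fun (rate r u0) t y)).
  move=> y; apply: cvgM.
    exact: (@continuous_comp _ _ _ (path t) (weak_density t) y (is_derive_cont (path_dy lu0 y gt)) (cF (path t y))).
  apply: cvgD; first exact: cvg_cst.
  by case: dg => _ /(_ 0%N) wk _ _; exact: (W_cont wk).
have DE y : D y = weak_density t (path t y) * (1 + path_slope r unit_fun (rate r u0) t y) - lag_term t y.
  by rewrite slope1E.
have cD : continuous D.
  rewrite (funext DE) => y; apply: cvgB; [exact: cP|exact: cL].
have sB y : space_flux t y != 0 -> `|y| <= M1.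
  apply: contraNT => yM; rewrite /space_flux (supported_out spsi) ?mulr0//; right.
  by rewrite ltNge; apply: contra yM; exact: HM.
have [iD D0] := @Rint_derive_compact _ (space_flux t) D M1 (fun y => space_flux_dy y gt) cD sB.
have {}DE y : weak_density t (path t y) * (1 + path_slope r unit_fun (rate r u0) t y) = D y + lag_term t y.
  by rewrite DE subrK.
by rewrite (funext DE) RintegralD// D0 add0r.
Qed.

Lemma weak_density_integral : mu2.-integrable setT (EFin \o (fun z : R * R => weak_density z.1 z.2)) /\
  (\int[mu2]_z (weak_density z.1 z.2)%:E = 0)%E.
Proof.
have [M' sK] := lag_term_supported; split.
  exact: (@integrable_compact_support R (fun z : R * R => weak_density z.1 z.2) al be M
    weak_density_cont (fun z : R * R => @weak_density_supported z.1 z.2)).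
exact (@fubini_transport R weak_density lag_term al be M M' weak_density_cont lag_term_cont
  weak_density_supported sK weak_density_transport lag_term_time_int).
Qed.

End Test.

Lemma eulerian_HS T : (forall t, 0 < t < T -> good t) -> Hunter_Saxton_solution r T u.
Proof.
move=> gT m psi [psiC [al [be [M [al0 beT spsi]]]]].
exact: (weak_density_integral gT psiC al0 beT spsi).
Qed.

End HunterSaxton.

Theorem corollary2p4p1 (R : realType) (r : R) (hr : 1 < r) :
  ~ geodesically_complete r /\
  forall u0 : R -> R, lie_algebra u0 ->
    let phi := flow r u0 in
    let Tstar := - (r / inf (range u0^`())) in
    [/\ forall (T : \bar R) (gamma v : R -> R -> R), (0 < T)%E ->
          geodesic_from r id u0 T gamma v ->
          forall t, time_interval T t -> gamma t = phi t,
        geodesic_exists r id u0 +oo%E <-> (forall x, 0 <= u0^`() x)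
      & (exists x0, u0^`() x0 < 0) ->
        [/\ 0 < Tstar,
            forall T : \bar R, (0 < T)%E ->
              (geodesic_exists r id u0 T <-> (T <= Tstar%:E)%E),
            (forall x, derivable (phi Tstar) x 1) /\
            ((exists x, Dx phi Tstar x = 0) /\
             (forall x, 0 <= Dx phi Tstar x))
          & let u := eulerian phi in
            [/\ forall t, 0 <= t < Tstar -> lie_algebra (u t),
                Hunter_Saxton_solution r Tstar u,
                Proudman_Johnson_solution r^-1 Tstar u
              & blows_up_at Tstar u]]].
Proof.
split; first exact: not_geodesically_complete.
move=> u0 lu0 phi Tstar; split.
- move=> T gamma v T0 gf t Tt; rewrite /phi flowE.
  exact: (geodesic_flow hr gf Tt).
- exact: exists_nonneg.
- move=> [x0 ax0]; have gT := Tstar_good hr lu0 ax0.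
  have gT0 t : 0 < t < Tstar -> affine_good unit_fun (rate r u0) t.
    by case/andP => t0 tT; apply: gT; rewrite (ltW t0).
  split.
  + exact: (Tstar_gt0 hr lu0 ax0).
  + exact: (Tstar_exists hr lu0 ax0).
  + exact: (Tstar_flow hr lu0 ax0).
  + split.
    * move=> t /gT gt; exact: (lie_with_algebra (eulerian_lie_with hr lu0 gt)).
    * exact: (eulerian_HS hr lu0 gT0).
    * exact: (eulerian_PJ hr lu0 gT0).
    * exact: (eulerian_blowup hr lu0 ax0).
Qed.
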